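(* Let $k\ge 1$ be a fixed integer and let $\sigma\ge k+1$. Suppose that $\varepsilon\le C_0N^{-1}$ for a fixed constant $C_0$. Let $u$ be the solution of the boundary value problem $-\varepsilon u''+bu'+cu=f$ on $(0,1)$, $u(0)=u(1)=0$. Let $u_N\in V_N^k$ be the NIPG solution on the Bakhvalov-type mesh with parameter $\sigma$, with penalty parameters $\mu(x_j)=1$ for $0\le j\le N/2$ and $\mu(x_j)=N^2$ for $N/2+1\le j\le N$. Let $L_ku$ be the piecewise Gauss–Lobatto interpolant of $u$ on all of $[0,1]$, and let $\Pi u$ be the composite interpolant of $u$. Then $$\Vert L_{k}u-u_{N}\Vert_{NIPG}+\Vert \Pi u-u_{N}\Vert_{NIPG}\le CN^{-(k+\frac12)},$$ where $C>0$ is independent of $\varepsilon$ and $N$.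
   Context: **Continuous problem.** $\Omega=(0,1)$, $0<\varepsilon\ll1$ is a perturbation parameter, and $u$ solves $-\varepsilon u''(x)+b(x)u'(x)+c(x)u(x)=f(x)$ on $\Omega$, $u(0)=u(1)=0$. Here $b,c,f$ are independent of $\varepsilon$ and sufficiently smooth (of class $C^m(\bar\Omega)$ with $m$ large enough depending only on $k$), $b(x)\ge\alpha>0$ and $c(x)-\frac12 b'(x)\ge\gamma>0$ on $\bar\Omega$, with fixed constants $\alpha,\gamma$. It is known (and may be used) that $u=S+E$ with $LS=f$, $LE=0$ (where $Lv=-\varepsilon v''+bv'+cv$) and $|S^{(l)}(x)|\le C$, $|E^{(l)}(x)|\le C\varepsilon^{-l}e^{-\alpha(1-x)/\varepsilon}$ for $0\le l\le q$, where $q$ can be any given positive integer provided $b,c,f$ are smooth enough. **Mesh.** $N\ge4$ is an even integer. $\tau=1+\frac{\sigma\varepsilon}{\alpha}\ln\varepsilon$ is assumed to satisfy $\tau\ge1/2$. The mesh points are $x_j=\psi(j/N)$, $j=0,\dots,N$, where $\psi(t)=2\tau t$ for $t\in[0,\frac12)$ and $\psi(t)=1+\frac{\sigma\varepsilon}{\alpha}\ln[1+2(1-\varepsilon)(t-1)]$ for $t\in[\frac12,1]$ (so $x_{N/2}=\tau$). $I_j=[x_{j-1},x_j]$, $h_j=x_j-x_{j-1}$. **Spaces, jumps, averages.** $V_N^k=\{v\in L^2(\Omega): v|_{I_j}\in\mathbb P_k(I_j),\ j=1,\dots,N\}$, with $\mathbb P_k$ the polynomials of degree at most $k$. For a piecewise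 smooth function $w$, with one-sided limits $w(x_j^\pm)$: $[w(x_j)]=w(x_j^-)-w(x_j^+)$, $\{w(x_j)\}=\frac12(w(x_j^+)+w(x_j^-))$ for $1\le j\le N-1$; $[w(x_0)]=-w(x_0^+)$, $\{w(x_0)\}=w(x_0^+)$, $[w(x_N)]=w(x_N^-)$, $\{w(x_N)\}=w(x_N^-)$. **NIPG method.** $u_N\in V_N^k$ is the unique solution of $B(u_N,v)=\sum_{j=1}^N\int_{I_j}fv\,dx$ for all $v\in V_N^k$, where $$B(w,v)=\sum_{j=1}^N\int_{I_j}\varepsilon w'v'\,dx-\varepsilon\sum_{j=0}^N\{w'(x_j)\}[v(x_j)]+\varepsilon\sum_{j=0}^N[w(x_j)]\{v'(x_j)\}+\sum_{j=0}^N\mu(x_j)[w(x_j)][v(x_j)]$$ $$\qquad+\sum_{j=1}^N\int_{I_j}b\,w'v\,dx-\sum_{j=0}^{N-1}b(x_j)[w(x_j)]v(x_j^+)+\sum_{j=1}^N\int_{I_j}c\,wv\,dx.$$ **Norm.** For piecewise $H^1$ functions $v$, $$\Vert v\Vert_{NIPG}^2=\varepsilon\sum_{j=1}^N\Vert v'\Vert_{L^2(I_j)}^2+\gamma\sum_{j=1}^N\Vert v\Vert_{L^2(I_j)}^2+\sum_{j=0}^N\left(\mu(x_j)+\tfrac12b(x_j)\right)[v(x_j)]^2.$$ **Interpolants.** On each $I_j$, $L_ku|_{I_j}$ is the Lagrange interpolant of degree $k$ of $u$ at the Gauss–Lobatto points $x_{j-1}=s_0<s_1<\dots<s_k=x_j$,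 where $s_1,\dots,s_{k-1}$ are the zeros of the derivative of the degree-$k$ Legendre polynomial on $I_j$. The Gauss–Radau interpolant $P_hu|_{I_j}\in\mathbb P_k(I_j)$ is defined by $\int_{I_j}(P_hu)v\,dx=\int_{I_j}uv\,dx$ for all $v\in\mathbb P_{k-1}(I_j)$ and $(P_hu)(x_j^-)=u(x_j^-)$. The composite interpolant is $\Pi u|_{I_j}=P_hu|_{I_j}$ for $1\le j\le N/2+1$ (i.e. $I_j\subset[0,x_{N/2+1}]$) and $\Pi u|_{I_j}=L_ku|_{I_j}$ for $N/2+2\le j\le N$ (i.e. $I_j\subset[x_{N/2+1},1]$). **Constants.** $C$ denotes a positive constant independent of $\varepsilon$ and $N$ (it may depend on $k,\sigma,\alpha,\gamma,b,c,f,C_0$). *)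

(* Defs.v *)
From Stdlib Require Import Reals Arith.
From Coquelicot Require Import Coquelicot.
Open Scope R_scope.

(* C^m([0,1]): the derivatives of order at most m exist on (0,1) and extend
   continuously to [0,1].  Derivatives of a function on [0,1] are only
   evaluated in the open interval, because [Derive] is two-sided. *)
Definition C_class (m : nat) (g : R -> R) : Prop :=
  continuous_on (fun x => 0 <= x <= 1) g /\
  forall n, (n <= m)%nat ->
    (forall x, 0 < x < 1 -> ex_derive_n g n x) /\
    exists h : R -> R,
      continuous_on (fun x => 0 <= x <= 1) h /\
      forall x, 0 < x < 1 -> h x = Derive_n g n x.

Definition L_op (eps : R) (b c v : R -> R) (x : R) : R :=
  - eps * Derive_n v 2 x + b x * Derive v x + c x * v x.

Definition bvp_solution (eps : R) (b c f u : R -> R) : Prop :=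
  C_class 2 u /\
  (forall x, 0 < x < 1 -> L_op eps b c u x = f x) /\
  u 0 = 0 /\ u 1 = 0.

(* The a priori splitting of u into a smooth part and an outflow layer, with
   derivative bounds up to order q that are uniform in eps. *)
Definition solution_decomposition (q : nat) (alpha : R) (b c f : R -> R)
  : Prop :=
  exists C : R, forall (eps : R) (u : R -> R),
    0 < eps < 1 -> bvp_solution eps b c f u ->
    exists Sm El : R -> R,
      C_class (Nat.max 2 q) Sm /\ C_class (Nat.max 2 q) El /\
      (forall x, 0 <= x <= 1 -> u x = Sm x + El x) /\
      (forall x, 0 < x < 1 -> L_op eps b c Sm x = f x) /\
      (forall x, 0 < x < 1 -> L_op eps b c El x = 0) /\
      (forall l x, (l <= q)%nat -> 0 < x < 1 ->
         Rabs (Derive_n Sm l x) <= C /\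
         Rabs (Derive_n El l x)
           <= C * / eps ^ l * exp (- alpha * (1 - x) / eps)).

Definition tau (sigma alpha eps : R) : R :=
  1 + sigma * eps / alpha * ln eps.

Definition psi (sigma alpha eps t : R) : R :=
  if Rlt_dec t (1 / 2) then 2 * tau sigma alpha eps * t
  else 1 + sigma * eps / alpha * ln (1 + 2 * (1 - eps) * (t - 1)).

Definition mesh (sigma alpha eps : R) (N j : nat) : R :=
  psi sigma alpha eps (INR j / INR N).

(* A piecewise smooth function is given by its pieces: [w j] is a function on
   R whose restriction to I_j = [x_(j-1), x_j], 1 <= j <= N, is the function in
   question.  Hence w(x_j^-) = w j (x j) and w(x_j^+) = w (S j) (x j). *)

Definition poly_le (k : nat) (p : R -> R) : Prop :=
  exists a : nat -> R, forall t, p t = sum_n (fun i => a i * t ^ i) k.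

Definition V_space (k N : nat) (v : nat -> R -> R) : Prop :=
  forall j, (1 <= j <= N)%nat -> poly_le k (v j).

Definition lim_minus (x : nat -> R) (w : nat -> R -> R) (j : nat) : R :=
  w j (x j).

Definition lim_plus (x : nat -> R) (w : nat -> R -> R) (j : nat) : R :=
  w (S j) (x j).

Definition jump (N : nat) (x : nat -> R) (w : nat -> R -> R) (j : nat) : R :=
  if (j =? 0)%nat then - lim_plus x w j
  else if (j =? N)%nat then lim_minus x w j
  else lim_minus x w j - lim_plus x w j.

Definition avg (N : nat) (x : nat -> R) (w : nat -> R -> R) (j : nat) : R :=
  if (j =? 0)%nat then lim_plus x w j
  else if (j =? N)%nat then lim_minus x w j
  else / 2 * (lim_plus x w j + lim_minus x w j).

Definition broken_derive (w : nat -> R -> R) (j : nat) : R -> R :=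
  Derive (w j).

Definition broken_minus (w v : nat -> R -> R) (j : nat) (t : R) : R :=
  w j t - v j t.

(* g j is the integrand on I_j. *)
Definition broken_int (N : nat) (x : nat -> R) (g : nat -> R -> R) : R :=
  sum_n_m (fun j => RInt (g j) (x (j - 1)%nat) (x j)) 1 N.

Definition penalty (N j : nat) : R :=
  if (j <=? N / 2)%nat then 1 else INR N ^ 2.

Definition nipg_form (eps : R) (b c : R -> R) (mu : nat -> R)
    (N : nat) (x : nat -> R) (w v : nat -> R -> R) : R :=
  let dw := broken_derive w in
  let dv := broken_derive v in
  broken_int N x (fun j t => eps * dw j t * dv j t)
  - eps * sum_n_m (fun j => avg N x dw j * jump N x v j) 0 N
  + eps * sum_n_m (fun j => jump N x w j * avg N x dv j) 0 N
  + sum_n_m (fun j => mu j * jump N x w j * jump N x v j) 0 N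
  + broken_int N x (fun j t => b t * dw j t * v j t)
  - sum_n_m (fun j => b (x j) * jump N x w j * lim_plus x v j) 0 (N - 1)
  + broken_int N x (fun j t => c t * w j t * v j t).

Definition nipg_solution (k : nat) (eps : R) (b c f : R -> R) (mu : nat -> R)
    (N : nat) (x : nat -> R) (uN : nat -> R -> R) : Prop :=
  V_space k N uN /\
  forall v, V_space k N v ->
    nipg_form eps b c mu N x uN v = broken_int N x (fun j t => f t * v j t).

Definition nipg_norm (eps gamma : R) (b : R -> R) (mu : nat -> R)
    (N : nat) (x : nat -> R) (v : nat -> R -> R) : R :=
  sqrt (eps * broken_int N x (fun j t => broken_derive v j t ^ 2)
        + gamma * broken_int N x (fun j t => v j t ^ 2)
        + sum_n_m (fun j => (mu j + / 2 * b (x j)) * jump N x v j ^ 2) 0 N).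

(* Legendre polynomial of degree k on [-1,1], by Rodrigues' formula. *)
Definition legendre (k : nat) (t : R) : R :=
  / (2 ^ k * INR (fact k)) * Derive_n (fun y => (y ^ 2 - 1) ^ k) k t.

Definition lobatto_nodes (k : nat) (s : nat -> R) : Prop :=
  s 0%nat = -1 /\ s k = 1 /\
  (forall i, (i < k)%nat -> s i < s (S i)) /\
  (forall i, (0 < i < k)%nat -> Derive (legendre k) (s i) = 0).

(* The Lobatto points of [l,r] are the affine images of those of [-1,1]. *)
Definition is_lobatto_interp (k : nat) (s : nat -> R) (l r : R)
    (u p : R -> R) : Prop :=
  poly_le k p /\
  forall i, (i <= k)%nat ->
    let si := (l + r) / 2 + (r - l) / 2 * s i in p si = u si.

Definition is_radau_interp (k : nat) (l r : R) (u p : R -> R) : Prop :=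
  poly_le k p /\
  (forall v, poly_le (k - 1) v ->
     RInt (fun t => p t * v t) l r = RInt (fun t => u t * v t) l r) /\
  p r = u r.

Definition lobatto_interpolant (k : nat) (s : nat -> R) (N : nat)
    (x : nat -> R) (u : R -> R) (w : nat -> R -> R) : Prop :=
  forall j, (1 <= j <= N)%nat ->
    is_lobatto_interp k s (x (j - 1)%nat) (x j) u (w j).

Definition composite_interpolant (k : nat) (s : nat -> R) (N : nat)
    (x : nat -> R) (u : R -> R) (w : nat -> R -> R) : Prop :=
  (forall j, (1 <= j <= N / 2 + 1)%nat ->
     is_radau_interp k (x (j - 1)%nat) (x j) u (w j)) /\
  (forall j, (N / 2 + 2 <= j <= N)%nat ->
     is_lobatto_interp k s (x (j - 1)%nat) (x j) u (w j)).

(* Main.v *)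
(* Let [xi = Pi u - u_N] and [w = Pi u - u].  Coercivity and Galerkin
   orthogonality give [||xi||^2 <= B(xi, xi) = B(w, xi)].  Both interpolants
   reproduce the values u(x_j^-), so after integration by parts the upwind flux
   cancels the boundary terms, and every element or node contribution to
   B(w, xi) is at most [C N^-(k+1)] times a local piece of [||xi||]:
   - on the Radau elements w is L^2-orthogonal to P_(k-1) and is itself
     O(N^-(k+1)), since the layer part of u is that small up to x_(N/2+1);
   - on the Lobatto elements h_j <= C eps, and the error for a polynomial of
     degree k+1 is a multiple of (t^2-1) P_k'(t), so that int w' xi' gains one
     order; the weaker bound eps w' = O(N^-k) at the nodes is compensated by
     mu = N^2.
   Young's inequality and summation over the O(N) elements and nodes give
   [||xi||^2 <= C N N^-2(k+1)].  The same local bounds estimate L_k u - Pi u.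
   When eps is not small, N is bounded and only Taylor's formula is needed
   (the layer mesh then degenerates and eps / h_j is unbounded). *)

Require Import Defs.
From Stdlib Require Import Reals Arith Lra Lia Psatz.
From Coquelicot Require Import Coquelicot.
Open Scope R_scope.

(** * Polynomials of bounded degree *)

(** The data [u], [b], [c] are known only on [0,1], whereas derivatives and traces are taken up to
    the end nodes. Each is therefore replaced by a function that is C^1 on the whole line and agrees
    with it on [0,1]; integrability and integration by parts then need no care at the ends of an
    element. An interpolant enters only through its defining equations. Its error is compared with
    that of a local polynomial [T] by sup-norm stability, and stability comes from bounding a
    polynomial by its values at separated points, with constants that depend on the degree alone.
    What layer and mesh contribute is condensed into the local inequalities [coarse_ok] and
    [fine_ok]. On coarse elements with small [eps] the layer part is approximated by zero and [T]
    expands the smooth part; on fine elements the whole solution is expanded, since the graded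
    widths offset the factors 1/eps of its derivatives. An inverse estimate costs 1/h, and bounding
    [eps] times a power of [N] times the sup error by [h] is designed to pay for it. The norm stays
    squared until the end, so that local bounds simply add up. *)

Lemma poly_le_ext n p q : (forall t, p t = q t) -> poly_le n p -> poly_le n q.
Proof. intros H [a Ha]; exists a; intros t; rewrite <- H; apply Ha. Qed.

Lemma poly_le_0 p : poly_le 0 p <-> exists a, forall t, p t = a.
Proof.
  split; intros [a Ha].
  - exists (a 0%nat); intros t; rewrite Ha, sum_O; simpl; ring.
  - exists (fun _ => a); intros t; rewrite Ha, sum_O; simpl; ring.
Qed.

(** The induction principle for polynomials used throughout: splitting off the top monomial lowers
    the degree. *)
Lemma poly_le_S n p :
  poly_le (S n) p <->
  exists q a, poly_le n q /\ forall t, p t = q t + a * t ^ S n.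
Proof.
  split.
  - intros [a Ha].
    exists (fun t => sum_n (fun i => a i * t ^ i) n), (a (S n)).
    split; [now exists a|].
    intros t; rewrite Ha, sum_Sn; reflexivity.
  - intros (q & c & [a Ha] & Hp).
    exists (fun i => if (i =? S n)%nat then c else a i); intros t.
    rewrite sum_Sn, Nat.eqb_refl, Hp, Ha; unfold plus; simpl.
    f_equal; apply sum_n_ext_loc; intros i Hi.
    replace (i =? S n)%nat with false; [easy|].
    symmetry; apply Nat.eqb_neq; lia.
Qed.

Lemma poly_le_const n c : poly_le n (fun _ => c).
Proof.
  induction n as [|n IH]; [apply poly_le_0; now exists c|].
  apply poly_le_S; exists (fun _ => c), 0; split; [easy|intros; ring].
Qed.

Lemma poly_le_lin n a b p q :
  poly_le n p -> poly_le n q -> poly_le n (fun t => a * p t + b * q t).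
Proof.
  intros [c Hc] [d Hd]; exists (fun i => a * c i + b * d i); intros t.
  rewrite Hc, Hd; clear; induction n as [|n IH].
  - rewrite !sum_O; ring.
  - rewrite !sum_Sn, <- IH; unfold plus; simpl; ring.
Qed.

Lemma poly_le_plus n p q :
  poly_le n p -> poly_le n q -> poly_le n (fun t => p t + q t).
Proof.
  intros Hp Hq; apply (poly_le_ext n (fun t => 1 * p t + 1 * q t));
    [intros; ring | now apply poly_le_lin].
Qed.

Lemma poly_le_minus n p q :
  poly_le n p -> poly_le n q -> poly_le n (fun t => p t - q t).
Proof.
  intros Hp Hq; apply (poly_le_ext n (fun t => 1 * p t + (-1) * q t));
    [intros; ring | now apply poly_le_lin].
Qed.

Lemma poly_le_scal n a p : poly_le n p -> poly_le n (fun t => a * p t).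
Proof.
  intros Hp; apply (poly_le_ext n (fun t => a * p t + 0 * p t));
    [intros; ring | now apply poly_le_lin].
Qed.

Lemma poly_le_weaken n m p : (n <= m)%nat -> poly_le n p -> poly_le m p.
Proof.
  induction 1 as [|m _ IH]; [easy|]; intros Hp.
  apply poly_le_S; exists p, 0; split; [auto|intros; ring].
Qed.

Lemma poly_le_mulX n p : poly_le n p -> poly_le (S n) (fun t => t * p t).
Proof.
  revert p; induction n as [|n IH]; intros p Hp.
  - apply poly_le_0 in Hp as [a Ha]; apply poly_le_S.
    exists (fun _ => 0), a; split; [apply poly_le_const|].
    intros t; rewrite Ha; ring.
  - apply poly_le_S in Hp as (q & a & Hq & Hp); apply poly_le_S.
    exists (fun t => t * q t), a; split; [now apply IH|].
    intros t; rewrite Hp; simpl; ring.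
Qed.

Lemma poly_le_mul_pow n j p :
  poly_le n p -> poly_le (n + j) (fun t => t ^ j * p t).
Proof.
  intros Hp; induction j as [|j IH].
  - rewrite Nat.add_0_r; apply (poly_le_ext n p); [intros; simpl; ring|easy].
  - rewrite Nat.add_succ_r; apply poly_le_mulX in IH.
    eapply poly_le_ext; [|exact IH]; intros; simpl; ring.
Qed.

Lemma poly_le_mul n m p q :
  poly_le n p -> poly_le m q -> poly_le (n + m) (fun t => p t * q t).
Proof.
  intros Hp; revert q; induction m as [|m IH]; intros q Hq.
  - apply poly_le_0 in Hq as [a Ha]; rewrite Nat.add_0_r.
    apply (poly_le_ext n (fun t => a * p t));
      [intros; rewrite Ha; ring | now apply poly_le_scal].
  - apply poly_le_S in Hq as (r & a & Hr & Hq).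
    apply (poly_le_ext _ (fun t => 1 * (p t * r t) + a * (t ^ S m * p t)));
      [intros; rewrite Hq; ring|].
    apply poly_le_lin; [|now apply poly_le_mul_pow].
    apply poly_le_weaken with (n + m)%nat; [lia|now apply IH].
Qed.

Lemma poly_le_id : poly_le 1 (fun t => t).
Proof.
  eapply poly_le_ext; [|apply (poly_le_mulX 0 (fun _ => 1)), poly_le_const].
  intros; simpl; ring.
Qed.

Lemma poly_le_affine n a b p :
  poly_le n p -> poly_le n (fun t => p (a + b * t)).
Proof.
  assert (Haff : poly_le 1 (fun t => a + b * t)).
  { apply poly_le_plus; [apply poly_le_const|].
    apply poly_le_scal, poly_le_id. }
  assert (Hpow : forall m, poly_le m (fun t => (a + b * t) ^ m)).
  { induction m as [|m IH]; [exact (poly_le_const 0 1)|].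
    exact (poly_le_mul 1 m _ _ Haff IH). }
  revert p; induction n as [|n IH]; intros p Hp.
  - apply poly_le_0 in Hp as [c Hc]; apply poly_le_0; exists c; auto.
  - apply poly_le_S in Hp as (q & c & Hq & Hp).
    apply (poly_le_ext _ (fun t => q (a + b * t) + c * (a + b * t) ^ S n));
      [intros; now rewrite Hp|].
    apply poly_le_plus; [|apply poly_le_scal, Hpow].
    apply poly_le_weaken with n; [lia|auto].
Qed.

Lemma is_derive_monomial c n (x : R) :
  is_derive (fun t => c * t ^ S n) x (c * INR (S n) * x ^ n).
Proof.
  auto_derive; [easy|].
  change (c * (1 * (INR (S n) * x ^ n)) = c * INR (S n) * x ^ n); ring.
Qed.

Lemma poly_le_is_derive n p :
  poly_le n p ->
  exists q, poly_le (pred n) q /\ forall x, is_derive p x (q x).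
Proof.
  revert p; induction n as [|n IH]; intros p Hp.
  - apply poly_le_0 in Hp as [c Hc]; exists (fun _ => 0).
    split; [apply poly_le_const|]; intros x.
    apply (is_derive_ext (fun _ => c)); [auto|].
    apply (is_derive_const (V := R_NormedModule) c x).
  - apply poly_le_S in Hp as (q & c & Hq & Hp).
    destruct (IH q Hq) as (r & Hr & Hd).
    exists (fun t => r t + (c * INR (S n)) * t ^ n); split.
    + apply poly_le_plus; [apply poly_le_weaken with (pred n); [simpl; lia|easy]|].
      apply poly_le_scal; simpl.
      eapply poly_le_ext; [|apply (poly_le_mul_pow 0 n (fun _ => 1)), poly_le_const].
      intros; simpl; ring.
    + intros x.
      apply (is_derive_ext (fun t => q t + c * t ^ S n)); [intros; now rewrite Hp|].
      apply (is_derive_plus (V := R_NormedModule)); [apply Hd|].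
      apply is_derive_monomial.
Qed.

Lemma poly_le_antiderive n p a c :
  poly_le n p ->
  exists q, poly_le (S n) q /\ q a = c /\ forall x, is_derive q x (p x).
Proof.
  revert p c; induction n as [|n IH]; intros p c Hp.
  - apply poly_le_0 in Hp as [d Hd]; exists (fun t => c + d * (t - a)).
    split; [|split; [ring|]].
    + apply (poly_le_ext _ (fun t => (c - d * a) + d * t)); [intros; ring|].
      apply poly_le_plus; [apply poly_le_const|apply poly_le_scal, poly_le_id].
    + intros x; rewrite Hd; auto_derive; [easy|ring].
  - apply poly_le_S in Hp as (r & d & Hr & Hp).
    destruct (IH r (c - d / INR (S (S n)) * a ^ S (S n)) Hr) as (q & Hq & Ha & Hd).
    assert (HN : INR (S (S n)) <> 0) by (apply not_0_INR; lia).
    exists (fun t => q t + d / INR (S (S n)) * t ^ S (S n)); split; [|split].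
    + apply poly_le_S; now exists q, (d / INR (S (S n))).
    + rewrite Ha; ring.
    + intros x; rewrite Hp.
      apply (is_derive_plus (V := R_NormedModule)); [apply Hd|].
      replace (d * x ^ S n) with (d / INR (S (S n)) * INR (S (S n)) * x ^ S n)
        by (field; easy).
      apply is_derive_monomial.
Qed.

Lemma pow_sub_factor n t0 :
  exists r, poly_le n r /\ forall t, t ^ S n - t0 ^ S n = (t - t0) * r t.
Proof.
  induction n as [|n (r & Hr & H)].
  - exists (fun _ => 1); split; [apply poly_le_const|intros; simpl; ring].
  - exists (fun t => t * r t + t0 ^ S n); split.
    + apply poly_le_plus; [now apply poly_le_mulX|apply poly_le_const].
    + intros t.
      replace (t ^ S (S n) - t0 ^ S (S n))
        with (t * (t ^ S n - t0 ^ S n) + (t - t0) * t0 ^ S n) by (simpl; ring).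
      rewrite H; ring.
Qed.

(** Dividing out one node lowers the degree; this drives the induction over nodes and, with [t0] the
    right end of the element, the Radau analysis. *)
Lemma poly_le_factor n p t0 :
  poly_le (S n) p ->
  exists q, poly_le n q /\ forall t, p t = p t0 + (t - t0) * q t.
Proof.
  revert p; induction n as [|n IH]; intros p Hp.
  - apply poly_le_S in Hp as (q & a & Hq & Hp).
    apply poly_le_0 in Hq as [c Hc].
    exists (fun _ => a); split; [apply poly_le_const|].
    intros t; rewrite !Hp, !Hc; ring.
  - apply poly_le_S in Hp as (q & a & Hq & Hp).
    destruct (IH q Hq) as (r & Hr & H).
    destruct (pow_sub_factor (S n) t0) as (r' & Hr' & H').
    exists (fun t => r t + a * r' t); split.
    + apply poly_le_plus; [apply poly_le_weaken with n; [lia|easy]|].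
      now apply poly_le_scal.
    + intros t; rewrite (Hp t), (Hp t0), (H t).
      replace (t ^ S (S n)) with (t0 ^ S (S n) + (t - t0) * r' t)
        by (rewrite <- H'; ring).
      ring.
Qed.

Lemma poly_le_ex_derive n p : poly_le n p -> forall x, ex_derive p x.
Proof.
  intros Hp x; destruct (poly_le_is_derive n p Hp) as (q & _ & Hq).
  now exists (q x).
Qed.

Lemma poly_le_Derive n p : poly_le n p -> poly_le (pred n) (Derive p).
Proof.
  intros Hp; destruct (poly_le_is_derive n p Hp) as (q & Hq & H).
  apply (poly_le_ext _ q); [|easy].
  intros t; symmetry; now apply is_derive_unique.
Qed.

Lemma poly_le_continuous n p : poly_le n p -> forall x, continuous p x.
Proof. intros Hp x; apply (ex_derive_continuous p), (poly_le_ex_derive n p Hp). Qed.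

(** * Inverse estimates *)

(** Continuity is asked on the whole line rather than on an element, so that every integrability
    condition is met for arbitrary end points. *)
Definition cont (f : R -> R) : Prop := forall x : R, continuous f x.

Lemma cont_ext f g : (forall t, f t = g t) -> cont f -> cont g.
Proof. intros H Hf x; exact (continuous_ext f g x H (Hf x)). Qed.

Lemma cont_const c : cont (fun _ => c).
Proof. intros x; apply continuous_const. Qed.

Lemma cont_id : cont (fun t => t).
Proof. intros x; apply continuous_id. Qed.

Lemma cont_plus f g : cont f -> cont g -> cont (fun t => f t + g t).
Proof. intros Hf Hg x; apply (continuous_plus f g x (Hf x) (Hg x)). Qed.

Lemma cont_minus f g : cont f -> cont g -> cont (fun t => f t - g t).
Proof. intros Hf Hg x; apply (continuous_minus f g x (Hf x) (Hg x)). Qed.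

Lemma cont_opp f : cont f -> cont (fun t => - f t).
Proof. intros Hf x; apply (continuous_opp f x (Hf x)). Qed.

Lemma cont_mult f g : cont f -> cont g -> cont (fun t => f t * g t).
Proof. intros Hf Hg x; apply (continuous_mult f g x (Hf x) (Hg x)). Qed.

Lemma cont_pow f n : cont f -> cont (fun t => f t ^ n).
Proof.
  intros Hf; induction n as [|n IH]; simpl; [apply cont_const|].
  now apply cont_mult.
Qed.

Ltac solve_cont :=
  lazymatch goal with
  | |- cont (fun t => @?f t + @?g t) => apply (cont_plus f g); solve_cont
  | |- cont (fun t => @?f t - @?g t) => apply (cont_minus f g); solve_cont
  | |- cont (fun t => - @?f t) => apply (cont_opp f); solve_cont
  | |- cont (fun t => @?f t * @?g t) => apply (cont_mult f g); solve_cont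
  | |- cont (fun t => @?f t ^ ?n) => apply (cont_pow f n); solve_cont
  | |- cont (fun t => t) => apply cont_id
  | |- cont (fun _ => ?c) => first [apply (cont_const c) | solve [eauto]]
  | |- _ => solve [eauto]
  end.

Lemma cont_ex_RInt f a b : cont f -> ex_RInt f a b.
Proof. intros Hf; apply (ex_RInt_continuous (V := R_CompleteNormedModule)); auto. Qed.

Lemma RInt_cont_plus f g a b :
  cont f -> cont g -> RInt (fun t => f t + g t) a b = RInt f a b + RInt g a b.
Proof. intros; apply (RInt_plus (V := R_CompleteNormedModule)); now apply cont_ex_RInt. Qed.

Lemma RInt_cont_minus f g a b :
  cont f -> cont g -> RInt (fun t => f t - g t) a b = RInt f a b - RInt g a b.
Proof. intros; apply (RInt_minus (V := R_CompleteNormedModule)); now apply cont_ex_RInt. Qed.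

Lemma RInt_cont_scal f c a b :
  cont f -> RInt (fun t => c * f t) a b = c * RInt f a b.
Proof. intros; apply (RInt_scal (V := R_CompleteNormedModule)); now apply cont_ex_RInt. Qed.

Lemma RInt_cont_ge_0 f a b :
  a <= b -> cont f -> (forall t, a < t < b -> 0 <= f t) -> 0 <= RInt f a b.
Proof. intros; apply RInt_ge_0; [easy|now apply cont_ex_RInt|easy]. Qed.

Lemma RInt_cont_le f g a b :
  a <= b -> cont f -> cont g -> (forall t, a < t < b -> f t <= g t) ->
  RInt f a b <= RInt g a b.
Proof. intros; apply RInt_le; try easy; now apply cont_ex_RInt. Qed.

Lemma RInt_const_R c a b : RInt (fun _ => c) a b = (b - a) * c.
Proof. apply (RInt_const (V := R_CompleteNormedModule)). Qed.

Ltac ringR :=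
  match goal with |- @eq _ ?a ?b => change (@eq R a b) end; ring.

Ltac fieldR :=
  match goal with |- @eq _ ?a ?b => change (@eq R a b) end; field.

Lemma RInt_abs_le f a b A :
  a <= b -> cont f -> (forall t, a <= t <= b -> Rabs (f t) <= A) ->
  Rabs (RInt f a b) <= (b - a) * A.
Proof.
  intros Hab Hf HA; apply Rabs_le; split.
  - replace (- ((b - a) * A)) with (RInt (fun _ => - A) a b)
      by (rewrite RInt_const_R; ringR).
    apply RInt_cont_le; auto using cont_const; intros t Ht.
    specialize (HA t ltac:(lra)); apply Rabs_le_between in HA; lra.
  - rewrite <- (RInt_const_R A a b).
    apply RInt_cont_le; auto using cont_const; intros t Ht.
    specialize (HA t ltac:(lra)); apply Rabs_le_between in HA; lra.
Qed.

Lemma RInt_sub_le f l a b r :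
  l <= a -> a <= b -> b <= r -> cont f -> (forall t, l < t < r -> 0 <= f t) ->
  RInt f a b <= RInt f l r.
Proof.
  intros Hla Hab Hbr Hf H0.
  pose proof (cont_ex_RInt f) as Hex.
  rewrite <- (RInt_Chasles (V := R_CompleteNormedModule) f l a r) by auto.
  rewrite <- (RInt_Chasles (V := R_CompleteNormedModule) f a b r) by auto.
  unfold plus; simpl.
  assert (0 <= RInt f l a) by (apply RInt_cont_ge_0; auto; intros; apply H0; lra).
  assert (0 <= RInt f b r) by (apply RInt_cont_ge_0; auto; intros; apply H0; lra).
  lra.
Qed.

Lemma one_le_mult a b : 1 <= a -> 1 <= b -> 1 <= a * b.
Proof. nra. Qed.

(** Differentiability is required everywhere because the two-sided [Derive] is integrated and
    evaluated up to the ends of an element. *)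
Definition cdiff (f : R -> R) : Prop :=
  (forall x : R, ex_derive f x) /\ cont (Derive f).

Lemma cdiff_cont f : cdiff f -> cont f.
Proof. intros [H _] x; now apply (ex_derive_continuous f). Qed.

Lemma cdiff_cont_Derive f : cdiff f -> cont (Derive f).
Proof. now intros [_ H]. Qed.

Lemma cdiff_is_derive f : cdiff f -> forall x, is_derive f x (Derive f x).
Proof. intros [H _] x; now apply Derive_correct. Qed.

Lemma cdiff_intro f g : (forall x, is_derive f x (g x)) -> cont g -> cdiff f.
Proof.
  intros H Hg; split; [intros x; now exists (g x)|].
  apply (cont_ext g); [|easy]; intros; symmetry; now apply is_derive_unique.
Qed.

Lemma poly_le_cdiff n p : poly_le n p -> cdiff p.
Proof.
  intros Hp; split; [now apply (poly_le_ex_derive n)|].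
  intros x; apply (poly_le_continuous (pred n)), poly_le_Derive, Hp.
Qed.

Lemma is_derive_mult_R f g f' g' (x : R) :
  is_derive f x f' -> is_derive g x g' ->
  is_derive (fun t => f t * g t) x (f' * g x + f x * g').
Proof.
  intros Hf Hg; apply (is_derive_mult f g x f' g' Hf Hg).
  intros; apply Rmult_comm.
Qed.

Lemma is_derive_minus_R f g f' g' (x : R) :
  is_derive f x f' -> is_derive g x g' ->
  is_derive (fun t => f t - g t) x (f' - g').
Proof. apply (is_derive_minus (V := R_NormedModule)). Qed.

Lemma is_derive_plus_R f g f' g' (x : R) :
  is_derive f x f' -> is_derive g x g' ->
  is_derive (fun t => f t + g t) x (f' + g').
Proof. apply (is_derive_plus (V := R_NormedModule)). Qed.

Lemma cdiff_mult f g : cdiff f -> cdiff g -> cdiff (fun t => f t * g t).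
Proof.
  intros Hf Hg.
  apply (cdiff_intro _ (fun t => Derive f t * g t + f t * Derive g t)).
  - intros x; apply is_derive_mult_R; now apply cdiff_is_derive.
  - pose proof (cdiff_cont f Hf); pose proof (cdiff_cont g Hg);
    pose proof (cdiff_cont_Derive f Hf); pose proof (cdiff_cont_Derive g Hg).
    solve_cont.
Qed.

Lemma cdiff_minus f g : cdiff f -> cdiff g -> cdiff (fun t => f t - g t).
Proof.
  intros Hf Hg.
  apply (cdiff_intro _ (fun t => Derive f t - Derive g t)).
  - intros x; apply is_derive_minus_R; now apply cdiff_is_derive.
  - pose proof (cdiff_cont_Derive f Hf); pose proof (cdiff_cont_Derive g Hg).
    solve_cont.
Qed.

Lemma Derive_mult_cdiff f g x :
  cdiff f -> cdiff g ->
  Derive (fun t => f t * g t) x = Derive f x * g x + f x * Derive g x.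
Proof. intros [Hf _] [Hg _]; now apply Derive_mult. Qed.

Lemma Derive_minus_cdiff f g x :
  cdiff f -> cdiff g -> Derive (fun t => f t - g t) x = Derive f x - Derive g x.
Proof. intros [Hf _] [Hg _]; now apply Derive_minus. Qed.

Lemma RInt_Derive_cdiff f a b : cdiff f -> RInt (Derive f) a b = f b - f a.
Proof.
  intros Hf; apply RInt_Derive; intros; [now apply Hf|apply Hf].
Qed.

Lemma RInt_by_parts f g a b :
  cdiff f -> cdiff g ->
  RInt (fun t => Derive f t * g t) a b =
  f b * g b - f a * g a - RInt (fun t => f t * Derive g t) a b.
Proof.
  intros Hf Hg.
  pose proof (cdiff_cont f Hf); pose proof (cdiff_cont g Hg);
  pose proof (cdiff_cont_Derive f Hf); pose proof (cdiff_cont_Derive g Hg).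
  pose proof (RInt_Derive_cdiff _ a b (cdiff_mult f g Hf Hg)) as HI.
  rewrite (RInt_ext _ (fun t => Derive f t * g t + f t * Derive g t)) in HI
    by (intros; now apply Derive_mult_cdiff).
  rewrite RInt_cont_plus in HI by solve_cont.
  lra.
Qed.

(* Each [A i] is a node known only up to its position in a set: the nodes may
   be given points or unspecified points of prescribed intervals. *)
Lemma poly_nodes_bound n delta :
  0 < delta ->
  exists C, 1 <= C /\
  forall (A : nat -> R -> Prop) l h p M,
  0 < h -> 0 <= M -> poly_le n p ->
  (forall i, (i <= n)%nat ->
     exists t, A i t /\ l <= t <= l + h /\ Rabs (p t) <= M) ->
  (forall i j t t', (i < j <= n)%nat -> A i t -> A j t' ->
     delta * h <= Rabs (t - t')) ->
  forall x, l <= x <= l + h ->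
  Rabs (p x) <= C * M /\ Rabs (Derive p x) <= C * M / h.
Proof.
  intros Hd; induction n as [|n (C & HC & IH)].
  - exists 1; split; [lra|]; intros A l h p M Hh HM Hp Hn _ x Hx.
    destruct (Hn 0%nat (le_n _)) as (t & _ & _ & Ht).
    apply poly_le_0 in Hp as [a Ha]; split.
    + rewrite (Ha x), <- (Ha t); lra.
    + rewrite (Derive_ext _ (fun _ => a)) by auto.
      rewrite Derive_const, Rabs_R0.
      apply Rdiv_le_0_compat; lra.
  - exists (1 + 4 * C / delta).
    assert (H0 : 0 <= C / delta) by (apply Rdiv_le_0_compat; lra).
    split; [lra|].
    intros A l h p M Hh HM Hp Hn Hsep x Hx.
    destruct (Hn 0%nat ltac:(lia)) as (t0 & HA0 & Ht0 & Hpt0).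
    destruct (poly_le_factor n p t0 Hp) as (q & Hq & Hpq).
    assert (Hdh : 0 < delta * h) by nra.
    (* At every other node [t], [q t = (p t - p t0) / (t - t0)], with numerator at most [2 * M] and
       denominator at least [delta * h] in absolute value. *)
    set (M' := 2 * M / (delta * h)).
    assert (HM' : 0 <= M') by (apply Rdiv_le_0_compat; lra).
    destruct (IH (fun i => A (S i)) l h q M' Hh HM' Hq) with (x := x) as [Hqx Hqx'];
      [| |easy|].
    { intros i Hi; destruct (Hn (S i) ltac:(lia)) as (t & HAt & Ht & Hpt).
      exists t; split; [easy|]; split; [easy|].
      assert (Hs := Hsep 0%nat (S i) t0 t ltac:(lia) HA0 HAt).
      rewrite Rabs_minus_sym in Hs.
      apply Rle_div_r; [lra|].
      apply Rle_trans with (Rabs (q t) * Rabs (t - t0)).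
      - apply Rmult_le_compat_l; [apply Rabs_pos|easy].
      - rewrite <- Rabs_mult.
        replace (q t * (t - t0)) with (p t - p t0) by (rewrite (Hpq t); ring).
        eapply Rle_trans; [apply Rabs_triang|].
        rewrite Rabs_Ropp; lra. }
    { intros i j t t' Hij Hi Hj; apply (Hsep (S i) (S j)); auto; lia. }
    assert (Hxt : Rabs (x - t0) <= h) by (apply Rabs_le; lra).
    assert (E : C * M' * h = 2 * (C / delta) * M) by (unfold M'; field; lra).
    assert (Hq0 := Rabs_pos (q x)).
    split.
    + rewrite (Hpq x).
      eapply Rle_trans; [apply Rabs_triang|]; rewrite Rabs_mult.
      assert (Rabs (x - t0) * Rabs (q x) <= h * (C * M'))
        by (apply Rmult_le_compat; auto using Rabs_pos).
      nra.
    + rewrite (Derive_ext _ _ x Hpq).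
      assert (HqC := poly_le_cdiff n q Hq).
      rewrite (is_derive_unique _ x (q x + (x - t0) * Derive q x)).
      2:{ apply (is_derive_ext (fun t => p t0 + (t - t0) * q t)); [easy|].
          replace (q x + (x - t0) * Derive q x)
            with (0 + (1 * q x + (x - t0) * Derive q x)) by ring.
          apply is_derive_plus_R; [apply (is_derive_const (V := R_NormedModule))|].
          apply (is_derive_mult_R (fun t => t - t0)); [|now apply cdiff_is_derive].
          auto_derive; [easy|ring]. }
      eapply Rle_trans; [apply Rabs_triang|]; rewrite Rabs_mult.
      assert (H1 : Rabs (x - t0) * Rabs (Derive q x) <= h * (C * M' / h))
        by (apply Rmult_le_compat; auto using Rabs_pos).
      replace (h * (C * M' / h)) with (C * M') in H1 by (field; lra).
      apply Rle_div_r; [easy|].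
      nra.
Qed.

(** On each of [n + 1] separated subintervals the minimum of [q ^ 2] is bounded by the integral, and
    the minimisers serve as nodes for [poly_nodes_bound]. The weight vanishing at [r] is the one
    that Radau orthogonality produces; bounding it by [r - l] gives the plain inverse estimate. *)
Lemma poly_weighted_inverse n :
  exists C, 1 <= C /\
  forall l r q, l < r -> poly_le n q ->
  forall x, l <= x <= r ->
  (r - l) ^ 2 * q x ^ 2 <= C * RInt (fun t => (r - t) * q t ^ 2) l r.
Proof.
  set (D := 2 * INR n + 2).
  assert (HD : 2 <= D) by (pose proof (pos_INR n); unfold D; lra).
  destruct (poly_nodes_bound n (/ D)) as (C & HC & HB).
  { apply Rinv_0_lt_compat; lra. }
  exists (C ^ 2 * D ^ 2); split.
  { apply one_le_mult; apply pow_R1_Rle; lra. }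
  intros l r q Hlr Hq x Hx.
  set (w := fun t => (r - t) * q t ^ 2).
  assert (Hqc : cont q) by (exact (poly_le_continuous n q Hq)).
  assert (Hw : cont w) by (unfold w; solve_cont).
  assert (Hw0 : forall t, l < t < r -> 0 <= w t).
  { intros t Ht; unfold w; pose proof (pow2_ge_0 (q t)); nra. }
  set (I := RInt w l r).
  assert (HI : 0 <= I) by (apply RInt_cont_ge_0; auto; lra).
  set (d := (r - l) / D).
  assert (Hd : 0 < d) by (apply Rdiv_lt_0_compat; lra).
  assert (HdD : d * D = r - l) by (unfold d; field; lra).
  (* Since [D = 2 n + 2], the [n + 1] subintervals of length [d] are separated by gaps of length
     [d], and the last one ends at [r - d], where the weight is still [d]. *)
  set (J := fun i t => l + 2 * INR i * d <= t <= l + (2 * INR i + 1) * d).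
  destruct (HB J l (r - l) q (sqrt I / d)) with (x := x) as [Hqx _];
    [lra | | easy | | | lra |].
  - apply Rdiv_le_0_compat; [apply sqrt_pos|easy].
  - intros i Hi; apply le_INR in Hi.
    pose proof (pos_INR i) as Hi0.
    assert (Hend : l + (2 * INR i + 1) * d <= r - d).
    { unfold D in HdD; nra. }
    destruct (continuity_ab_min (fun t => q t ^ 2) (l + 2 * INR i * d)
      (l + (2 * INR i + 1) * d)) as (t & Hmin & Ht).
    { nra. }
    { intros c _; apply continuity_pt_filterlim.
      assert (Hc : cont (fun t => q t ^ 2)) by solve_cont; apply Hc. }
    exists t; split; [easy|]; split; [nra|].
    apply Rle_div_r; [easy|].
    rewrite <- (Rabs_right d) by lra; rewrite <- Rabs_mult, <- sqrt_Rsqr_abs.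
    apply sqrt_le_1_alt; unfold Rsqr.
    apply Rle_trans with (RInt w (l + 2 * INR i * d) (l + (2 * INR i + 1) * d)).
    + replace (q t * d * (q t * d))
        with (RInt (fun _ => d * q t ^ 2) (l + 2 * INR i * d)
                (l + (2 * INR i + 1) * d)) by (rewrite RInt_const_R; ringR).
      apply RInt_cont_le; [nra|apply cont_const|easy|].
      intros y Hy; unfold w; apply Rmult_le_compat; [lra|apply pow2_ge_0|lra|].
      apply Hmin; lra.
    + apply RInt_sub_le; auto; nra.
  - intros i j t t' [Hij _] Hi Hj; unfold J in Hi, Hj.
    apply Nat.le_succ_l, le_INR in Hij; rewrite S_INR in Hij.
    replace (/ D * (r - l)) with d by (unfold d; field; lra).
    rewrite Rabs_minus_sym, Rabs_right; nra.
  - fold w I.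
    assert (H2 : q x ^ 2 <= (C * (sqrt I / d)) ^ 2).
    { rewrite <- (pow2_abs (q x)); apply pow_incr; split; [apply Rabs_pos|easy]. }
    replace ((C * (sqrt I / d)) ^ 2) with (C ^ 2 * (sqrt I) ^ 2 / d ^ 2) in H2
      by (field; lra).
    rewrite pow2_sqrt in H2 by easy.
    apply Rle_trans with ((r - l) ^ 2 * (C ^ 2 * I / d ^ 2)).
    + apply Rmult_le_compat_l; [apply pow2_ge_0|easy].
    + right; rewrite <- HdD; field; lra.
Qed.

Lemma poly_markov k :
  exists C, 1 <= C /\
  forall l r p M, l < r -> 0 <= M -> poly_le k p ->
  (forall x, l <= x <= r -> Rabs (p x) <= M) ->
  forall x, l <= x <= r -> (r - l) * Rabs (Derive p x) <= C * M.
Proof.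
  pose proof (pos_INR k) as Hk.
  assert (Hi : 0 < / (INR k + 1)) by (apply Rinv_0_lt_compat; lra).
  destruct (poly_nodes_bound k (/ (INR k + 1)) Hi) as (C & HC & HB).
  exists C; split; [easy|]; intros l r p M Hlr HM Hp HpM x Hx.
  (* Equidistant nodes; dividing by [k + 1] instead of [k] covers degree 0. *)
  destruct (HB (fun i t => t = l + INR i * / (INR k + 1) * (r - l))
              l (r - l) p M) with (x := x) as [_ H2];
    [lra|easy|easy| | |lra|].
  - intros i Hik; apply le_INR in Hik; pose proof (pos_INR i).
    eexists; split; [reflexivity|].
    assert (0 <= INR i * / (INR k + 1) <= 1).
    { split; [apply Rdiv_le_0_compat; lra|].
      apply (proj2 (Rle_div_l _ _ (INR k + 1) ltac:(lra))); lra. }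
    split; [nra|]; apply HpM; nra.
  - intros i j t t' [Hij _] -> ->.
    apply Nat.le_succ_l, le_INR in Hij; rewrite S_INR in Hij.
    rewrite Rabs_minus_sym.
    replace (l + INR j * / (INR k + 1) * (r - l)
             - (l + INR i * / (INR k + 1) * (r - l)))
      with ((INR j - INR i) * (/ (INR k + 1) * (r - l))) by ring.
    rewrite Rabs_right.
    + rewrite <- (Rmult_1_l (/ (INR k + 1) * (r - l))) at 1.
      apply Rmult_le_compat_r; [nra|lra].
    + apply Rle_ge, Rmult_le_pos; [lra|nra].
  - apply Rle_div_r in H2; lra.
Qed.

(* Inverse estimates, with the pointwise bounds packed into constants [a] and
   [e] so that later integrals over the element need only sup bounds. *)
Lemma poly_inverse k :
  exists C, 1 <= C /\
  forall l r p, l < r -> poly_le k p ->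
  exists a e, 0 <= a /\ 0 <= e /\
    (r - l) * a ^ 2 <= C * RInt (fun t => p t ^ 2) l r /\
    (r - l) * e ^ 2 <= C * RInt (fun t => Derive p t ^ 2) l r /\
    forall x, l <= x <= r ->
      Rabs (p x) <= a /\ (r - l) * Rabs (Derive p x) <= a /\
      Rabs (Derive p x) <= e.
Proof.
  destruct (poly_weighted_inverse k) as (C & HC & HW).
  destruct (poly_markov k) as (C' & HC' & HB).
  assert (Hinv : forall l r p, l < r -> poly_le k p ->
    exists a, 0 <= a /\ (r - l) * a ^ 2 = C * RInt (fun t => p t ^ 2) l r /\
      forall x, l <= x <= r -> Rabs (p x) <= a).
  { intros l r p Hlr Hp.
    assert (Hc : cont p) by exact (poly_le_continuous k p Hp).
    set (I := RInt (fun t => p t ^ 2) l r).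
    assert (HI : 0 <= I).
    { apply RInt_cont_ge_0; [lra|solve_cont|intros; apply pow2_ge_0]. }
    exists (sqrt (C * I / (r - l))).
    assert (H0 : 0 <= C * I / (r - l)) by (apply Rdiv_le_0_compat; [apply Rmult_le_pos|]; lra).
    split; [apply sqrt_pos|]; split.
    - rewrite pow2_sqrt by easy; field; lra.
    - intros x Hx; rewrite <- sqrt_Rsqr_abs; apply sqrt_le_1_alt.
      apply (proj1 (Rle_div_r _ _ (r - l) ltac:(lra))).
      assert (H := HW l r p Hlr Hp x Hx).
      assert (Hle : RInt (fun t => (r - t) * p t ^ 2) l r <= (r - l) * I).
      { unfold I; rewrite <- RInt_cont_scal by solve_cont.
        apply RInt_cont_le; [lra|solve_cont|solve_cont|].
        intros t Ht; apply Rmult_le_compat_r; [apply pow2_ge_0|lra]. }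
      unfold Rsqr; apply Rmult_le_reg_l with (r - l); [lra|].
      apply (Rmult_le_compat_l C) in Hle; [|lra].
      lra. }
  exists (C * C' ^ 2); split.
  { apply one_le_mult; [easy|apply pow_R1_Rle; lra]. }
  intros l r p Hlr Hp.
  assert (Hp' : poly_le k (Derive p)).
  { apply poly_le_weaken with (pred k); [lia|now apply poly_le_Derive]. }
  destruct (Hinv l r p Hlr Hp) as (a & Ha0 & Ha & Hpa).
  destruct (Hinv l r _ Hlr Hp') as (e & He0 & He & Hpe).
  (* The sup bound [a] is enlarged by the Markov constant so that it also dominates
     [(r - l) * |p'|]. *)
  exists (C' * a), e; repeat split; auto.
  - nra.
  - right; rewrite Rpow_mult_distr; transitivity (C' ^ 2 * ((r - l) * a ^ 2)); [ring|].
    rewrite Ha; ring.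
  - rewrite He.
    assert (HI : 0 <= RInt (fun t => Derive p t ^ 2) l r).
    { apply RInt_cont_ge_0; [lra| |intros; apply pow2_ge_0].
      assert (cont (Derive p)) by exact (poly_le_continuous k _ Hp'); solve_cont. }
    apply Rmult_le_compat_r; [easy|].
    pose proof (pow_R1_Rle C' 2 HC'); nra.
  - specialize (Hpa x H); pose proof (Rmult_le_compat_r a 1 C' Ha0 HC'); lra.
Qed.

(** * Stability of the interpolants *)

Lemma lobatto_nodes_gap k s :
  lobatto_nodes k s ->
  exists d, 0 < d /\
  (forall i j, (i < j <= k)%nat -> d <= s j - s i) /\
  forall i, (i <= k)%nat -> -1 <= s i <= 1.
Proof.
  intros (H0 & H1 & Hinc & _).
  assert (Hd : forall m, (m <= k)%nat ->
    exists d, 0 < d /\ forall i, (i < m)%nat -> d <= s (S i) - s i).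
  { induction m as [|m IH]; intros Hm.
    - exists 1; split; [lra|]; intros; lia.
    - destruct (IH ltac:(lia)) as (d & Hd & H).
      assert (Hs := Hinc m ltac:(lia)).
      exists (Rmin d (s (S m) - s m)); split; [apply Rmin_glb_lt; lra|].
      intros i Hi; destruct (Nat.eq_dec i m) as [->|Hne]; [apply Rmin_r|].
      eapply Rle_trans; [apply Rmin_l|apply H; lia]. }
  destruct (Hd k (le_n k)) as (d & Hd0 & Hgap).
  assert (Hmono : forall i j, (i <= j)%nat -> (j <= k)%nat -> s i <= s j).
  { intros i j; induction 1 as [|j _ IH]; intros Hj; [lra|].
    specialize (IH ltac:(lia)); assert (Hs := Hinc j ltac:(lia)); lra. }
  exists d; split; [easy|]; split.
  - intros i j Hij; assert (H := Hgap i ltac:(lia)).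
    assert (H' := Hmono (S i) j ltac:(lia) ltac:(lia)); lra.
  - intros i Hi; rewrite <- H0, <- H1; split; apply Hmono; lia.
Qed.

Lemma lobatto_stable k s :
  lobatto_nodes k s ->
  exists C, 1 <= C /\
  forall l r g p A, l < r -> 0 <= A ->
  (forall x, l <= x <= r -> Rabs (g x) <= A) ->
  is_lobatto_interp k s l r g p ->
  forall x, l <= x <= r -> Rabs (p x) <= C * A.
Proof.
  intros Hs; destruct (lobatto_nodes_gap k s Hs) as (d & Hd & Hgap & Hin).
  (* The reference interval has length 2, so a gap [d] there becomes [d / 2 * (r - l)] on the
     element. *)
  destruct (poly_nodes_bound k (d / 2)) as (C & HC & HB); [lra|].
  exists C; split; [easy|]; intros l r g p A Hlr HA Hg [Hp Hpg] x Hx.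
  apply (HB (fun i t => t = (l + r) / 2 + (r - l) / 2 * s i) l (r - l) p A);
    [lra|easy|easy| | |lra].
  - intros i Hi; specialize (Hin i Hi).
    assert (Ht : l <= (l + r) / 2 + (r - l) / 2 * s i <= r) by nra.
    eexists; split; [reflexivity|]; split; [lra|].
    specialize (Hpg i Hi); simpl in Hpg; rewrite Hpg; auto.
  - intros i j t t' Hij -> ->; specialize (Hgap i j Hij).
    rewrite Rabs_minus_sym, Rabs_right; nra.
Qed.

(* With [p = p r + (t - r) q], testing the orthogonality with [q] controls
   the integral of [(r - t) q^2]. *)
Lemma radau_stable k :
  (1 <= k)%nat ->
  exists C, 1 <= C /\
  forall l r g p A, l < r -> 0 <= A -> cont g ->
  (forall x, l <= x <= r -> Rabs (g x) <= A) ->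
  is_radau_interp k l r g p ->
  forall x, l <= x <= r -> Rabs (p x) <= C * A.
Proof.
  intros Hk; destruct k as [|k]; [lia|].
  destruct (poly_weighted_inverse k) as (C & HC & HW).
  exists (1 + 2 * C); split; [lra|].
  intros l r g p A Hlr HA Hg HgA (Hp & Horth & Hpr) x Hx.
  destruct (poly_le_factor k p r Hp) as (q & Hq & Hpq).
  replace (S k - 1)%nat with k in Horth by lia.
  assert (Hqc : cont q) by exact (poly_le_continuous k q Hq).
  assert (Hpc : cont p) by exact (poly_le_continuous _ p Hp).
  destruct (continuity_ab_maj (fun t => q t ^ 2) l r) as (x0 & Hmax & Hx0);
    [lra| |].
  { intros c _; apply continuity_pt_filterlim.
    assert (Hc : cont (fun t => q t ^ 2)) by solve_cont; apply Hc. }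
  assert (Hmax' : forall t, l <= t <= r -> Rabs (q t) <= Rabs (q x0)).
  { intros t Ht; apply Rsqr_le_abs_0; unfold Rsqr.
    specialize (Hmax t Ht); simpl in Hmax; lra. }
  set (Q := Rabs (q x0)) in *.
  assert (HQ : 0 <= Q) by apply Rabs_pos.
  assert (Hint : RInt (fun t => (r - t) * q t ^ 2) l r <= (r - l) * (2 * A * Q)).
  { rewrite (RInt_ext _ (fun t => g r * q t - p t * q t))
      by (intros; rewrite (Hpq x1), Hpr; ringR).
    rewrite RInt_cont_minus, (Horth q Hq), <- RInt_cont_minus by solve_cont.
    eapply Rle_trans; [apply Rle_abs|].
    apply RInt_abs_le; [lra|solve_cont|].
    intros t Ht.
    replace (g r * q t - g t * q t) with ((g r - g t) * q t) by ring.
    rewrite Rabs_mult; apply Rmult_le_compat; auto using Rabs_pos.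
    eapply Rle_trans; [apply Rabs_triang|]; rewrite Rabs_Ropp.
    pose proof (HgA r ltac:(lra)); pose proof (HgA t Ht); lra. }
  (* The weighted inverse estimate makes [Hint] quadratic in [Q] on the left and linear on the
     right; one factor [Q] cancels. *)
  assert (HQb : (r - l) * Q <= 2 * C * A).
  { assert (H := HW l r q Hlr Hq x0 Hx0).
    rewrite <- (pow2_abs (q x0)) in H; fold Q in H.
    destruct (Req_dec Q 0) as [->|HQ0]; [nra|].
    apply Rmult_le_reg_r with ((r - l) * Q); [nra|].
    apply (Rmult_le_compat_l C) in Hint; [|lra].
    nra. }
  rewrite (Hpq x), Hpr; eapply Rle_trans; [apply Rabs_triang|].
  rewrite Rabs_mult.
  assert (Rabs (x - r) * Rabs (q x) <= (r - l) * Q).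
  { apply Rmult_le_compat; auto using Rabs_pos; apply Rabs_le; lra. }
  pose proof (HgA r ltac:(lra)); lra.
Qed.

(** Both interpolations reproduce degree [k], so [P - T] interpolates [U - T] and stability bounds
    it by a multiple of [A]. The derivative of [P] is compared with that of [T] because Markov's
    inequality applies to the polynomial [P - T]; the remaining difference of the derivatives of [U]
    and [T] has its own scaling in [eps]. *)
Lemma interp_error k s :
  (1 <= k)%nat -> lobatto_nodes k s ->
  exists C, 1 <= C /\
  forall l r U T P A, l < r -> 0 <= A -> cdiff U -> poly_le k T ->
  (forall x, l <= x <= r -> Rabs (U x - T x) <= A) ->
  is_radau_interp k l r U P \/ is_lobatto_interp k s l r U P ->
  forall x, l <= x <= r ->
  Rabs (P x - U x) <= C * A /\ (r - l) * Rabs (Derive P x - Derive T x) <= C * A.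
Proof.
  intros Hk Hs.
  destruct (radau_stable k Hk) as (C & HC & HR).
  destruct (lobatto_stable k s Hs) as (C' & HC' & HL).
  destruct (poly_markov k) as (C'' & HC'' & HM).
  exists ((C + C') * C'' + 1); split; [nra|].
  intros l r U T P A Hlr HA HU HT HUT Hint x Hx.
  assert (HP : poly_le k P) by (destruct Hint as [H|H]; apply H).
  assert (HPT : poly_le k (fun t => P t - T t)) by now apply poly_le_minus.
  assert (HUc := cdiff_cont U HU).
  assert (HTc : cont T) by exact (poly_le_continuous k T HT).
  assert (HPc : cont P) by exact (poly_le_continuous k P HP).
  assert (Hb : forall y, l <= y <= r -> Rabs (P y - T y) <= (C + C') * A).
  { intros y Hy; destruct Hint as [(_ & Horth & Hr)|(_ & Hn)].
    - apply Rle_trans with (C * A); [|nra].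
      apply (HR l r (fun t => U t - T t) (fun t => P t - T t)); auto.
      { solve_cont. }
      split; [easy|]; split; [|lra].
      intros v Hv; assert (Hvc : cont v) by exact (poly_le_continuous _ v Hv).
      rewrite (RInt_ext _ (fun t => P t * v t - T t * v t)) by (intros; ringR).
      rewrite (RInt_ext (fun t => (U t - T t) * v t)
                 (fun t => U t * v t - T t * v t)) by (intros; ringR).
      rewrite !RInt_cont_minus, (Horth v Hv) by solve_cont; reflexivity.
    - apply Rle_trans with (C' * A); [|nra].
      apply (HL l r (fun t => U t - T t) (fun t => P t - T t)); auto.
      split; [easy|]; intros i Hi; specialize (Hn i Hi); simpl in *; lra. }
  split.
  - replace (P x - U x) with ((P x - T x) + - (U x - T x)) by ring.
    eapply Rle_trans; [apply Rabs_triang|]; rewrite Rabs_Ropp.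
    pose proof (Hb x Hx); pose proof (HUT x Hx).
    pose proof (Rmult_le_compat_l ((C + C') * A) 1 C'' ltac:(nra) HC''); lra.
  - rewrite <- Derive_minus_cdiff by eauto using poly_le_cdiff.
    apply Rle_trans with (C'' * ((C + C') * A)); [|lra].
    apply (HM l r (fun t => P t - T t)); auto; nra.
Qed.

(** * Taylor polynomials with remainder bounds for the function and its derivative *)

Lemma mean_value_bound f f' l x K :
  l <= x -> (forall t, is_derive f t (f' t)) ->
  (forall t, l <= t <= x -> Rabs (f' t) <= K) ->
  Rabs (f x - f l) <= K * (x - l).
Proof.
  intros Hlx Hd HK.
  destruct (MVT_gen f l x f') as (c & Hc & ->).
  - auto.
  - intros t _; apply continuity_pt_filterlim.
    apply (ex_derive_continuous f); now exists (f' t).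
  - rewrite Rmin_left, Rmax_right in Hc by easy.
    rewrite Rabs_mult, (Rabs_right (x - l)) by lra.
    apply Rmult_le_compat_r; [lra|auto].
Qed.

(** The derivative is approximated along with the function because [T] is the primitive, matched at
    [l], of the polynomial found for the derivative; the mean value theorem then gains one power of
    [r - l]. The factorial is given away. *)
Lemma taylor n D l r K :
  l <= r ->
  (forall i x, (i <= n)%nat -> is_derive (D i) x (D (S i) x)) ->
  (forall x, l <= x <= r -> Rabs (D (S n) x) <= K) ->
  exists T, poly_le n T /\
  forall x, l <= x <= r ->
  Rabs (D 0%nat x - T x) <= K * (r - l) ^ S n /\
  Rabs (D 1%nat x - Derive T x) <= K * (r - l) ^ n.
Proof.
  revert D; induction n as [|n IH]; intros D Hlr HD HK.
  - exists (fun _ => D 0%nat l); split; [apply poly_le_const|].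
    intros x Hx; split.
    + eapply Rle_trans.
      * apply (mean_value_bound (D 0%nat) (D 1%nat)); [easy|auto|].
        intros t Ht; apply HK; lra.
      * assert (0 <= K) by (eapply Rle_trans; [apply Rabs_pos|apply (HK x Hx)]).
        simpl; nra.
    + rewrite Derive_const; simpl; rewrite Rminus_0_r, Rmult_1_r; auto.
  - destruct (IH (fun i => D (S i))) as (T1 & HT1 & Hb); [easy| |easy|].
    { intros i x Hi; apply HD; lia. }
    destruct (poly_le_antiderive n T1 l (D 0%nat l) HT1) as (T & HT & HTl & HTd).
    exists T; split; [easy|]; intros x Hx; split.
    + replace (D 0%nat x - T x)
        with ((D 0%nat x - T x) - (D 0%nat l - T l)) by (rewrite HTl; ring).
      assert (H0 : 0 <= K) by (eapply Rle_trans; [apply Rabs_pos|apply (HK x Hx)]).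
      eapply Rle_trans.
      * apply (mean_value_bound (fun t => D 0%nat t - T t)
          (fun t => D 1%nat t - T1 t) l x (K * (r - l) ^ S n)); [easy| |].
        { intros t; apply is_derive_minus_R; [apply HD; lia|apply HTd]. }
        { intros t Ht; apply Hb; lra. }
      * assert (0 <= K * (r - l) ^ S n) by (apply Rmult_le_pos; [|apply pow_le]; lra).
        change ((r - l) ^ S (S n)) with ((r - l) * (r - l) ^ S n); nra.
    + rewrite (is_derive_unique T x (T1 x)) by auto.
      now apply Hb.
Qed.

(** * Superconvergence of Gauss-Lobatto interpolation *)

(** Degree strictly below [n], where degree below 0 means the zero polynomial; [poly_le (n - 1)]
    would admit constants at [n = 0] and break the induction for orthogonality. *)
Definition poly_lt (n : nat) (p : R -> R) : Prop :=
  match n with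
  | 0%nat => forall t, p t = 0
  | S m => poly_le m p
  end.

Lemma poly_lt_le n p : poly_lt n p -> poly_le n p.
Proof.
  destruct n as [|n]; simpl; intros H.
  - apply (poly_le_ext 0 (fun _ => 0)); [auto|apply poly_le_const].
  - apply poly_le_weaken with n; [lia|easy].
Qed.

Lemma poly_lt_ext n p q : (forall t, p t = q t) -> poly_lt n p -> poly_lt n q.
Proof.
  destruct n as [|n]; simpl; intros H Hp.
  - intros t; now rewrite <- H.
  - now apply (poly_le_ext n p).
Qed.

Lemma poly_lt_minus n p q :
  poly_lt n p -> poly_lt n q -> poly_lt n (fun t => p t - q t).
Proof.
  destruct n as [|n]; simpl; intros Hp Hq.
  - intros t; rewrite Hp, Hq; ring.
  - now apply poly_le_minus.
Qed.

Lemma poly_lt_weaken n p : poly_lt n p -> poly_lt (S n) p.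
Proof. apply poly_lt_le. Qed.

Lemma poly_lt_mulX n p : poly_lt n p -> poly_lt (S n) (fun t => t * p t).
Proof.
  destruct n as [|n]; simpl; intros H.
  - apply (poly_le_ext 0 (fun _ => 0)); [intros; rewrite H; ring|].
    apply poly_le_const.
  - now apply poly_le_mulX.
Qed.

Lemma poly_lt_mulX2m1 n p :
  poly_lt n p -> poly_lt (S (S n)) (fun t => (t ^ 2 - 1) * p t).
Proof.
  intros H; apply (poly_lt_ext _ (fun t => t * (t * p t) - p t)).
  - intros; ring.
  - apply poly_lt_minus; [now do 2 apply poly_lt_mulX|].
    now do 2 apply poly_lt_weaken.
Qed.

Lemma poly_lt_Derive n p : poly_lt (S n) p -> poly_lt n (Derive p).
Proof.
  simpl; intros H; destruct n as [|n]; simpl.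
  - apply poly_le_0 in H as [a Ha]; intros t.
    rewrite (Derive_ext p (fun _ => a)) by auto; apply Derive_const.
  - exact (poly_le_Derive (S n) p H).
Qed.

Lemma Derive_n_S f n t : Derive_n f (S n) t = Derive (Derive_n f n) t.
Proof. reflexivity. Qed.

(** [poly_le] only bounds the degree; here the exact top coefficient is recorded, because the
    superconvergence argument cancels it. *)
Definition leads (n : nat) (a : R) (p : R -> R) : Prop :=
  exists q, poly_lt n q /\ forall t, p t = q t + a * t ^ n.

Lemma leads_Derive n a p :
  leads (S n) a p -> leads n (a * INR (S n)) (Derive p).
Proof.
  intros (q & Hq & Hp); exists (Derive q); split; [now apply poly_lt_Derive|].
  intros t; rewrite (Derive_ext _ _ t Hp).
  apply is_derive_unique, is_derive_plus_R; [|apply is_derive_monomial].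
  apply cdiff_is_derive, (poly_le_cdiff (S n)), poly_lt_le, Hq.
Qed.

Lemma leads_Derive_n n m a p :
  a <> 0 -> leads (n + m) a p ->
  exists a', a' <> 0 /\ leads n a' (Derive_n p m).
Proof.
  revert n a; induction m as [|m IH]; intros n a Ha Hp.
  - rewrite Nat.add_0_r in Hp; now exists a.
  - destruct (IH (S n) a Ha) as (b & Hb & H).
    { now replace (S n + m)%nat with (n + S m)%nat by lia. }
    exists (b * INR (S n)); split.
    + apply Rmult_integral_contrapositive_currified; [easy|].
      apply not_0_INR; lia.
    + exact (leads_Derive n b _ H).
Qed.

Lemma leads_mulX2m1 n a p :
  leads n a p -> leads (S (S n)) a (fun t => (t ^ 2 - 1) * p t).
Proof.
  intros (q & Hq & Hp).
  exists (fun t => (t ^ 2 - 1) * q t - a * t ^ n); split.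
  - apply poly_lt_minus; [now apply poly_lt_mulX2m1|].
    simpl; apply poly_le_weaken with n; [lia|].
    apply (poly_le_ext n (fun t => a * (t ^ n * 1))); [intros; ring|].
    apply poly_le_scal, (poly_le_mul_pow 0 n (fun _ => 1)), poly_le_const.
  - intros t; rewrite Hp; simpl; ring.
Qed.

Lemma leads_rodrigues k : leads (2 * k) 1 (fun y => (y ^ 2 - 1) ^ k).
Proof.
  induction k as [|k IH].
  - exists (fun _ => 0); split; [easy|intros; simpl; ring].
  - replace (2 * S k)%nat with (S (S (2 * k))) by lia.
    exact (leads_mulX2m1 _ _ _ IH).
Qed.

Lemma leads_poly_le n a p : leads n a p -> poly_le n p.
Proof.
  intros (q & Hq & Hp).
  apply (poly_le_ext n (fun t => q t + a * (t ^ n * 1))).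
  - intros; rewrite Hp; ring.
  - apply poly_le_plus; [now apply poly_lt_le|].
    apply poly_le_scal, (poly_le_mul_pow 0 n (fun _ => 1)), poly_le_const.
Qed.

Lemma poly_le_Derive_n n p m : poly_le n p -> poly_le n (Derive_n p m).
Proof.
  intros Hp; induction m as [|m IH]; [exact Hp|].
  apply poly_le_weaken with (pred n); [lia|exact (poly_le_Derive n _ IH)].
Qed.

Lemma rodrigues_cdiff k m : cdiff (Derive_n (fun y => (y ^ 2 - 1) ^ k) m).
Proof.
  eapply poly_le_cdiff, poly_le_Derive_n, leads_poly_le, leads_rodrigues.
Qed.

(** Each differentiation lowers the multiplicity of the roots -1 and 1 by one. This makes the
    boundary terms vanish in the integrations by parts that give orthogonality. *)
Lemma rodrigues_factor k m :
  (m <= k)%nat ->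
  exists n r, poly_le n r /\ forall t,
  Derive_n (fun y => (y ^ 2 - 1) ^ k) m t = (t ^ 2 - 1) ^ (k - m) * r t.
Proof.
  induction m as [|m IH]; intros Hm.
  - exists 0%nat, (fun _ => 1); split; [apply poly_le_const|].
    intros t; rewrite Nat.sub_0_r; simpl; ring.
  - destruct (IH ltac:(lia)) as (n & r & Hr & H).
    replace (k - m)%nat with (S (k - S m)) in H by lia.
    set (j := (k - S m)%nat) in *.
    assert (Hrc := poly_le_cdiff n r Hr).
    exists (S (S n)),
      (fun t => 2 * INR (S j) * (t * r t) + (t ^ 2 - 1) * Derive r t); split.
    + apply poly_le_plus.
      * apply poly_le_scal, poly_le_weaken with (S n); [lia|].
        now apply poly_le_mulX.
      * apply poly_lt_le, poly_lt_mulX2m1, poly_lt_Derive, Hr.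
    + intros t; rewrite Derive_n_S, (Derive_ext _ _ t H).
      apply is_derive_unique.
      replace ((t ^ 2 - 1) ^ j *
        (2 * INR (S j) * (t * r t) + (t ^ 2 - 1) * Derive r t))
        with ((INR (S j) * (2 * t) * (t ^ 2 - 1) ^ j) * r t
              + (t ^ 2 - 1) ^ S j * Derive r t) by (simpl; ring).
      apply (is_derive_mult_R (fun t => (t ^ 2 - 1) ^ S j));
        [|now apply cdiff_is_derive].
      auto_derive; [easy|].
      change (match j with 0%nat => 1 | S _ => INR j + 1 end) with (INR (S j)).
      replace (t * (t * 1) + - (1)) with (t ^ 2 - 1) by ring; ring.
Qed.

Lemma rodrigues_root k m t :
  (m < k)%nat -> t ^ 2 = 1 -> Derive_n (fun y => (y ^ 2 - 1) ^ k) m t = 0.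
Proof.
  intros Hm Ht.
  destruct (rodrigues_factor k m ltac:(lia)) as (n & r & _ & H).
  rewrite H, Ht, Rminus_diag, pow_ne_zero by lia; ring.
Qed.

(** [m] integrations by parts move all derivatives onto [v]. For [m = k] this is the orthogonality
    of the Legendre polynomial; smaller [m] are there for the induction. *)
Lemma rodrigues_orthogonal k m v :
  (m <= k)%nat -> poly_lt m v ->
  RInt (fun t => Derive_n (fun y => (y ^ 2 - 1) ^ k) m t * v t) (-1) 1 = 0.
Proof.
  revert v; induction m as [|m IH]; intros v Hm Hv.
  - rewrite (RInt_ext _ (fun _ => 0)) by (intros; rewrite Hv; ringR).
    rewrite RInt_const_R; ringR.
  - assert (Hvc : cdiff v) by exact (poly_le_cdiff _ v Hv).
    rewrite (RInt_ext _ (fun t =>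
      Derive (Derive_n (fun y => (y ^ 2 - 1) ^ k) m) t * v t)) by easy.
    rewrite (RInt_by_parts _ v _ _ (rodrigues_cdiff k m) Hvc).
    rewrite !rodrigues_root by (lia || lra).
    rewrite IH by (lia || now apply poly_lt_Derive); ringR.
Qed.

(* [(t^2 - 1) P_k'(t)] up to a scalar: it vanishes at the Lobatto points. *)
Definition lobatto_poly (k : nat) (t : R) : R :=
  (t ^ 2 - 1) * Derive_n (fun y => (y ^ 2 - 1) ^ k) (S k) t.

Lemma leads_lobatto_poly k :
  (1 <= k)%nat -> exists a, a <> 0 /\ leads (S k) a (lobatto_poly k).
Proof.
  intros Hk; destruct k as [|k]; [lia|].
  destruct (leads_Derive_n k (S (S k)) 1 (fun y => (y ^ 2 - 1) ^ S k) R1_neq_R0)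
    as (a & Ha & H).
  { replace (k + S (S k))%nat with (2 * S k)%nat by lia; apply leads_rodrigues. }
  exists a; split; [easy|].
  exact (leads_mulX2m1 _ _ _ H).
Qed.

Lemma lobatto_poly_node k s i :
  lobatto_nodes k s -> (i <= k)%nat -> lobatto_poly k (s i) = 0.
Proof.
  intros (H0 & H1 & _ & Hd) Hi; unfold lobatto_poly.
  destruct (Nat.eq_dec i 0) as [->|Hi0]; [rewrite H0; ring|].
  destruct (Nat.eq_dec i k) as [->|Hik]; [rewrite H1; ring|].
  specialize (Hd i ltac:(lia)); unfold legendre in Hd.
  rewrite Derive_scal in Hd.
  apply Rmult_integral in Hd as [Hd|Hd].
  - exfalso; revert Hd; apply Rinv_neq_0_compat.
    apply Rmult_integral_contrapositive_currified; [apply pow_nonzero; lra|].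
    apply INR_fact_neq_0.
  - rewrite Derive_n_S, Hd; ring.
Qed.

(** Integrating by parts twice, with boundary terms killed by the factor [t ^ 2 - 1] each time,
    leaves the Legendre polynomial (up to a scalar) tested against the derivative of
    [(t ^ 2 - 1) z'], which has degree below [k]. *)
Lemma lobatto_poly_orthogonal k z :
  poly_lt k z -> RInt (fun t => Derive (lobatto_poly k) t * z t) (-1) 1 = 0.
Proof.
  destruct k as [|k]; intros Hz.
  { rewrite (RInt_ext _ (fun _ => 0)) by (intros; rewrite Hz; ringR).
    rewrite RInt_const_R; ringR. }
  assert (Hzc : cdiff z) by exact (poly_le_cdiff _ z Hz).
  destruct (leads_lobatto_poly (S k) ltac:(lia)) as (a & _ & HQ).
  apply leads_poly_le in HQ.
  rewrite (RInt_by_parts _ z _ _ (poly_le_cdiff _ _ HQ) Hzc).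
  set (y := fun t => (t ^ 2 - 1) * Derive z t).
  assert (Hy : poly_le (S k) y) by now apply poly_lt_mulX2m1, poly_lt_Derive.
  rewrite (RInt_ext (fun t => lobatto_poly (S k) t * Derive z t)
    (fun t => Derive (Derive_n (fun y => (y ^ 2 - 1) ^ S k) (S k)) t * y t))
    by (intros; unfold lobatto_poly, y; rewrite Derive_n_S; ringR).
  rewrite (RInt_by_parts _ y _ _ (rodrigues_cdiff _ _) (poly_le_cdiff _ _ Hy)).
  rewrite rodrigues_orthogonal; [|lia|now apply (poly_lt_Derive (S k))].
  unfold lobatto_poly, y; ringR.
Qed.

(** The interpolant [T'] is exhibited: it is [T] minus the multiple [b / a] of the pulled-back
    [lobatto_poly k]. This cancels the top coefficient, since [b] and [a] are the top coefficients
    of the two polynomials on [-1,1], and it keeps the nodal values. The orthogonality is then that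
    of [lobatto_poly_orthogonal] after an affine substitution. *)
Lemma lobatto_superconvergence k s l r T :
  (1 <= k)%nat -> lobatto_nodes k s -> l < r -> poly_le (S k) T ->
  exists T', is_lobatto_interp k s l r T T' /\
  forall z, poly_le (k - 1) z ->
  RInt (fun t => (Derive T' t - Derive T t) * z t) l r = 0.
Proof.
  intros Hk Hs Hlr HT.
  destruct (leads_lobatto_poly k Hk) as (a & Ha & HQl).
  set (Q := lobatto_poly k) in *.
  set (mid := (l + r) / 2); set (h2 := (r - l) / 2).
  assert (Hh : h2 <> 0) by (unfold h2; lra).
  assert (HTr := poly_le_affine _ mid h2 _ HT).
  apply poly_le_S in HTr as (q & b & Hq & HTq).
  set (QQ := fun t => Q (- mid / h2 + / h2 * t)).
  assert (HQQ : poly_le (S k) QQ).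
  { apply poly_le_affine, (leads_poly_le _ a), HQl. }
  assert (HQc := poly_le_cdiff _ Q (leads_poly_le _ a _ HQl)).
  assert (HQQc := poly_le_cdiff _ QQ HQQ).
  exists (fun t => T t - b / a * QQ t); split; [split|].
  - destruct HQl as (q' & Hq' & HQ').
    apply (poly_le_ext k
      (fun t => (fun y => q y - b / a * q' y) (- mid / h2 + / h2 * t))).
    + intros t; set (y := - mid / h2 + / h2 * t).
      replace (T t) with (T (mid + h2 * y)) by (f_equal; unfold y; field; easy).
      rewrite HTq; unfold QQ; fold y; rewrite HQ'; field; easy.
    + apply (poly_le_affine k _ _ (fun y => q y - b / a * q' y)), poly_le_minus; [easy|now apply poly_le_scal].
  - intros i Hi; simpl; fold mid h2.
    unfold QQ; replace (- mid / h2 + / h2 * (mid + h2 * s i)) with (s i)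
      by (field; easy).
    unfold Q; rewrite (lobatto_poly_node k s i Hs Hi); ring.
  - intros z Hz.
    rewrite (RInt_ext _ (fun t =>
      - (b / a) * (/ h2 * (Derive Q (/ h2 * t + - mid / h2) *
                           z (mid + h2 * (/ h2 * t + - mid / h2)))))).
    2:{ intros t _.
        assert (Hd : Derive (fun t => T t - b / a * QQ t) t
          = Derive T t - b / a * Derive QQ t).
        { rewrite Derive_minus, Derive_scal; [easy| |].
          - apply (poly_le_ex_derive _ _ HT).
          - apply ex_derive_scal, HQQc. }
        rewrite Hd.
        replace (mid + h2 * (/ h2 * t + - mid / h2)) with t by (field; easy).
        assert (HdQ : Derive QQ t = / h2 * Derive Q (/ h2 * t + - mid / h2)).
        { unfold QQ; rewrite (Rplus_comm (/ h2 * t)).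
          apply is_derive_unique.
          apply (is_derive_comp Q (fun t => - mid / h2 + / h2 * t)).
          - now apply cdiff_is_derive.
          - auto_derive; [easy|ring]. }
        rewrite HdQ; ringR. }
    set (F := fun y => Derive Q y * z (mid + h2 * y)).
    assert (HF : cont F).
    { unfold F; apply cont_mult; [now apply cdiff_cont_Derive|].
      exact (poly_le_continuous _ _ (poly_le_affine _ mid h2 _ Hz)). }
    assert (HF' : cont (fun t => / h2 * F (/ h2 * t + - mid / h2))).
    { apply cont_mult; [apply cont_const|]; intros t.
      apply (continuous_comp (fun t => / h2 * t + - mid / h2) F); [|apply HF].
      assert (Hc : cont (fun t => / h2 * t + - mid / h2)) by solve_cont; apply Hc. }
    rewrite (RInt_cont_scal (fun t => / h2 * F (/ h2 * t + - mid / h2)))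
      by exact HF'.
    assert (Hcomp := RInt_comp_lin F (/ h2) (- mid / h2) l r
      (cont_ex_RInt F _ _ HF)).
    unfold scal in Hcomp; simpl in Hcomp; unfold mult in Hcomp; simpl in Hcomp.
    rewrite Hcomp; clear Hcomp.
    replace (/ h2 * l + - mid / h2) with (-1)
      by (unfold h2, mid in *; field; lra).
    replace (/ h2 * r + - mid / h2) with 1
      by (unfold h2, mid in *; field; lra).
    unfold F, Q; rewrite lobatto_poly_orthogonal; [ringR|].
    destruct k as [|k]; [lia|]; simpl.
    replace (S k - 1)%nat with k in Hz by lia.
    now apply poly_le_affine.
Qed.

(** * Extension from the unit interval *)

(** Composition with this 1-Lipschitz retraction extends a function by its end values and turns
    continuity relative to [0,1] into two-sided continuity. *)
Definition clamp (x : R) : R := Rmax 0 (Rmin 1 x).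

Lemma clamp_in x : 0 <= clamp x <= 1.
Proof.
  unfold clamp; split; [apply Rmax_l|].
  apply Rmax_lub; [lra|apply Rmin_l].
Qed.

Lemma clamp_id x : 0 <= x <= 1 -> clamp x = x.
Proof. intros; unfold clamp; rewrite Rmin_right, Rmax_right; lra. Qed.

Lemma clamp_lipschitz x y : Rabs (clamp x - clamp y) <= Rabs (x - y).
Proof.
  unfold clamp, Rmax, Rmin.
  repeat destruct Rle_dec; unfold Rabs; repeat destruct Rcase_abs; lra.
Qed.

Lemma clamp_cont g :
  continuous_on (fun x => 0 <= x <= 1) g -> cont (fun x => g (clamp x)).
Proof.
  intros Hg x.
  apply (filterlim_comp _ _ _ clamp g (locally x)
           (within (fun y => 0 <= y <= 1) (locally (clamp x)))
           (locally (g (clamp x)))).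
  - intros P [d Hd]; exists d; intros y Hy.
    apply Hd; [|apply clamp_in].
    eapply Rle_lt_trans; [apply clamp_lipschitz|exact Hy].
  - apply Hg, clamp_in.
Qed.

Lemma locally_open_unit (x : R) :
  0 < x < 1 -> locally x (fun y => 0 < y < 1).
Proof.
  intros Hx; apply (locally_interval _ x 0 1); simpl; try easy.
Qed.

(** The continuous extension [h] of the derivative of [g] is one class lower, so it has a
    representative by induction, and integrating this from 0 represents [g]. In effect the top
    derivative is extended by constants and integrated back. *)
Lemma C_class_extend m g :
  C_class m g ->
  exists D : nat -> R -> R,
  (forall i x, (i < m)%nat -> is_derive (D i) x (D (S i) x)) /\
  (forall i, (i <= m)%nat -> cont (D i)) /\
  (forall x, 0 <= x <= 1 -> D 0%nat x = g x) /\
  (forall i x, (i <= m)%nat -> 0 < x < 1 -> D i x = Derive_n g i x).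
Proof.
  revert g; induction m as [|m IH]; intros g [Hg HD].
  - exists (fun _ x => g (clamp x)); split; [intros; lia|].
    split; [intros; now apply clamp_cont|].
    split; [intros; now rewrite clamp_id|].
    intros i x Hi Hx; replace i with 0%nat by lia.
    now rewrite clamp_id by lra.
  - destruct (HD 1%nat ltac:(lia)) as (Hg1 & h & Hh & Hhg).
    assert (Hloc : forall x, 0 < x < 1 -> locally x (fun y => Derive g y = h y)).
    { intros x Hx; generalize (locally_open_unit x Hx).
      apply filter_imp; intros y Hy; symmetry; now apply Hhg. }
    assert (Hn : forall n x, 0 < x < 1 -> Derive_n h n x = Derive_n g (S n) x).
    { intros n x Hx.
      rewrite <- (Derive_n_ext_loc (Derive g) h n x) by auto.
      replace (S n) with (n + 1)%nat by lia.
      now rewrite <- Derive_n_comp. }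
    destruct (IH h) as (D' & H1 & H2 & H3 & H4).
    { split; [easy|]; intros n Hnm.
      destruct (HD (S n) ltac:(lia)) as (Hgn & h' & Hh' & Hhg'); split.
      - intros x Hx; destruct n as [|n]; [exact I|].
        specialize (Hgn x Hx); simpl in Hgn |- *.
        apply (ex_derive_ext_loc (fun y => Derive_n g (S n) y)); [|exact Hgn].
        generalize (locally_open_unit x Hx).
        apply filter_imp; intros y Hy; symmetry; now apply Hn.
      - exists h'; split; [easy|]; intros x Hx; rewrite Hn; auto. }
    exists (fun i => match i with
                     | 0%nat => fun x => g 0 + RInt (D' 0%nat) 0 x
                     | S i => D' i
                     end).
    assert (Hc0 : cont (D' 0%nat)) by (apply H2; lia).
    assert (Hd0 : forall x : R,
      is_derive (fun y => g 0 + RInt (D' 0%nat) 0 y) x (D' 0%nat x)).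
    { intros x; replace (D' 0%nat x) with (0 + D' 0%nat x) by ring.
      apply is_derive_plus_R; [apply (is_derive_const (V := R_NormedModule))|].
      apply (is_derive_RInt (D' 0%nat) _ 0 x); [|apply Hc0].
      apply filter_forall; intros y; apply (RInt_correct (V := R_CompleteNormedModule)).
      now apply cont_ex_RInt. }
    assert (Heq : forall x, 0 <= x <= 1 -> g 0 + RInt (D' 0%nat) 0 x = g x).
    { intros x Hx.
      (* The clamp makes [F] continuous at 0 and 1, whatever [g] is outside [0,1], so the mean value
         theorem applies on the closed interval. *)
      set (F := fun y => (g 0 + RInt (D' 0%nat) 0 y) - g (clamp y)).
      assert (HF : F x - F 0 = 0).
      { destruct (MVT_gen F 0 x (fun _ => 0)) as (c & _ & HF).
        - rewrite Rmin_left, Rmax_right by lra; intros y Hy.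
          assert (Hy1 : 0 < y < 1) by lra.
          replace 0 with (D' 0%nat y - Derive g y)
            by (rewrite H3, Hhg by lra; change (Derive_n g 1 y) with (Derive g y); ring).
          apply is_derive_minus_R; [apply Hd0|].
          apply (is_derive_ext_loc g).
          + generalize (locally_open_unit y Hy1).
            apply filter_imp; intros t Ht; now rewrite clamp_id by lra.
          + apply Derive_correct, (Hg1 y Hy1).
        - intros y _; apply continuity_pt_filterlim.
          assert (HcF : cont F).
          { unfold F; apply cont_minus; [|now apply clamp_cont].
            intros z; apply (ex_derive_continuous
              (fun y => g 0 + RInt (D' 0%nat) 0 y)).
            now exists (D' 0%nat z). }
          apply HcF.
        - rewrite HF; ring. }
      unfold F in HF; rewrite RInt_point, !clamp_id in HF by lra.
      unfold zero in HF; simpl in HF; lra. }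
    split; [|split; [|split]].
    + intros [|i] x Hi; [apply Hd0|apply H1; lia].
    + intros [|i] Hi; [|apply H2; lia].
      intros x; apply (ex_derive_continuous (fun y => g 0 + RInt (D' 0%nat) 0 y)).
      now exists (D' 0%nat x).
    + exact Heq.
    + intros [|i] x Hi Hx; [apply Heq; lra|rewrite H4, Hn; auto; lia].
Qed.

(** Bounds on derivatives are given on the open interval only, while the end nodes carry traces. A
    negative value at [x] would persist at a nearby point shifted towards 1/2. *)
Lemma cont_nonneg_closure F :
  cont F -> (forall x, 0 < x < 1 -> 0 <= F x) ->
  forall x, 0 <= x <= 1 -> 0 <= F x.
Proof.
  intros HF H x Hx; destruct (Rle_or_lt 0 (F x)) as [Hle|Hlt]; [easy|exfalso].
  assert (Hn : locally x (fun y => F y < 0)).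
  { apply (HF x (fun z => z < 0)), (open_lt 0), Hlt. }
  destruct Hn as [[d Hd] Hn].
  set (t := Rmin (1 / 2) (d / 2)).
  assert (Ht : 0 < t /\ t <= 1 / 2 /\ t <= d / 2).
  { split; [apply Rmin_glb_lt; lra|split; [apply Rmin_l|apply Rmin_r]]. }
  set (y := x + (1 / 2 - x) * t).
  assert (Hy : 0 < y < 1) by (unfold y; nra).
  specialize (H y Hy).
  assert (Hyn : F y < 0); [apply Hn|lra].
  change (Rabs (y - x) < d).
  apply Rabs_def1; unfold y; nra.
Qed.

(** * The bilinear form *)

Lemma sum_plus_R (a b : nat -> R) n m :
  sum_n_m (fun j => a j + b j) n m = sum_n_m a n m + sum_n_m b n m.
Proof. apply (sum_n_m_plus (G := R_AbelianMonoid)). Qed.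

Lemma sum_scal_R c (a : nat -> R) n m :
  sum_n_m (fun j => c * a j) n m = c * sum_n_m a n m.
Proof. apply (sum_n_m_mult_l (K := R_Ring)). Qed.

Lemma sum_minus_R (a b : nat -> R) n m :
  sum_n_m (fun j => a j - b j) n m = sum_n_m a n m - sum_n_m b n m.
Proof.
  rewrite (sum_n_m_ext _ (fun j => a j + (-1) * b j)) by (intros; ringR).
  rewrite sum_plus_R, sum_scal_R; ringR.
Qed.

Lemma sum_le_R (a b : nat -> R) n m :
  (forall j, (n <= j <= m)%nat -> a j <= b j) ->
  sum_n_m a n m <= sum_n_m b n m.
Proof.
  intros H; destruct (le_lt_dec n m) as [Hnm|Hnm].
  2:{ rewrite !sum_n_m_zero by easy; apply Rle_refl. }
  induction Hnm as [|m Hnm IH].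
  - rewrite !sum_n_n; apply H; lia.
  - rewrite !sum_n_Sm by lia; apply Rplus_le_compat.
    + apply IH; intros; apply H; lia.
    + apply H; lia.
Qed.

Lemma sum_zero_R (a : nat -> R) n m :
  (forall j, (n <= j <= m)%nat -> a j = 0) -> sum_n_m a n m = 0.
Proof.
  intros H; rewrite (sum_n_m_ext_loc _ (fun _ => 0)) by auto.
  rewrite sum_n_m_const; ringR.
Qed.

Lemma sum_last_R (a : nat -> R) n m :
  (n <= S m)%nat -> sum_n_m a n (S m) = sum_n_m a n m + a (S m).
Proof. intros H; now rewrite sum_n_Sm. Qed.

Lemma sum_first_R (a : nat -> R) n m :
  (n <= m)%nat -> sum_n_m a n m = a n + sum_n_m a (S n) m.
Proof. intros H; now rewrite sum_Sn_m. Qed.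

Lemma jump_interior N x w j :
  (0 < j < N)%nat -> jump N x w j = w j (x j) - w (S j) (x j).
Proof.
  intros H; unfold jump.
  destruct (Nat.eqb_spec j 0); [lia|]; destruct (Nat.eqb_spec j N); [lia|].
  reflexivity.
Qed.

Lemma jump_0 N x w : jump N x w 0 = - w 1%nat (x 0%nat).
Proof. reflexivity. Qed.

Lemma jump_N N x w : (0 < N)%nat -> jump N x w N = w N (x N).
Proof.
  intros H; unfold jump.
  destruct (Nat.eqb_spec N 0); [lia|]; now rewrite Nat.eqb_refl.
Qed.

Lemma avg_interior N x w j :
  (0 < j < N)%nat -> avg N x w j = / 2 * (w (S j) (x j) + w j (x j)).
Proof.
  intros H; unfold avg.
  destruct (Nat.eqb_spec j 0); [lia|]; destruct (Nat.eqb_spec j N); [lia|].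
  reflexivity.
Qed.

Lemma avg_0 N x w : avg N x w 0 = w 1%nat (x 0%nat).
Proof. reflexivity. Qed.

Lemma avg_N N x w : (0 < N)%nat -> avg N x w N = w N (x N).
Proof.
  intros H; unfold avg.
  destruct (Nat.eqb_spec N 0); [lia|]; now rewrite Nat.eqb_refl.
Qed.

Lemma node_cases N (P : nat -> Prop) :
  (0 < N)%nat -> P 0%nat -> P N -> (forall j, (0 < j < N)%nat -> P j) ->
  forall j, (j <= N)%nat -> P j.
Proof.
  intros HN H0 HNN Hi j Hj.
  destruct (Nat.eq_dec j 0) as [->|]; [easy|].
  destruct (Nat.eq_dec j N) as [->|]; [easy|apply Hi; lia].
Qed.

Lemma sum_jump N x w :
  (0 < N)%nat ->
  sum_n_m (fun j => w j (x j) - w j (x (j - 1)%nat)) 1 N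
  = sum_n_m (jump N x w) 0 N.
Proof.
  intros HN.
  (* Node [n] already carries the trace from element [n + 1], whose other end is not yet counted. *)
  assert (H : forall n, (n < N)%nat ->
    sum_n_m (jump N x w) 0 n
    = sum_n_m (fun j => w j (x j) - w j (x (j - 1)%nat)) 1 n - w (S n) (x n)).
  { induction n as [|n IH]; intros Hn.
    - rewrite sum_n_n, sum_n_m_zero, jump_0 by lia.
      unfold zero; simpl; ringR.
    - rewrite !sum_last_R, IH, jump_interior by lia.
      replace (S n - 1)%nat with n by lia; ringR. }
  destruct N as [|n]; [lia|].
  rewrite !sum_last_R, H, jump_N by lia.
  replace (S n - 1)%nat with n by lia; ringR.
Qed.

Lemma broken_int_ext N x g g' :
  (forall j, (1 <= j <= N)%nat -> x (j - 1)%nat <= x j) ->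
  (forall j t, (1 <= j <= N)%nat -> x (j - 1)%nat < t < x j -> g j t = g' j t) ->
  broken_int N x g = broken_int N x g'.
Proof.
  intros Hx H; apply sum_n_m_ext_loc; intros j Hj.
  apply RInt_ext; rewrite Rmin_left, Rmax_right by auto; auto.
Qed.

Lemma broken_int_plus N x g g' :
  (forall j, (1 <= j <= N)%nat -> cont (g j)) ->
  (forall j, (1 <= j <= N)%nat -> cont (g' j)) ->
  broken_int N x (fun j t => g j t + g' j t)
  = broken_int N x g + broken_int N x g'.
Proof.
  intros H H'; unfold broken_int; rewrite <- sum_plus_R.
  apply sum_n_m_ext_loc; intros j Hj; apply RInt_cont_plus; auto.
Qed.

Lemma broken_int_minus N x g g' :
  (forall j, (1 <= j <= N)%nat -> cont (g j)) ->
  (forall j, (1 <= j <= N)%nat -> cont (g' j)) ->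
  broken_int N x (fun j t => g j t - g' j t)
  = broken_int N x g - broken_int N x g'.
Proof.
  intros H H'; unfold broken_int; rewrite <- sum_minus_R.
  apply sum_n_m_ext_loc; intros j Hj; apply RInt_cont_minus; auto.
Qed.

Lemma broken_int_scal N x c g :
  (forall j, (1 <= j <= N)%nat -> cont (g j)) ->
  broken_int N x (fun j t => c * g j t) = c * broken_int N x g.
Proof.
  intros H; unfold broken_int; rewrite <- sum_scal_R.
  apply sum_n_m_ext_loc; intros j Hj; apply RInt_cont_scal; auto.
Qed.

Definition piecewise_cdiff (N : nat) (w : nat -> R -> R) : Prop :=
  forall j, (1 <= j <= N)%nat -> cdiff (w j).

Lemma piecewise_cdiff_cont N w j :
  piecewise_cdiff N w -> (1 <= j <= N)%nat -> cont (w j).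
Proof. intros H Hj; now apply cdiff_cont, H. Qed.

Lemma piecewise_cdiff_cont_derive N w j :
  piecewise_cdiff N w -> (1 <= j <= N)%nat -> cont (broken_derive w j).
Proof. intros H Hj; now apply cdiff_cont_Derive, H. Qed.

#[local] Hint Resolve piecewise_cdiff_cont piecewise_cdiff_cont_derive
  cdiff_cont cdiff_cont_Derive : core.

Lemma piecewise_cdiff_minus N w v :
  piecewise_cdiff N w -> piecewise_cdiff N v ->
  piecewise_cdiff N (broken_minus w v).
Proof. intros Hw Hv j Hj; apply cdiff_minus; auto. Qed.

Lemma broken_derive_minus N w v j t :
  piecewise_cdiff N w -> piecewise_cdiff N v -> (1 <= j <= N)%nat ->
  broken_derive (broken_minus w v) j t = broken_derive w j t - broken_derive v j t.
Proof. intros Hw Hv Hj; apply Derive_minus_cdiff; auto. Qed.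

Lemma broken_int_derive N x w :
  (0 < N)%nat -> piecewise_cdiff N w ->
  broken_int N x (broken_derive w) = sum_n_m (jump N x w) 0 N.
Proof.
  intros HN Hw; rewrite <- sum_jump by easy.
  apply sum_n_m_ext_loc; intros j Hj; now apply RInt_Derive_cdiff, Hw.
Qed.

Lemma jump_minus N x w v j :
  jump N x (broken_minus w v) j = jump N x w j - jump N x v j.
Proof.
  unfold jump, lim_plus, lim_minus, broken_minus.
  destruct (j =? 0)%nat; [ringR|]; destruct (j =? N)%nat; ringR.
Qed.

Lemma avg_derive_minus N x w v j :
  (0 < N)%nat -> piecewise_cdiff N w -> piecewise_cdiff N v -> (j <= N)%nat ->
  avg N x (broken_derive (broken_minus w v)) j
  = avg N x (broken_derive w) j - avg N x (broken_derive v) j.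
Proof.
  intros HN Hw Hv; revert j; apply node_cases; [easy| | |].
  - rewrite !avg_0; apply (broken_derive_minus N); auto; lia.
  - rewrite !avg_N by easy; apply (broken_derive_minus N); auto; lia.
  - intros j Hj; rewrite !avg_interior by easy.
    rewrite !(broken_derive_minus N) by (auto; lia); ringR.
Qed.

(** * Linearity, consistency and coercivity of the form *)

Lemma nipg_form_minus eps b c mu N x w1 w2 v :
  (0 < N)%nat -> (forall j, (1 <= j <= N)%nat -> x (j - 1)%nat <= x j) ->
  cont b -> cont c ->
  piecewise_cdiff N w1 -> piecewise_cdiff N w2 -> piecewise_cdiff N v ->
  nipg_form eps b c mu N x (broken_minus w1 w2) v
  = nipg_form eps b c mu N x w1 v - nipg_form eps b c mu N x w2 v.
Proof.
  intros HN Hx Hb Hc H1 H2 Hv; unfold nipg_form.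
  rewrite (broken_int_ext N x
    (fun j t => eps * broken_derive (broken_minus w1 w2) j t * broken_derive v j t)
    (fun j t => eps * broken_derive w1 j t * broken_derive v j t
       - eps * broken_derive w2 j t * broken_derive v j t))
    by (auto; intros; rewrite (broken_derive_minus N) by auto; ringR).
  rewrite (broken_int_ext N x
    (fun j t => b t * broken_derive (broken_minus w1 w2) j t * v j t)
    (fun j t => b t * broken_derive w1 j t * v j t
       - b t * broken_derive w2 j t * v j t))
    by (auto; intros; rewrite (broken_derive_minus N) by auto; ringR).
  rewrite (broken_int_ext N x
    (fun j t => c t * broken_minus w1 w2 j t * v j t)
    (fun j t => c t * w1 j t * v j t - c t * w2 j t * v j t))
    by (auto; intros; unfold broken_minus; ringR).
  rewrite !broken_int_minus by (intros; solve_cont).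
  rewrite (sum_n_m_ext_loc
    (fun j => avg N x (broken_derive (broken_minus w1 w2)) j * jump N x v j)
    (fun j => avg N x (broken_derive w1) j * jump N x v j
       - avg N x (broken_derive w2) j * jump N x v j))
    by (intros j Hj; rewrite avg_derive_minus by (auto; lia); ringR).
  rewrite (sum_n_m_ext
    (fun j => jump N x (broken_minus w1 w2) j * avg N x (broken_derive v) j)
    (fun j => jump N x w1 j * avg N x (broken_derive v) j
       - jump N x w2 j * avg N x (broken_derive v) j))
    by (intros j; rewrite jump_minus; ringR).
  rewrite (sum_n_m_ext
    (fun j => mu j * jump N x (broken_minus w1 w2) j * jump N x v j)
    (fun j => mu j * jump N x w1 j * jump N x v j
       - mu j * jump N x w2 j * jump N x v j))
    by (intros j; rewrite jump_minus; ringR).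
  rewrite (sum_n_m_ext
    (fun j => b (x j) * jump N x (broken_minus w1 w2) j * lim_plus x v j)
    (fun j => b (x j) * jump N x w1 j * lim_plus x v j
       - b (x j) * jump N x w2 j * lim_plus x v j))
    by (intros j; rewrite jump_minus; ringR).
  rewrite !sum_minus_R; ringR.
Qed.

(** All jumps of [U] vanish, so of the interface terms only the sum of [{U'} [v]] survives. By
    continuity of [U'] it is the sum of the jumps of [U' v], that is, the integral of
    [U'' v + U' v'], whose second part cancels the diffusion integral. *)
Lemma nipg_form_consistent eps b c f mu N x U v :
  (0 < N)%nat -> (forall j, (1 <= j <= N)%nat -> x (j - 1)%nat <= x j) ->
  cont b -> cont c -> cdiff U -> cdiff (Derive U) -> piecewise_cdiff N v ->
  U (x 0%nat) = 0 -> U (x N) = 0 ->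
  (forall j t, (1 <= j <= N)%nat -> x (j - 1)%nat < t < x j ->
     - eps * Derive (Derive U) t + b t * Derive U t + c t * U t = f t) ->
  nipg_form eps b c mu N x (fun _ => U) v
  = broken_int N x (fun j t => f t * v j t).
Proof.
  intros HN Hx Hb Hc HU HU' Hv H0 H1 Heq.
  assert (Hj0 : forall j, (j <= N)%nat -> jump N x (fun _ => U) j = 0).
  { apply node_cases; [easy|rewrite jump_0, H0; ringR|now rewrite jump_N|].
    intros j Hj; rewrite jump_interior by easy; ringR. }
  assert (HUv : piecewise_cdiff N (fun j t => Derive U t * v j t)).
  { intros j Hj; apply cdiff_mult; auto. }
  assert (Hjmp : sum_n_m (fun j =>
      avg N x (broken_derive (fun _ => U)) j * jump N x v j) 0 N
    = broken_int N x (fun j t =>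
        Derive (Derive U) t * v j t + Derive U t * broken_derive v j t)).
  { rewrite (broken_int_ext N x _ (broken_derive (fun j t => Derive U t * v j t))).
    - rewrite broken_int_derive by easy.
      apply sum_n_m_ext_loc; intros j [_ Hj]; revert j Hj.
      apply node_cases; [easy| | |].
      + rewrite avg_0, !jump_0; unfold broken_derive; ringR.
      + rewrite avg_N, !jump_N by easy; reflexivity.
      + intros j Hj; rewrite avg_interior, !jump_interior by easy.
        unfold broken_derive; fieldR.
    - easy.
    - intros j t Hj _; symmetry; apply Derive_mult_cdiff; auto. }
  unfold nipg_form; rewrite Hjmp.
  rewrite (sum_zero_R (fun j => jump N x (fun _ => U) j * _))
    by (intros j Hj; rewrite Hj0 by easy; ringR).
  rewrite (sum_zero_R (fun j => mu j * jump N x (fun _ => U) j * _))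
    by (intros j Hj; rewrite Hj0 by easy; ringR).
  rewrite (sum_zero_R (fun j => b (x j) * jump N x (fun _ => U) j * _))
    by (intros j Hj; rewrite Hj0 by lia; ringR).
  unfold broken_derive at 1 4.
  rewrite <- (broken_int_scal N x eps)
    by (intros; solve_cont).
  rewrite !Rmult_0_r, !Rplus_0_r, Rminus_0_r.
  rewrite <- broken_int_minus by (intros; solve_cont).
  rewrite <- !broken_int_plus by (intros; solve_cont).
  apply broken_int_ext; [easy|].
  intros j t Hj Ht; rewrite <- (Heq j t Hj Ht); ringR.
Qed.

Lemma broken_int_le N x g g' :
  (forall j, (1 <= j <= N)%nat -> x (j - 1)%nat <= x j) ->
  (forall j, (1 <= j <= N)%nat -> cont (g j)) ->
  (forall j, (1 <= j <= N)%nat -> cont (g' j)) ->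
  (forall j t, (1 <= j <= N)%nat -> x (j - 1)%nat < t < x j -> g j t <= g' j t) ->
  broken_int N x g <= broken_int N x g'.
Proof.
  intros Hx Hg Hg' H; apply sum_le_R; intros j Hj.
  apply RInt_cont_le; auto.
Qed.

Definition nipg_norm_sq (eps gamma : R) (b : R -> R) (mu : nat -> R)
    (N : nat) (x : nat -> R) (v : nat -> R -> R) : R :=
  eps * broken_int N x (fun j t => broken_derive v j t ^ 2)
  + gamma * broken_int N x (fun j t => v j t ^ 2)
  + sum_n_m (fun j => (mu j + / 2 * b (x j)) * jump N x v j ^ 2) 0 N.

(** The two flux sums are opposite for [w = v] and cancel. In the convection integral [b v' v] is
    half of [(b v^2)' - b' v^2]: the second part joins [c], the first the upwind flux. *)
Lemma nipg_form_coercive eps gamma b c mu N x v :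
  (0 < N)%nat -> (forall j, (1 <= j <= N)%nat -> x (j - 1)%nat <= x j) ->
  cdiff b -> cont c -> piecewise_cdiff N v ->
  (forall j t, (1 <= j <= N)%nat -> x (j - 1)%nat < t < x j ->
     gamma <= c t - / 2 * Derive b t) ->
  nipg_norm_sq eps gamma b mu N x v <= nipg_form eps b c mu N x v v.
Proof.
  intros HN Hx Hb Hc Hv Hg.
  assert (Hbc := cdiff_cont b Hb); assert (Hbc' := cdiff_cont_Derive b Hb).
  assert (Hvv : piecewise_cdiff N (fun j t => v j t * v j t)).
  { intros j Hj; apply cdiff_mult; auto. }
  assert (Hbv : piecewise_cdiff N (fun j t => b t * (v j t * v j t))).
  { intros j Hj; apply cdiff_mult; auto. }
  assert (Hconv : broken_int N x (fun j t => b t * broken_derive v j t * v j t)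
    = / 2 * sum_n_m (jump N x (fun j t => b t * (v j t * v j t))) 0 N
      - broken_int N x (fun j t => / 2 * (Derive b t * (v j t * v j t)))).
  { rewrite <- broken_int_derive, <- broken_int_scal, <- broken_int_minus
      by (auto; intros; solve_cont).
    apply broken_int_ext; [easy|]; intros j t Hj _.
    unfold broken_derive at 2.
    rewrite Derive_mult_cdiff by auto.
    rewrite Derive_mult_cdiff by auto.
    unfold broken_derive; fieldR. }
  (* At an interior node [(v-^2 - v+^2) / 2 - (v- - v+) v+ = (v- - v+)^2 / 2]. At node 0 the left
     trace counts as zero; at node [N], which has no upwind term, the right one does. *)
  assert (Hnode : / 2 * sum_n_m (jump N x (fun j t => b t * (v j t * v j t))) 0 N
      - sum_n_m (fun j => b (x j) * jump N x v j * lim_plus x v j) 0 (N - 1)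
    = sum_n_m (fun j => / 2 * b (x j) * jump N x v j ^ 2) 0 N).
  { rewrite <- sum_scal_R.
    destruct N as [|n]; [lia|]; replace (S n - 1)%nat with n by lia.
    rewrite !sum_last_R, !jump_N by lia.
    rewrite (sum_n_m_ext_loc
      (fun j => / 2 * b (x j) * jump (S n) x v j ^ 2)
      (fun j => / 2 * jump (S n) x (fun j t => b t * (v j t * v j t)) j
         - b (x j) * jump (S n) x v j * lim_plus x v j)).
    - rewrite sum_minus_R; simpl; ringR.
    - intros j [_ Hj]; unfold lim_plus; destruct j as [|j].
      + rewrite !jump_0; fieldR.
      + rewrite !jump_interior by lia; fieldR. }
  unfold nipg_form, nipg_norm_sq; rewrite Hconv.
  rewrite (sum_n_m_ext
    (fun j => jump N x v j * avg N x (broken_derive v) j)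
    (fun j => avg N x (broken_derive v) j * jump N x v j))
    by (intros; apply Rmult_comm).
  rewrite (sum_n_m_ext
    (fun j => (mu j + / 2 * b (x j)) * jump N x v j ^ 2)
    (fun j => mu j * jump N x v j * jump N x v j
              + / 2 * b (x j) * jump N x v j ^ 2)) by (intros; ringR).
  rewrite sum_plus_R, <- Hnode.
  rewrite (broken_int_ext N x
    (fun j t => eps * broken_derive v j t * broken_derive v j t)
    (fun j t => eps * broken_derive v j t ^ 2)) by (auto; intros; ringR).
  rewrite (broken_int_scal N x eps) by (intros; solve_cont).
  assert (Hreact : gamma * broken_int N x (fun j t => v j t ^ 2)
    <= broken_int N x (fun j t => c t * v j t * v j t)
       - broken_int N x (fun j t => / 2 * (Derive b t * (v j t * v j t)))).
  { rewrite <- broken_int_scal, <- broken_int_minus by (intros; solve_cont).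
    apply broken_int_le; [easy|intros; solve_cont|intros; solve_cont|].
    intros j t Hj Ht; specialize (Hg j t Hj Ht).
    pose proof (pow2_ge_0 (v j t)); nra. }
  lra.
Qed.

(* The traces [w(x_j^-)] vanish for both interpolation errors, so that the
   upwind flux cancels against the boundary terms of the integration by parts. *)
Lemma nipg_form_right_zero eps b c mu N x w v :
  (0 < N)%nat -> (forall j, (1 <= j <= N)%nat -> x (j - 1)%nat <= x j) ->
  cdiff b -> cont c -> piecewise_cdiff N w -> piecewise_cdiff N v ->
  (forall j, (1 <= j <= N)%nat -> w j (x j) = 0) ->
  nipg_form eps b c mu N x w v =
  sum_n_m (fun j =>
    eps * RInt (fun t => broken_derive w j t * broken_derive v j t)
            (x (j - 1)%nat) (x j)
    + RInt (fun t => (c t - Derive b t) * w j t * v j t) (x (j - 1)%nat) (x j)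
    - RInt (fun t => b t * w j t * broken_derive v j t) (x (j - 1)%nat) (x j)) 1 N
  + sum_n_m (fun j =>
      - (eps * avg N x (broken_derive w) j * jump N x v j)
      + jump N x w j * (eps * avg N x (broken_derive v) j + mu j * jump N x v j))
      0 N.
Proof.
  intros HN Hx Hb Hc Hw Hv Hw0.
  assert (Hbc := cdiff_cont b Hb); assert (Hbc' := cdiff_cont_Derive b Hb).
  assert (Hwv : piecewise_cdiff N (fun j t => w j t * v j t)).
  { intros j Hj; apply cdiff_mult; auto. }
  assert (Hbwv : piecewise_cdiff N (fun j t => b t * (w j t * v j t))).
  { intros j Hj; apply cdiff_mult; auto. }
  assert (Hconv : broken_int N x (fun j t => b t * broken_derive w j t * v j t)
    = sum_n_m (jump N x (fun j t => b t * (w j t * v j t))) 0 N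
      - broken_int N x (fun j t => Derive b t * w j t * v j t)
      - broken_int N x (fun j t => b t * w j t * broken_derive v j t)).
  { rewrite <- broken_int_derive, <- !broken_int_minus
      by (auto; intros; solve_cont).
    apply broken_int_ext; [easy|]; intros j t Hj _.
    unfold broken_derive at 2.
    rewrite Derive_mult_cdiff by auto.
    rewrite Derive_mult_cdiff by auto.
    unfold broken_derive; ringR. }
  (* Since [w(x_j^-) = 0], the jump of [b w v] is [- b w+ v+ = b [w] v+] at every node before [N],
     and it vanishes at [N]: exactly the upwind sum. *)
  assert (Hnode : sum_n_m (jump N x (fun j t => b t * (w j t * v j t))) 0 N
    = sum_n_m (fun j => b (x j) * jump N x w j * lim_plus x v j) 0 (N - 1)).
  { destruct N as [|n]; [lia|]; replace (S n - 1)%nat with n by lia.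
    rewrite sum_last_R, jump_N, Hw0 by lia.
    rewrite Rmult_0_l, Rmult_0_r, Rplus_0_r.
    apply sum_n_m_ext_loc; intros j [_ Hj]; unfold lim_plus; destruct j as [|j].
    - rewrite !jump_0; ringR.
    - rewrite !jump_interior, Hw0 by lia; ringR. }
  unfold nipg_form; rewrite Hconv, Hnode.
  rewrite (sum_minus_R (fun j => eps * RInt _ _ _ + RInt _ _ _)).
  rewrite (sum_plus_R (fun j => eps * RInt _ _ _)), (sum_scal_R eps (fun j => RInt _ _ _)).
  rewrite (sum_n_m_ext (fun j => - _ + _) (fun j =>
    - eps * (avg N x (broken_derive w) j * jump N x v j)
    + eps * (jump N x w j * avg N x (broken_derive v) j)
    + mu j * jump N x w j * jump N x v j)) by (intros; ringR).
  rewrite !sum_plus_R, !sum_scal_R.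
  rewrite (broken_int_ext N x
    (fun j t => eps * broken_derive w j t * broken_derive v j t)
    (fun j t => eps * (broken_derive w j t * broken_derive v j t)))
    by (auto; intros; ringR).
  rewrite broken_int_scal by (intros; solve_cont).
  assert (Hreact : sum_n_m (fun j =>
      RInt (fun t => (c t - Derive b t) * w j t * v j t) (x (j - 1)%nat) (x j)) 1 N
    = broken_int N x (fun j t => c t * w j t * v j t)
      - broken_int N x (fun j t => Derive b t * w j t * v j t)).
  { rewrite <- broken_int_minus by (intros; solve_cont).
    apply (broken_int_ext N x (fun j t => (c t - Derive b t) * w j t * v j t));
      [easy|]; intros; ringR. }
  match goal with |- _ = eps * ?s1 + ?s2 - ?s3 + _ =>
    change s1 with (broken_int N x
      (fun j t => broken_derive w j t * broken_derive v j t));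
    change s3 with (broken_int N x (fun j t => b t * w j t * broken_derive v j t));
    replace s2 with (broken_int N x (fun j t => c t * w j t * v j t)
      - broken_int N x (fun j t => Derive b t * w j t * v j t))
      by (symmetry; exact Hreact)
  end; ringR.
Qed.

(** * The mesh *)

(* For [M <= j] one has [exp (- alpha (1 - x_j) / eps) = layer_arg eps M j ^ sigma]. *)
Definition layer_arg (eps : R) (M j : nat) : R :=
  eps + (1 - eps) * (INR j - INR M) / INR M.

Lemma mesh_coarse sigma alpha eps M j :
  0 < alpha -> (0 < M)%nat -> (j <= M)%nat ->
  mesh sigma alpha eps (2 * M) j = tau sigma alpha eps * INR j / INR M.
Proof.
  intros Ha HM Hj; apply lt_0_INR in HM as HM'.
  unfold mesh, psi; rewrite mult_INR; simpl (INR 2).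
  destruct (Rlt_dec _ _) as [_|Hn].
  - field; lra.
  (* The transition point falls into the logarithmic branch of [psi], where both formulas give
     [tau]. *)
  - destruct (Nat.eq_dec j M) as [->|Hne].
    + unfold tau.
      replace (1 + 2 * (1 - eps) * (INR M / ((1 + 1) * INR M) - 1)) with eps
        by (field; lra).
      field; lra.
    + exfalso; apply Hn.
      assert (H : (j < M)%nat) by lia; apply lt_INR in H.
      apply (proj2 (Rlt_div_l (INR j) (1 / 2) ((1 + 1) * INR M) ltac:(lra))).
      lra.
Qed.

Lemma mesh_fine sigma alpha eps M j :
  (0 < M)%nat -> (M <= j)%nat ->
  mesh sigma alpha eps (2 * M) j
  = 1 + sigma * eps / alpha * ln (layer_arg eps M j).
Proof.
  intros HM Hj; apply lt_0_INR in HM as HM'; apply le_INR in Hj.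
  unfold mesh, psi, layer_arg; rewrite mult_INR; simpl (INR 2).
  destruct (Rlt_dec _ _) as [Hn|_].
  - exfalso.
    apply (Rlt_div_l (INR j) (1 / 2) ((1 + 1) * INR M) ltac:(lra)) in Hn; lra.
  - do 3 f_equal; field; lra.
Qed.

Lemma layer_arg_S eps M j :
  (0 < M)%nat ->
  layer_arg eps M (S j) = layer_arg eps M j + (1 - eps) / INR M.
Proof.
  intros HM; apply lt_0_INR in HM; unfold layer_arg; rewrite S_INR; field; lra.
Qed.

Lemma layer_arg_ge eps M j :
  0 < eps < 1 -> (0 < M)%nat -> (M <= j)%nat -> eps <= layer_arg eps M j.
Proof.
  intros He HM Hj; apply lt_0_INR in HM; apply le_INR in Hj; unfold layer_arg.
  assert (0 <= (1 - eps) * (INR j - INR M) / INR M)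
    by (apply Rdiv_le_0_compat; nra).
  lra.
Qed.

(** The extra [(1 - eps) / INR M] is what distinguishes the elements beyond the transition element:
    it forces their widths to be of order [eps]. *)
Lemma layer_arg_ge_S eps M j :
  0 < eps < 1 -> (0 < M)%nat -> (M < j)%nat ->
  eps + (1 - eps) / INR M <= layer_arg eps M j.
Proof.
  intros He HM Hj; destruct j as [|j]; [lia|].
  rewrite layer_arg_S by easy.
  pose proof (layer_arg_ge eps M j He HM ltac:(lia)); lra.
Qed.

Lemma layer_arg_le eps M j :
  0 < eps < 1 -> (0 < M)%nat -> (j <= 2 * M)%nat -> layer_arg eps M j <= 1.
Proof.
  intros He HM Hj; apply lt_0_INR in HM; apply le_INR in Hj.
  rewrite mult_INR in Hj; simpl (INR 2) in Hj; unfold layer_arg.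
  assert ((1 - eps) * (INR j - INR M) / INR M <= 1 - eps); [|lra].
  apply (proj2 (Rle_div_l _ _ (INR M) HM)); nra.
Qed.

Lemma ln_le_sub_1 x : 0 < x -> ln x <= x - 1.
Proof.
  intros Hx; rewrite <- (ln_exp (x - 1)).
  apply ln_le; [easy|].
  pose proof (exp_ineq1_le (x - 1)); lra.
Qed.

(** From [ln (1 + y) <= y]. The last bound expresses the grading of the mesh: the width is at most
    of order [eps / M] divided by [layer_arg] at the left end. *)
Lemma mesh_width_fine sigma alpha eps M j :
  0 < alpha -> 0 < sigma -> 0 < eps < 1 -> (0 < M)%nat -> (M <= j)%nat ->
  let h := mesh sigma alpha eps (2 * M) (S j) - mesh sigma alpha eps (2 * M) j in
  0 < h /\
  h = sigma / alpha * eps *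
      ln (1 + (1 - eps) / (INR M * layer_arg eps M j)) /\
  INR M * h * layer_arg eps M j <= sigma / alpha * eps.
Proof.
  intros Ha Hs He HM Hj h.
  apply lt_0_INR in HM as HM'.
  assert (Hq := layer_arg_ge eps M j He HM Hj).
  set (q := layer_arg eps M j) in *.
  assert (Hy : 0 < (1 - eps) / (INR M * q)).
  { apply Rdiv_lt_0_compat; [lra|nra]. }
  assert (HA : 0 < sigma / alpha) by (apply Rdiv_lt_0_compat; lra).
  assert (Hh : h = sigma / alpha * eps * ln (1 + (1 - eps) / (INR M * q))).
  { unfold h; rewrite !mesh_fine, layer_arg_S by lia; fold q.
    replace (1 + (1 - eps) / (INR M * q)) with ((q + (1 - eps) / INR M) / q)
      by (field; lra).
    assert (0 < (1 - eps) / INR M) by (apply Rdiv_lt_0_compat; lra).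
    rewrite (ln_div (q + (1 - eps) / INR M) q) by lra; field; lra. }
  assert (Hln : ln (1 + (1 - eps) / (INR M * q)) <= (1 - eps) / (INR M * q)).
  { eapply Rle_trans; [apply ln_le_sub_1|]; lra. }
  split; [|split; [easy|]].
  - rewrite Hh; apply Rmult_lt_0_compat; [nra|].
    rewrite <- ln_1; apply ln_increasing; lra.
  - rewrite Hh.
    replace (sigma / alpha * eps)
      with (INR M * q * (sigma / alpha * eps * / (INR M * q))) at 2
      by (field; lra).
    replace (INR M * (sigma / alpha * eps * ln (1 + (1 - eps) / (INR M * q))) * q)
      with (INR M * q * (sigma / alpha * eps * ln (1 + (1 - eps) / (INR M * q))))
      by ring.
    assert (0 < / (INR M * q)) by (apply Rinv_0_lt_compat; nra).
    apply Rmult_le_compat_l; [nra|]; apply Rmult_le_compat_l; [nra|].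
    unfold Rdiv in Hln |- *; nra.
Qed.

(** [layer_arg] is at most 1, so its exponent may be lowered from [sigma] to [n]; [sigma >= k + 1]
    admits every [n] up to [k + 1]. *)
Lemma layer_decay sigma alpha eps M j n :
  0 < alpha -> INR n <= sigma -> 0 < eps < 1 ->
  (0 < M)%nat -> (M <= j <= 2 * M)%nat ->
  exp (- alpha * (1 - mesh sigma alpha eps (2 * M) j) / eps)
  <= layer_arg eps M j ^ n.
Proof.
  intros Ha Hs He HM [Hj Hj2].
  rewrite mesh_fine by easy.
  assert (Hq := layer_arg_ge eps M j He HM Hj).
  assert (Hq1 := layer_arg_le eps M j He HM Hj2).
  set (q := layer_arg eps M j) in *.
  rewrite <- Rpower_pow by lra; unfold Rpower.
  replace (- alpha * (1 - (1 + sigma * eps / alpha * ln q)) / eps)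
    with (sigma * ln q) by (field; lra).
  assert (Hl : ln q <= 0) by (rewrite <- ln_1; apply ln_le; lra).
  destruct (Req_dec (sigma * ln q) (INR n * ln q)) as [->|Hne]; [lra|].
  left; apply exp_increasing; nra.
Qed.

Lemma mesh_facts k sigma alpha C0 :
  0 < alpha -> INR k + 1 <= sigma ->
  exists K, 1 <= K /\
  forall eps M, 0 < eps < 1 -> (2 <= M)%nat ->
  1 / 2 <= tau sigma alpha eps -> eps <= C0 * / INR (2 * M) ->
  let x := mesh sigma alpha eps (2 * M) in
  let h := fun j => x j - x (j - 1)%nat in
  let N := INR (2 * M) in
  let layer := fun j => exp (- alpha * (1 - x j) / eps) in
  x 0%nat = 0 /\ x (2 * M)%nat = 1 /\
  (forall j, (1 <= j <= 2 * M)%nat ->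
     0 <= x (j - 1)%nat /\ x (j - 1)%nat < x j /\ x j <= 1 /\ N * h j <= K) /\
  (forall j, (1 <= j <= M)%nat -> 1 <= N * h j) /\
  (forall j, (M + 2 <= j <= 2 * M)%nat ->
     h j <= K * eps /\
     forall n, (n <= k + 1)%nat -> (N * h j) ^ n * layer j <= (K * eps) ^ n) /\
  (forall j, (j <= M + 1)%nat -> N ^ (k + 1) * layer j <= K) /\
  (eps <= 1 / 2 -> eps <= K * h (M + 1)%nat).
Proof.
  intros Ha Hs.
  assert (Hs0 : 0 < sigma) by (pose proof (pos_INR k); lra).
  set (A := sigma / alpha).
  assert (HA : 0 < A) by (apply Rdiv_lt_0_compat; lra).
  set (D := Rabs C0 + 1).
  assert (HD : 1 <= D) by (pose proof (Rabs_pos C0); unfold D; lra).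
  assert (HD' : C0 <= D) by (pose proof (Rle_abs C0); unfold D; lra).
  assert (HlD : 0 < ln (1 + / D)).
  { assert (0 < / D) by (apply Rinv_0_lt_compat; lra).
    rewrite <- ln_1; apply ln_increasing; lra. }
  assert (HL : 0 < / (A * ln (1 + / D))) by (apply Rinv_0_lt_compat; nra).
  assert (HP : 1 <= (D + 2) ^ (k + 1)) by (apply pow_R1_Rle; lra).
  (* The summands serve in turn the equidistant widths ([N h = 2 tau]), the fine widths and their
     product with the layer, the layer at [x_(M+1)], where [N * layer_arg <= D + 2], and the lower
     bound for the width of the transition element. *)
  set (K := 2 + 4 * A + (D + 2) ^ (k + 1) + / (A * ln (1 + / D))).
  exists K; split; [unfold K; lra|].
  intros eps M He HM Htau HC0 x h N layer.
  assert (HM0 : (0 < M)%nat) by lia.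
  assert (HMR : 2 <= INR M) by (apply (le_INR 2); easy).
  assert (HN : N = 2 * INR M) by (unfold N; rewrite mult_INR; reflexivity).
  assert (HeN : N * eps <= D).
  { apply (Rmult_le_compat_l N) in HC0; [|lra].
    replace (N * (C0 * / INR (2 * M))) with C0 in HC0
      by (fold N; field; lra).
    lra. }
  assert (Htau1 : tau sigma alpha eps <= 1).
  { assert (ln eps < 0) by (rewrite <- ln_1; apply ln_increasing; lra).
    assert (0 < sigma * eps / alpha) by (apply Rdiv_lt_0_compat; nra).
    unfold tau; nra. }
  assert (Hc : forall j, (1 <= j <= M)%nat ->
    h j = tau sigma alpha eps / INR M).
  { intros j Hj; unfold h, x; rewrite !mesh_coarse by (easy || lia).
    rewrite minus_INR by lia; simpl; field; lra. }
  assert (Hf : forall j, (M <= j)%nat ->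
    0 < h (S j) /\
    h (S j) = A * eps * ln (1 + (1 - eps) / (INR M * layer_arg eps M j)) /\
    INR M * h (S j) * layer_arg eps M j <= A * eps).
  { intros j Hj; unfold h; replace (S j - 1)%nat with j by lia.
    now apply mesh_width_fine. }
  assert (Hpos : forall j, (1 <= j)%nat -> x (j - 1)%nat < x j).
  { intros j Hj; destruct (le_lt_dec j M) as [HjM|HjM].
    - assert (H := Hc j ltac:(lia)).
      assert (0 < tau sigma alpha eps / INR M) by (apply Rdiv_lt_0_compat; lra).
      unfold h in H; lra.
    - destruct j as [|j]; [lia|].
      destruct (Hf j ltac:(lia)) as [H _]; unfold h in H; lra. }
  assert (Hmono : forall i j, (i <= j)%nat -> x i <= x j).
  { induction 1 as [|j _ IH]; [lra|].
    assert (H := Hpos (S j) ltac:(lia)).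
    replace (S j - 1)%nat with j in H by lia; lra. }
  assert (Hx0 : x 0%nat = 0).
  { unfold x; rewrite mesh_coarse by (easy || lia); simpl; field; lra. }
  assert (HxN : x (2 * M)%nat = 1).
  { unfold x; rewrite mesh_fine by lia.
    replace (layer_arg eps M (2 * M)) with 1
      by (unfold layer_arg; rewrite mult_INR; simpl; field; lra).
    rewrite ln_1; ring. }
  split; [easy|]; split; [easy|]; split; [|split; [|split; [|split]]].
  - intros j Hj; split; [|split; [|split]].
    + rewrite <- Hx0; apply Hmono; lia.
    + apply Hpos; lia.
    + rewrite <- HxN; apply Hmono; lia.
    + destruct (le_lt_dec j M) as [HjM|HjM].
      * rewrite Hc, HN by lia.
        replace (2 * INR M * (tau sigma alpha eps / INR M))
          with (2 * tau sigma alpha eps) by (field; lra).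
        unfold K; lra.
      * destruct j as [|j]; [lia|].
        destruct (Hf j ltac:(lia)) as (Hh & _ & Hb).
        assert (Hq := layer_arg_ge eps M j He HM0 ltac:(lia)).
        assert (HMh : INR M * h (S j) <= A).
        { apply Rmult_le_reg_r with eps; [lra|].
          apply Rle_trans with (INR M * h (S j) * layer_arg eps M j); [|easy].
          apply Rmult_le_compat_l; [nra|easy]. }
        rewrite HN; unfold K; lra.
  - intros j Hj; rewrite Hc, HN by lia.
    replace (2 * INR M * (tau sigma alpha eps / INR M))
      with (2 * tau sigma alpha eps) by (field; lra).
    lra.
  - intros j Hj; destruct j as [|j]; [lia|].
    destruct (Hf j ltac:(lia)) as (Hh & _ & Hb).
    assert (Hq := layer_arg_ge_S eps M j He HM0 ltac:(lia)).
    assert (H0 : 0 < (1 - eps) / INR M) by (apply Rdiv_lt_0_compat; lra).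
    assert (HqM : 1 <= INR M * layer_arg eps M j).
    { apply Rle_trans with (INR M * (eps + (1 - eps) / INR M)).
      - replace (INR M * (eps + (1 - eps) / INR M))
          with (INR M * eps + (1 - eps)) by (field; lra); nra.
      - apply Rmult_le_compat_l; lra. }
    assert (HhA : h (S j) <= A * eps).
    { apply Rle_trans with (h (S j) * (INR M * layer_arg eps M j)).
      - nra.
      - lra. }
    split; [unfold K; nra|].
    intros n Hn.
    (* Past the first layer node [layer_arg] at most doubles over an element, so its value at the
       right end can be traded for the one at the left end, which the width bound controls. *)
    assert (HlayS : layer_arg eps M (S j) <= 2 * layer_arg eps M j).
    { rewrite layer_arg_S by easy; lra. }
    assert (Hlay : layer (S j) <= layer_arg eps M (S j) ^ n).
    { apply layer_decay; auto; [|lia].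
      apply le_INR in Hn; rewrite plus_INR in Hn; simpl in Hn; lra. }
    assert (HNh : 0 <= N * h (S j)) by (rewrite HN; nra).
    apply Rle_trans with ((N * h (S j)) ^ n * layer_arg eps M (S j) ^ n).
    + apply Rmult_le_compat_l; [now apply pow_le|easy].
    + rewrite <- Rpow_mult_distr; apply pow_incr; split.
      * apply Rmult_le_pos; [easy|].
        pose proof (layer_arg_ge eps M (S j) He HM0 ltac:(lia)); lra.
      * apply Rle_trans with (N * h (S j) * (2 * layer_arg eps M j)).
        -- now apply Rmult_le_compat_l.
        -- rewrite HN; unfold K; nra.
  - intros j Hj.
    apply Rle_trans with (N ^ (k + 1) * layer (M + 1)%nat).
    + apply Rmult_le_compat_l; [apply pow_le; lra|].
      assert (Hxj := Hmono j (M + 1)%nat Hj).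
      assert (Hle : - alpha * (1 - x j) / eps
        <= - alpha * (1 - x (M + 1)%nat) / eps).
      { apply Rmult_le_compat_r; [apply Rlt_le, Rinv_0_lt_compat; lra|nra]. }
      unfold layer; destruct Hle as [Hlt|Heq]; [|rewrite Heq; lra].
      left; now apply exp_increasing.
    + assert (Hlay : layer (M + 1)%nat <= layer_arg eps M (M + 1) ^ (k + 1)).
      { apply layer_decay; auto; [|lia]. rewrite plus_INR; simpl; lra. }
      assert (Hq := layer_arg_ge eps M (M + 1) He HM0 ltac:(lia)).
      apply Rle_trans with (N ^ (k + 1) * layer_arg eps M (M + 1) ^ (k + 1)).
      * apply Rmult_le_compat_l; [apply pow_le; lra|easy].
      * rewrite <- Rpow_mult_distr.
        apply Rle_trans with ((D + 2) ^ (k + 1)); [|unfold K; lra].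
        apply pow_incr; split; [nra|].
        replace (layer_arg eps M (M + 1)) with (eps + (1 - eps) / INR M)
          by (unfold layer_arg; rewrite plus_INR; simpl; field; lra).
        rewrite HN in HeN |- *.
        replace (2 * INR M * (eps + (1 - eps) / INR M))
          with (2 * INR M * eps + 2 * (1 - eps)) by (field; lra).
        lra.
  (* At the transition point [layer_arg] equals [eps]; with [eps <= 1 / 2] and [N * eps <= D] the
     argument of the logarithm is at least [1 + / D]. *)
  - intros He2; destruct (Hf M (le_n M)) as (Hh & Heq & _).
    replace (M + 1)%nat with (S M) by lia.
    assert (HqM : layer_arg eps M M = eps)
      by (unfold layer_arg; field; lra).
    rewrite HqM in Heq.
    assert (HDe : / D <= (1 - eps) / (INR M * eps)).
    { apply (proj1 (Rle_div_r (/ D) (1 - eps) (INR M * eps) ltac:(nra))).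
      rewrite Rmult_comm; apply (proj2 (Rle_div_l _ _ D ltac:(lra))); nra. }
    assert (0 < / D) by (apply Rinv_0_lt_compat; lra).
    assert (Hln : ln (1 + / D) <= ln (1 + (1 - eps) / (INR M * eps)))
      by (apply ln_le; lra).
    apply Rle_trans with (/ (A * ln (1 + / D)) * h (S M)).
    + rewrite Heq.
      apply Rle_trans with
        (/ (A * ln (1 + / D)) * (A * eps * ln (1 + / D))).
      * right; field; lra.
      * apply Rmult_le_compat_l; [lra|]; apply Rmult_le_compat_l; [nra|easy].
    + apply Rmult_le_compat_r; [lra|unfold K; lra].
Qed.

(** * Polynomial approximation of the solution *)

(** A function travels with the sequence of its derivatives, because at 0 and 1 these are
    derivatives of the extension and not [Derive_n] of the given function. *)
Definition derivatives (n : nat) (D : nat -> R -> R) : Prop :=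
  (forall i x, (i < n)%nat -> is_derive (D i) x (D (S i) x)) /\
  (forall i, (i <= n)%nat -> cont (D i)).

Definition layer_bounds (n : nat) (alpha eps C : R) (Sm El : nat -> R -> R)
  : Prop :=
  derivatives n Sm /\ derivatives n El /\
  forall i x, (i <= n)%nat -> 0 <= x <= 1 ->
  Rabs (Sm i x) <= C /\
  Rabs (El i x) <= C * / eps ^ i * exp (- alpha * (1 - x) / eps).

Lemma derivatives_plus n D D' :
  derivatives n D -> derivatives n D' ->
  derivatives n (fun i x => D i x + D' i x).
Proof.
  intros [H1 H2] [H1' H2']; split.
  - intros i x Hi; apply is_derive_plus_R; auto.
  - intros i Hi; apply cont_plus; auto.
Qed.

Lemma derivatives_cdiff n D i : derivatives n D -> (i < n)%nat -> cdiff (D i).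
Proof.
  intros [H1 H2] Hi; apply (cdiff_intro _ (D (S i))); auto.
Qed.

Lemma derivatives_Derive n D i x :
  derivatives n D -> (i < n)%nat -> Derive (D i) x = D (S i) x.
Proof. intros [H1 _] Hi; apply is_derive_unique; auto. Qed.

Lemma cont_le_closure f g :
  cont f -> cont g -> (forall x, 0 < x < 1 -> f x <= g x) ->
  forall x, 0 <= x <= 1 -> f x <= g x.
Proof.
  intros Hf Hg H x Hx.
  assert (0 <= g x - f x); [|lra].
  apply (cont_nonneg_closure (fun t => g t - f t)); [now apply cont_minus| |easy].
  intros t Ht; specialize (H t Ht); lra.
Qed.

Lemma cont_Rabs f : cont f -> cont (fun t => Rabs (f t)).
Proof.
  intros Hf x; apply (continuous_comp f Rabs); [apply Hf|apply continuous_Rabs].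
Qed.

(** Extends both parts of the splitting to the line and carries their derivative bounds to the
    closed interval by continuity. *)
Lemma solution_layer_bounds q alpha b c f :
  (2 <= q)%nat -> solution_decomposition q alpha b c f ->
  exists C, 1 <= C /\ forall eps u,
  0 < eps < 1 -> bvp_solution eps b c f u ->
  exists Sm El, layer_bounds q alpha eps C Sm El /\
  (forall x, 0 <= x <= 1 -> u x = Sm 0%nat x + El 0%nat x) /\
  forall x, 0 < x < 1 ->
    - eps * (Sm 2%nat x + El 2%nat x) + b x * (Sm 1%nat x + El 1%nat x)
    + c x * (Sm 0%nat x + El 0%nat x) = f x.
Proof.
  intros Hq [C HC]; exists (Rabs C + 1).
  split; [pose proof (Rabs_pos C); lra|].
  assert (HCC : C <= Rabs C + 1) by (pose proof (Rle_abs C); lra).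
  intros eps u He Hu.
  destruct (HC eps u He Hu) as (s & e & Hs & Hee & Hsum & HLs & HLe & Hb).
  rewrite Nat.max_r in Hs, Hee by easy.
  destruct (C_class_extend q s Hs) as (Sm & S1 & S2 & S3 & S4).
  destruct (C_class_extend q e Hee) as (El & E1 & E2 & E3 & E4).
  exists Sm, El; split; [|split].
  - split; [easy|]; split; [easy|]; intros i x Hi Hx; split.
    + revert x Hx; apply cont_le_closure;
        [apply cont_Rabs; auto|apply cont_const|].
      intros x Hx; rewrite S4 by auto.
      destruct (Hb i x Hi Hx); lra.
    + revert x Hx; apply cont_le_closure; [apply cont_Rabs; auto| |].
      * apply cont_mult; [apply cont_const|].
        intros x; apply (continuous_comp (fun t => - alpha * (1 - t) / eps) exp).
        -- assert (Hc : cont (fun t => - alpha * (1 - t) * / eps)) by solve_cont.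
           apply Hc.
        -- apply continuous_exp.
      * intros x Hx; rewrite E4 by auto.
        eapply Rle_trans; [apply (Hb i x Hi Hx)|].
        apply Rmult_le_compat_r; [left; apply exp_pos|].
        apply Rmult_le_compat_r; [|easy].
        left; apply Rinv_0_lt_compat, pow_lt; lra.
  - intros x Hx; rewrite Hsum, S3, E3; auto.
  - intros x Hx; rewrite !S4, !E4 by (lia || easy).
    specialize (HLs x Hx); specialize (HLe x Hx); unfold L_op in HLs, HLe.
    change (Derive_n s 1 x) with (Derive s x).
    change (Derive_n e 1 x) with (Derive e x).
    change (Derive_n s 0 x) with (s x); change (Derive_n e 0 x) with (e x).
    lra.
Qed.

Lemma Rabs_plus_le a b A B : Rabs a <= A -> Rabs b <= B -> Rabs (a + b) <= A + B.
Proof. intros; eapply Rle_trans; [apply Rabs_triang|lra]. Qed.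

Lemma Rabs_minus_le a b A B : Rabs a <= A -> Rabs b <= B -> Rabs (a - b) <= A + B.
Proof.
  intros; unfold Rminus; apply Rabs_plus_le; [easy|now rewrite Rabs_Ropp].
Qed.

Lemma layer_mono alpha eps x r :
  0 < alpha -> 0 < eps -> x <= r ->
  exp (- alpha * (1 - x) / eps) <= exp (- alpha * (1 - r) / eps).
Proof.
  intros Ha He Hx.
  assert (Hle : - alpha * (1 - x) / eps <= - alpha * (1 - r) / eps).
  { apply Rmult_le_compat_r; [apply Rlt_le, Rinv_0_lt_compat; lra|nra]. }
  destruct Hle as [Hlt|Heq]; [|rewrite Heq; lra].
  left; now apply exp_increasing.
Qed.

(** For [eps <= 1 / 2], [T] expands the smooth part alone and the layer part, of size [1 / W], goes
    into [A]; the second bound on [A] then uses [eps <= K * (r - l)]. For larger [eps],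
    [N * eps <= D] bounds [W] and [/ eps <= 2] tames the layer derivatives, so the full solution is
    expanded and [A] contains the factor [r - l] explicitly. *)
Lemma coarse_approx k alpha Cd K D :
  (1 <= k)%nat -> 0 < alpha -> 1 <= Cd -> 1 <= K -> 1 <= D ->
  exists K', 1 <= K' /\
  forall eps N l r Sm El,
  let W := N ^ (k + 1) in
  let U := fun t => Sm 0%nat t + El 0%nat t in
  0 < eps < 1 -> 1 <= N -> 0 <= l -> l < r -> r <= 1 -> N * (r - l) <= K ->
  N * eps <= D -> W * exp (- alpha * (1 - r) / eps) <= K ->
  (eps <= 1 / 2 -> eps <= K * (r - l)) ->
  layer_bounds (k + 2) alpha eps Cd Sm El ->
  exists T A, poly_le k T /\ 0 <= A /\ W * A <= K' /\
    eps * W * A <= K' * (r - l) /\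
    forall x, l <= x <= r ->
    Rabs (U x - T x) <= A /\ eps * W * Rabs (Derive U x - Derive T x) <= K'.
Proof.
  intros Hk Ha HCd HK HD.
  set (P1 := K ^ (k + 1)); set (P2 := K ^ k).
  set (P3 := (2 * D) ^ (k + 1)); set (G := Cd * (1 + 2 ^ (k + 1))).
  assert (HP1 : 1 <= P1) by (apply pow_R1_Rle; lra).
  assert (HP2 : 1 <= P2) by (apply pow_R1_Rle; lra).
  assert (HP3 : 1 <= P3) by (apply pow_R1_Rle; lra).
  assert (HG : 1 <= G).
  { unfold G; pose proof (pow_R1_Rle 2 (k + 1) ltac:(lra)); nra. }
  set (K1 := Cd * (P1 + K)).
  assert (HK1 : 1 <= K1) by (unfold K1; nra).
  exists (K * K1 + D * Cd * P2 + Cd * K + G * P1 + G * P3).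
  assert (Hz1 : 0 <= K * K1) by nra.
  assert (Hz1' : K1 <= K * K1) by nra.
  assert (Hz2 : 0 <= D * Cd * P2) by (apply Rmult_le_pos; nra).
  assert (Hz3 : 1 <= Cd * K) by nra.
  assert (Hz4 : 0 <= G * P1) by nra.
  assert (Hz5 : 0 <= G * P3) by nra.
  split; [lra|].
  intros eps N l r Sm El W U He HN Hl Hlr Hr HNh HNe HW Hhalf (HS & HE & Hb).
  set (lay := exp (- alpha * (1 - r) / eps)) in *.
  assert (Hlay : 0 < lay) by apply exp_pos.
  assert (HW1 : 1 <= W) by (apply pow_R1_Rle; lra).
  assert (HNh0 : 0 <= N * (r - l)) by nra.
  assert (HWh : W * (r - l) ^ (k + 1) <= P1).
  { unfold W, P1; rewrite <- Rpow_mult_distr; apply pow_incr; lra. }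
  assert (HWk : N ^ k * (r - l) ^ k <= P2).
  { unfold P2; rewrite <- Rpow_mult_distr; apply pow_incr; lra. }
  assert (Hh1 : (r - l) ^ k <= 1).
  { rewrite <- (pow1 k); apply pow_incr; lra. }
  assert (Hh0 : 0 <= (r - l) ^ k) by (apply pow_le; lra).
  assert (Hh0' : 0 <= (r - l) ^ (k + 1)) by (apply pow_le; lra).
  assert (HWN : W = N * N ^ k) by (unfold W; rewrite Nat.add_1_r; reflexivity).
  assert (Hhk : (r - l) ^ (k + 1) = (r - l) * (r - l) ^ k)
    by (rewrite Nat.add_1_r; reflexivity).
  destruct (Rle_or_lt eps (1 / 2)) as [Hhf|Hhf].
  - specialize (Hhalf Hhf).
    assert (Hblay : forall i x, (i <= k + 2)%nat -> l <= x <= r ->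
      Rabs (El i x) <= Cd * / eps ^ i * lay).
    { intros i x Hi Hx; destruct (Hb i x Hi ltac:(lra)) as [_ H].
      eapply Rle_trans; [exact H|].
      apply Rmult_le_compat_l.
      - apply Rmult_le_pos; [lra|]; left; apply Rinv_0_lt_compat, pow_lt; lra.
      - apply layer_mono; lra. }
    destruct (taylor k Sm l r Cd) as (T & HT & HTb); [lra| | |].
    { intros i x Hi; apply HS; lia. }
    { intros x Hx; apply (Hb (S k) x); [lia|lra]. }
    exists T, (Cd * (r - l) ^ (k + 1) + Cd * lay).
    set (A := Cd * (r - l) ^ (k + 1) + Cd * lay).
    assert (HA0 : 0 <= A) by (unfold A; nra).
    assert (HWA : W * A <= K1).
    { unfold A, K1.
      replace (W * (Cd * (r - l) ^ (k + 1) + Cd * lay))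
        with (Cd * (W * (r - l) ^ (k + 1) + W * lay)) by ring.
      apply Rmult_le_compat_l; lra. }
    split; [easy|]; split; [easy|]; split; [lra|]; split.
    + apply Rle_trans with (K * K1 * (r - l)).
      * replace (eps * W * A) with (eps * (W * A)) by ring.
        apply Rle_trans with (K * (r - l) * K1); [|right; ring].
        apply Rmult_le_compat; nra.
      * apply Rmult_le_compat_r; lra.
    + intros x Hx; destruct (HTb x Hx) as [HT0 HT1].
      rewrite <- Nat.add_1_r in HT0; split.
      * unfold U; replace (Sm 0%nat x + El 0%nat x - T x)
          with ((Sm 0%nat x - T x) + El 0%nat x) by ring.
        apply Rabs_plus_le; [easy|].
        specialize (Hblay 0%nat x ltac:(lia) Hx); simpl in Hblay; lra.
      * assert (HdU : Derive U x = Sm 1%nat x + El 1%nat x).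
        { apply (derivatives_Derive _ _ 0 x (derivatives_plus _ _ _ HS HE)); lia. }
        rewrite HdU.
        replace (Sm 1%nat x + El 1%nat x - Derive T x)
          with ((Sm 1%nat x - Derive T x) + El 1%nat x) by ring.
        specialize (Hblay 1%nat x ltac:(lia) Hx).
        rewrite pow_1 in Hblay.
        apply Rle_trans with
          (eps * W * (Cd * (r - l) ^ k + Cd * / eps * lay)).
        -- apply Rmult_le_compat_l; [nra|now apply Rabs_plus_le].
        (* One factor [N] of [W] is spent on [eps] and the other [k] on [(r - l) ^ k]; the weight
           [eps] cancels the [/ eps] of the layer derivative. *)
        -- replace (eps * W * (Cd * (r - l) ^ k + Cd * / eps * lay))
             with (N * eps * Cd * (N ^ k * (r - l) ^ k) + Cd * (W * lay))
             by (rewrite HWN; field; lra).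
           assert (N * eps * Cd * (N ^ k * (r - l) ^ k) <= D * Cd * P2).
           { assert (0 <= N * eps) by nra.
             apply Rmult_le_compat; [apply Rmult_le_pos; lra| |
               apply Rmult_le_compat_r; lra|easy].
             apply Rmult_le_pos; [apply pow_le; lra|easy]. }
           assert (Cd * (W * lay) <= Cd * K) by (apply Rmult_le_compat_l; lra).
           lra.
  - assert (HDS := derivatives_plus _ _ _ HS HE).
    assert (HG1 : forall x, l <= x <= r ->
      Rabs (Sm (S k) x + El (S k) x) <= G).
    { intros x Hx; destruct (Hb (S k) x ltac:(lia) ltac:(lra)) as [H1 H2].
      unfold G; rewrite Rmult_plus_distr_l, Rmult_1_r.
      apply Rabs_plus_le; [easy|].
      eapply Rle_trans; [exact H2|].
      rewrite <- (Rmult_1_r (Cd * 2 ^ (k + 1))).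
      assert (Hinv : / eps ^ S k <= 2 ^ (k + 1)).
      { rewrite Nat.add_1_r, <- pow_inv; apply pow_incr; split.
        - left; apply Rinv_0_lt_compat; lra.
        - replace 2 with (/ (1 / 2)) by field; apply Rinv_le_contravar; lra. }
      apply Rmult_le_compat.
      - apply Rmult_le_pos; [lra|]; left; apply Rinv_0_lt_compat, pow_lt; lra.
      - left; apply exp_pos.
      - apply Rmult_le_compat_l; lra.
      - replace 1 with (exp (- alpha * (1 - 1) / eps)) at 2
          by (rewrite <- exp_0; f_equal; field; lra).
        apply layer_mono; lra. }
    assert (HWP : W <= P3).
    { unfold W, P3; apply pow_incr; split; [lra|].
      apply Rle_trans with (N * (2 * eps)); [|lra].
      rewrite <- (Rmult_1_r N) at 1; apply Rmult_le_compat_l; lra. }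
    destruct (taylor k (fun i x => Sm i x + El i x) l r G) as (T & HT & HTb);
      [lra| |exact HG1|].
    { intros i x Hi; apply HDS; lia. }
    exists T, (G * (r - l) ^ (k + 1)).
    split; [easy|]; split; [nra|]; split; [|split].
    + assert (G * (W * (r - l) ^ (k + 1)) <= G * P1)
        by (apply Rmult_le_compat_l; lra).
      lra.
    + apply Rle_trans with (G * P3 * (r - l));
        [|apply Rmult_le_compat_r; lra].
      rewrite Hhk.
      replace (eps * W * (G * ((r - l) * (r - l) ^ k)))
        with (G * (W * (eps * (r - l) ^ k)) * (r - l)) by ring.
      apply Rmult_le_compat_r; [lra|]; apply Rmult_le_compat_l; [lra|].
      rewrite <- (Rmult_1_r P3); apply Rmult_le_compat; nra.
    + intros x Hx; destruct (HTb x Hx) as [HT0 HT1].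
      rewrite <- Nat.add_1_r in HT0; split; [easy|].
      unfold U; rewrite (derivatives_Derive _ _ 0 x HDS) by lia.
      apply Rle_trans with (eps * W * (G * 1)).
      * apply Rmult_le_compat_l; [nra|].
        eapply Rle_trans; [exact HT1|].
        apply Rmult_le_compat_l; lra.
      * assert (eps * W <= 1 * P3) by (apply Rmult_le_compat; lra).
        assert (eps * W * G <= 1 * P3 * G) by (apply Rmult_le_compat_r; lra).
        lra.
Qed.

Lemma fine_derivative_bound n alpha Cd eps Sm El i x r :
  0 < alpha -> 0 < eps -> 0 <= Cd -> 0 <= x <= r -> r <= 1 -> (i <= n)%nat ->
  layer_bounds n alpha eps Cd Sm El ->
  Rabs (Sm i x + El i x)
  <= Cd * (1 + / eps ^ i * exp (- alpha * (1 - r) / eps)).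
Proof.
  intros Ha He HCd Hx Hr Hi (_ & _ & Hb).
  destruct (Hb i x Hi ltac:(lra)) as [H1 H2].
  rewrite Rmult_plus_distr_l, Rmult_1_r; apply Rabs_plus_le; [easy|].
  eapply Rle_trans; [exact H2|].
  rewrite Rmult_assoc; apply Rmult_le_compat_l; [easy|].
  apply Rmult_le_compat_l; [left; apply Rinv_0_lt_compat, pow_lt; lra|].
  apply layer_mono; lra.
Qed.

(** Two polynomials, for two uses. Degree [k] gives order [N^-(k+1)] for the values, but only [N^-k]
    for [eps] times the derivative. Degree [k + 1] recovers the full order for the latter, and its
    own interpolation error is handled by superconvergence. *)
Lemma fine_approx k alpha Cd K :
  (1 <= k)%nat -> 0 < alpha -> 1 <= Cd -> 1 <= K ->
  exists K', 1 <= K' /\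
  forall eps N l r Sm El,
  let W := N ^ (k + 1) in
  let U := fun t => Sm 0%nat t + El 0%nat t in
  0 < eps < 1 -> 1 <= N -> 0 <= l -> l < r -> r <= 1 -> N * (r - l) <= K ->
  (forall n, (n <= k + 1)%nat ->
     (N * (r - l)) ^ n * exp (- alpha * (1 - r) / eps) <= (K * eps) ^ n) ->
  layer_bounds (k + 2) alpha eps Cd Sm El ->
  (exists T A, poly_le k T /\ 0 <= A /\ W * A <= K' /\
    eps * N ^ k * A <= K' * (r - l) /\
    forall x, l <= x <= r ->
    Rabs (U x - T x) <= A /\
    eps * N ^ k * Rabs (Derive U x - Derive T x) <= K') /\
  (exists T A, poly_le (S k) T /\ 0 <= A /\ eps * W * A <= K' * (r - l) /\
    forall x, l <= x <= r ->
    Rabs (U x - T x) <= A /\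
    eps * W * Rabs (Derive U x - Derive T x) <= K').
Proof.
  intros Hk Ha HCd HK.
  exists (2 * Cd * K ^ (k + 1)).
  assert (HP1 : 1 <= K ^ (k + 1)) by (apply pow_R1_Rle; lra).
  split; [nra|].
  intros eps N l r Sm El W U He HN Hl Hlr Hr HNh Hlay HLB.
  set (lay := exp (- alpha * (1 - r) / eps)) in *.
  assert (Hlay0 : 0 < lay) by apply exp_pos.
  assert (HD : derivatives (k + 2) (fun i x => Sm i x + El i x))
    by (destruct HLB as (? & ? & _); now apply derivatives_plus).
  set (h := r - l) in *.
  assert (Hh : 0 < h) by (unfold h; lra).
  (* A derivative of order [m] may contain [/ eps ^ m] times the layer. The grading lets [(N h)^n]
     absorb [n] of these powers and the explicit [eps ^ (m - n)] the others; below, [m] is [n] or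
     [n + 1]. *)
  assert (Hkey : forall n m, (n <= k + 1)%nat -> (m <= S n)%nat -> (n <= m)%nat ->
    eps ^ (m - n) * (N ^ n * h ^ n) * (Cd * (1 + / eps ^ m * lay))
    <= 2 * Cd * K ^ (k + 1)).
  { intros n m Hn Hm Hnm.
    rewrite <- Rpow_mult_distr.
    assert (H1 : (N * h) ^ n <= K ^ (k + 1)).
    { apply Rle_trans with (K ^ n); [apply pow_incr; split; [nra|lra]|].
      now apply Rle_pow. }
    assert (H2 := Hlay n Hn); rewrite (Rpow_mult_distr K) in H2.
    assert (H3 : K ^ n <= K ^ (k + 1)) by now apply Rle_pow.
    assert (He1 : eps ^ (m - n) <= 1).
    { rewrite <- (pow1 (m - n)); apply pow_incr; lra. }
    assert (He0 : 0 < eps ^ (m - n)) by (apply pow_lt; lra).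
    assert (Hen : 0 < eps ^ n) by (apply pow_lt; lra).
    assert (HNhn : 0 < (N * h) ^ n) by (apply pow_lt; nra).
    replace (eps ^ m) with (eps ^ (m - n) * eps ^ n)
      by (rewrite <- pow_add; f_equal; lia).
    replace (eps ^ (m - n) * (N * h) ^ n *
        (Cd * (1 + / (eps ^ (m - n) * eps ^ n) * lay)))
      with (Cd * (eps ^ (m - n) * (N * h) ^ n + (N * h) ^ n * lay / eps ^ n))
      by (field; lra).
    assert ((N * h) ^ n * lay / eps ^ n <= K ^ (k + 1)).
    { apply (proj2 (Rle_div_l _ _ (eps ^ n) Hen)).
      eapply Rle_trans; [exact H2|]; apply Rmult_le_compat_r; lra. }
    assert (eps ^ (m - n) * (N * h) ^ n <= 1 * K ^ (k + 1))
      by (apply Rmult_le_compat; lra).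
    replace (2 * Cd * K ^ (k + 1)) with (Cd * (K ^ (k + 1) + K ^ (k + 1))) by ring.
    apply Rmult_le_compat_l; lra. }
  assert (HT : forall n, (n <= k + 1)%nat ->
    exists T, poly_le n T /\ forall x, l <= x <= r ->
      Rabs (U x - T x) <= Cd * (1 + / eps ^ S n * lay) * h ^ S n /\
      Rabs (Derive U x - Derive T x) <= Cd * (1 + / eps ^ S n * lay) * h ^ n).
  { intros n Hn.
    destruct (taylor n (fun i x => Sm i x + El i x) l r
      (Cd * (1 + / eps ^ S n * lay))) as (T & HT & HTb); [lra| | |].
    - intros i x Hi; apply HD; lia.
    - intros x Hx; apply (fine_derivative_bound (k + 2)); auto; lra || lia.
    - exists T; split; [easy|]; intros x Hx.
      destruct (HTb x Hx) as [H0 H1]; split; [easy|].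
      unfold U; rewrite (derivatives_Derive _ _ 0 x HD) by lia; easy. }
  assert (HG0 : forall n, 0 <= Cd * (1 + / eps ^ n * lay)).
  { intros n; apply Rmult_le_pos; [lra|].
    assert (0 < / eps ^ n) by (apply Rinv_0_lt_compat, pow_lt; lra); nra. }
  split.
  - destruct (HT k ltac:(lia)) as (T & HTk & HTb).
    exists T, (Cd * (1 + / eps ^ S k * lay) * h ^ S k).
    split; [easy|].
    assert (H1 := Hkey (k + 1)%nat (S k) ltac:(lia) ltac:(lia) ltac:(lia)).
    assert (H2 := Hkey k (S k) ltac:(lia) ltac:(lia) ltac:(lia)).
    replace (S k - (k + 1))%nat with 0%nat in H1 by lia.
    replace (S k - k)%nat with 1%nat in H2 by lia.
    specialize (HG0 (S k)); set (G := Cd * (1 + / eps ^ S k * lay)) in *.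
    rewrite pow_O in H1; rewrite pow_1 in H2; fold W in H1.
    rewrite (Nat.add_1_r k) in H1 at 1.
    split; [apply Rmult_le_pos; [easy|apply pow_le; lra]|].
    split; [lra|]; split.
    + replace (eps * N ^ k * (G * h ^ S k))
        with (eps * (N ^ k * h ^ k) * G * h) by (simpl; ring).
      apply Rmult_le_compat_r; lra.
    + intros x Hx; destruct (HTb x Hx) as [Hx0 Hx1]; split; [easy|].
      eapply Rle_trans; [apply Rmult_le_compat_l; [|exact Hx1]|lra].
      apply Rmult_le_pos; [lra|apply pow_le; lra].
  - destruct (HT (k + 1)%nat ltac:(lia)) as (T & HTk & HTb).
    exists T, (Cd * (1 + / eps ^ S (k + 1) * lay) * h ^ S (k + 1)).
    rewrite Nat.add_1_r in HTk.
    split; [easy|].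
    assert (H2 := Hkey (k + 1)%nat (S (k + 1)) ltac:(lia) ltac:(lia) ltac:(lia)).
    replace (S (k + 1) - (k + 1))%nat with 1%nat in H2 by lia.
    specialize (HG0 (S (k + 1))).
    set (G := Cd * (1 + / eps ^ S (k + 1) * lay)) in *.
    rewrite pow_1 in H2; fold W in H2.
    split; [apply Rmult_le_pos; [easy|apply pow_le; lra]|].
    split.
    + replace (eps * W * (G * h ^ S (k + 1)))
        with (eps * (W * h ^ (k + 1)) * G * h)
        by (change (h ^ S (k + 1)) with (h * h ^ (k + 1)); ring).
      apply Rmult_le_compat_r; lra.
    + intros x Hx; destruct (HTb x Hx) as [Hx0 Hx1]; split; [easy|].
      eapply Rle_trans; [apply Rmult_le_compat_l; [|exact Hx1]|lra].
      apply Rmult_le_pos; [lra|apply pow_le; lra].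
Qed.

(** * Element and node estimates *)

(* [N] is the number of elements, and [K] a constant independent of [eps] and
   [N].  The second bound on [A] replaces a lower bound on [h / eps]. *)
Definition coarse_ok (k : nat) (K eps N l r : R) (U : R -> R) : Prop :=
  let W := N ^ (k + 1) in
  exists T A, poly_le k T /\ 0 <= A /\ W * A <= K /\
    eps * W * A <= K * (r - l) /\
    forall x, l <= x <= r ->
    Rabs (U x - T x) <= A /\ eps * W * Rabs (Derive U x - Derive T x) <= K.

Definition fine_ok (k : nat) (K eps N l r : R) (U : R -> R) : Prop :=
  let W := N ^ (k + 1) in
  (exists T A, poly_le k T /\ 0 <= A /\ W * A <= K /\
    eps * N ^ k * A <= K * (r - l) /\
    forall x, l <= x <= r ->
    Rabs (U x - T x) <= A /\
    eps * N ^ k * Rabs (Derive U x - Derive T x) <= K) /\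
  (exists T A, poly_le (S k) T /\ 0 <= A /\ eps * W * A <= K * (r - l) /\
    forall x, l <= x <= r ->
    Rabs (U x - T x) <= A /\
    eps * W * Rabs (Derive U x - Derive T x) <= K).

(** An inverse estimate controls [p] only by [A / h]; the hypothesis [c * A <= K * h] pays for this
    [1 / h]. *)
Lemma scaled_derivative_bound c h C K A p q :
  0 <= c -> 0 < h -> 1 <= C -> 0 <= A -> c * A <= K * h ->
  h * Rabs p <= C * A -> c * Rabs q <= K -> c * Rabs (p + q) <= (C + 1) * K.
Proof.
  intros Hc Hh HC HA HcA Hp Hq.
  assert (H : c * Rabs p <= C * K).
  { apply Rmult_le_reg_r with h; [easy|].
    apply (Rmult_le_compat_l c) in Hp; [|easy].
    apply (Rmult_le_compat_l C) in HcA; [|lra].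
    lra. }
  pose proof (Rmult_le_compat_l c _ _ Hc (Rabs_triang p q)); lra.
Qed.

(** [T] and [A] are chosen before [P], so that the Radau and the Lobatto interpolant of the same
    function can be compared through the same [T]. *)
Lemma coarse_interp k s :
  (1 <= k)%nat -> lobatto_nodes k s ->
  exists C, 1 <= C /\
  forall K eps N l r U, 1 <= K -> 0 < eps -> 1 <= N -> l < r -> cdiff U ->
  coarse_ok k K eps N l r U ->
  exists T A, 0 <= A /\ N ^ (k + 1) * A <= C * K /\
    eps * N ^ (k + 1) * A <= C * K * (r - l) /\ cdiff T /\
    forall P, is_radau_interp k l r U P \/ is_lobatto_interp k s l r U P ->
    forall x, l <= x <= r ->
    Rabs (P x - U x) <= A /\ (r - l) * Rabs (Derive P x - Derive T x) <= A /\
    eps * N ^ (k + 1) * Rabs (Derive P x - Derive U x) <= C * K.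
Proof.
  intros Hk Hs; destruct (interp_error k s Hk Hs) as (C & HC & HI).
  exists (C + 1); split; [lra|].
  intros K eps N l r U HK He HN Hlr HU (T & A & HT & HA & HWA & HeA & Hb).
  set (W := N ^ (k + 1)) in *.
  assert (HW : 1 <= W) by (apply pow_R1_Rle; lra).
  exists T, (C * A); split; [nra|]; split; [|split; [|split]].
  - apply (Rmult_le_compat_l C) in HWA; lra.
  - apply (Rmult_le_compat_l C) in HeA; [|lra].
    assert (0 <= K * (r - l)) by (apply Rmult_le_pos; lra); lra.
  - now apply (poly_le_cdiff k).
  - intros P HP x Hx.
    destruct (HI l r U T P A) with (x := x) as [H1 H2]; auto.
    { intros y Hy; now apply Hb. }
    split; [easy|]; split; [easy|].
    replace (Derive P x - Derive U x)
      with ((Derive P x - Derive T x) + - (Derive U x - Derive T x)) by ring.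
    apply (scaled_derivative_bound _ (r - l) C K A); try easy.
    + apply Rmult_le_pos; lra.
    + lra.
    + rewrite Rabs_Ropp; now apply Hb.
Qed.

(** The derivative of the error splits into [rho] and the derivative of the Lobatto error of a
    polynomial of degree [k + 1], which is orthogonal to degree [k - 1]. Against such test functions
    only [rho] remains, and its bound has one more power of [N] than the pointwise one. *)
Lemma fine_interp k s :
  (1 <= k)%nat -> lobatto_nodes k s ->
  exists C, 1 <= C /\
  forall K eps N l r U P, 1 <= K -> 0 < eps -> 1 <= N -> l < r -> cdiff U ->
  fine_ok k K eps N l r U -> is_lobatto_interp k s l r U P ->
  (forall x, l <= x <= r ->
    N ^ (k + 1) * Rabs (P x - U x) <= C * K /\
    eps * N ^ k * Rabs (Derive P x - Derive U x) <= C * K) /\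
  exists rho, cont rho /\
    (forall x, l <= x <= r -> eps * N ^ (k + 1) * Rabs (rho x) <= C * K) /\
    forall z, poly_le (k - 1) z ->
    RInt (fun t => (Derive P t - Derive U t) * z t) l r
    = RInt (fun t => rho t * z t) l r.
Proof.
  intros Hk Hs; destruct (interp_error k s Hk Hs) as (C & HC & HI).
  exists (C + 1); split; [lra|].
  intros K eps N l r U P HK He HN Hlr HU
    [(T & A & HT & HA & HWA & HeA & Hb) (T1 & A1 & HT1 & HA1 & HeA1 & Hb1)] HP.
  set (W := N ^ (k + 1)) in *.
  assert (HW : 1 <= W) by (apply pow_R1_Rle; lra).
  assert (HNk : 1 <= N ^ k) by (apply pow_R1_Rle; lra).
  split.
  - intros x Hx.
    destruct (HI l r U T P A) with (x := x) as [H1 H2]; auto.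
    { intros y Hy; now apply Hb. }
    split.
    + apply Rle_trans with (W * (C * A)); [apply Rmult_le_compat_l; lra|].
      apply (Rmult_le_compat_l C) in HWA; lra.
    + replace (Derive P x - Derive U x)
        with ((Derive P x - Derive T x) + - (Derive U x - Derive T x)) by ring.
      apply (scaled_derivative_bound _ (r - l) C K A); try easy.
      * apply Rmult_le_pos; lra.
      * lra.
      * rewrite Rabs_Ropp; now apply Hb.
  - destruct (lobatto_superconvergence k s l r T1 Hk Hs Hlr HT1)
      as (T' & HT' & Horth).
    assert (HPc : cdiff P) by (destruct HP as [HP _]; exact (poly_le_cdiff k P HP)).
    assert (HTc : cdiff T') by (destruct HT' as [H _]; exact (poly_le_cdiff k T' H)).
    assert (HT1c := poly_le_cdiff _ _ HT1).
    exists (fun t => (Derive P t - Derive T' t) + - (Derive U t - Derive T1 t)).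
    pose proof (cdiff_cont_Derive P HPc); pose proof (cdiff_cont_Derive U HU).
    pose proof (cdiff_cont_Derive _ HTc); pose proof (cdiff_cont_Derive _ HT1c).
    split; [solve_cont|]; split.
    + intros x Hx.
      apply (scaled_derivative_bound _ (r - l) C K A1); try easy.
      * apply Rmult_le_pos; lra.
      * lra.
      (* [P - T'] is the Lobatto interpolant of [U - T1], whose approximating polynomial may be
         taken as 0. *)
      * destruct (HI l r (fun t => U t - T1 t) (fun _ => 0)
          (fun t => P t - T' t) A1) with (x := x) as [_ H3]; auto.
        -- now apply cdiff_minus.
        -- apply poly_le_const.
        -- intros y Hy; rewrite Rminus_0_r; now apply Hb1.
        -- right; destruct HP as [HP HPn], HT' as [HT' HTn]; split.
           ++ now apply poly_le_minus.
           ++ intros i Hi; specialize (HPn i Hi); specialize (HTn i Hi).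
              simpl in *; lra.
        -- rewrite Derive_const, Rminus_0_r, Derive_minus_cdiff in H3 by easy.
           exact H3.
      * rewrite Rabs_Ropp; now apply Hb1.
    + intros z Hz; assert (Hzc : cont z) by exact (poly_le_continuous _ z Hz).
      rewrite (RInt_ext (fun t => (Derive P t - Derive U t) * z t) (fun t =>
        ((Derive P t - Derive T' t) + - (Derive U t - Derive T1 t)) * z t
        + (Derive T' t - Derive T1 t) * z t)) by (intros; ringR).
      rewrite RInt_cont_plus, Horth by (easy || solve_cont).
      ringR.
Qed.

(** * Contributions of single elements to the form *)

Lemma Rabs_mult_le a b A B : Rabs a <= A -> Rabs b <= B -> Rabs (a * b) <= A * B.
Proof.
  intros; rewrite Rabs_mult; apply Rmult_le_compat; auto using Rabs_pos.
Qed.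

(* On a Radau element [int w v'' = 0] and [w(r) = 0], and [b] may be replaced
   by [b - b(l)] in the convective term. *)
Lemma coarse_element_form k l r eps B A a e b c U P v :
  (1 <= k)%nat -> l < r -> 0 <= eps ->
  cdiff b -> cont c -> cdiff U -> poly_le k v -> is_radau_interp k l r U P ->
  (forall t, l <= t <= r -> Rabs (P t - U t) <= A) ->
  (forall t, l <= t <= r -> Rabs (Derive b t) <= B) ->
  (forall t, l <= t <= r -> Rabs (c t - Derive b t) <= B) ->
  (forall t, l <= t <= r -> Rabs (v t) <= a /\ (r - l) * Rabs (Derive v t) <= a /\
     Rabs (Derive v t) <= e) ->
  let w := fun t => P t - U t in
  Rabs (eps * RInt (fun t => Derive w t * Derive v t) l r
        + RInt (fun t => (c t - Derive b t) * w t * v t) l r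
        - RInt (fun t => b t * w t * Derive v t) l r)
  <= eps * A * e + (r - l) * (2 * B * A * a).
Proof.
  intros Hk Hlr He Hb Hc HU Hv (HP & Horth & Hr) HA HBd HBc Hva w.
  assert (HPc : cdiff P) by exact (poly_le_cdiff k P HP).
  assert (Hvc : cdiff v) by exact (poly_le_cdiff k v Hv).
  assert (Hw : cdiff w) by now apply cdiff_minus.
  assert (Hv1 : poly_le (k - 1) (Derive v)).
  { replace (k - 1)%nat with (pred k) by lia; now apply poly_le_Derive. }
  assert (Hv2 : poly_le (k - 1) (Derive (Derive v))).
  { apply poly_le_weaken with (pred (k - 1)); [lia|now apply poly_le_Derive]. }
  assert (Hvc1 : cdiff (Derive v)) by exact (poly_le_cdiff _ _ Hv1).
  pose proof (cdiff_cont b Hb); pose proof (cdiff_cont_Derive b Hb).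
  pose proof (cdiff_cont w Hw); pose proof (cdiff_cont v Hvc).
  pose proof (cdiff_cont_Derive v Hvc); pose proof (cdiff_cont_Derive _ Hvc1).
  pose proof (cdiff_cont U HU); pose proof (cdiff_cont P HPc).
  assert (Hwz : forall z, poly_le (k - 1) z -> RInt (fun t => w t * z t) l r = 0).
  { intros z Hz; assert (cont z) by exact (poly_le_continuous _ z Hz).
    unfold w; rewrite (RInt_ext _ (fun t => P t * z t - U t * z t))
      by (intros; ringR).
    rewrite RInt_cont_minus, (Horth z Hz) by solve_cont; ringR. }
  rewrite (RInt_by_parts w (Derive v) l r Hw Hvc1), (Hwz _ Hv2).
  replace (w r) with 0 by (unfold w; rewrite Hr; ring).
  assert (E1 : Rabs (eps * (0 * Derive v r - w l * Derive v l - 0)) <= eps * A * e).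
  { replace (eps * (0 * Derive v r - w l * Derive v l - 0))
      with (- (eps * (w l * Derive v l))) by ring.
    rewrite Rabs_Ropp, Rabs_mult, (Rabs_right eps) by lra.
    rewrite Rmult_assoc; apply Rmult_le_compat_l; [easy|].
    apply Rabs_mult_le; [apply HA|apply Hva]; lra. }
  assert (E2 : Rabs (RInt (fun t => (c t - Derive b t) * w t * v t) l r)
    <= (r - l) * (B * A * a)).
  { apply RInt_abs_le; [lra|solve_cont|].
    intros t Ht; repeat apply Rabs_mult_le; [apply HBc|apply HA|apply Hva]; lra. }
  assert (E3 : Rabs (RInt (fun t => b t * w t * Derive v t) l r)
    <= (r - l) * (B * A * a)).
  { rewrite (RInt_ext _ (fun t => (b t - b l) * w t * Derive v t
      + b l * (w t * Derive v t))) by (intros; ringR).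
    rewrite RInt_cont_plus, RInt_cont_scal, (Hwz _ Hv1), Rmult_0_r, Rplus_0_r
      by solve_cont.
    apply RInt_abs_le; [lra|solve_cont|].
    intros t Ht.
    assert (HB0 : 0 <= B) by (eapply Rle_trans; [apply Rabs_pos|apply (HBd t Ht)]).
    assert (HA0 : 0 <= A) by (eapply Rle_trans; [apply Rabs_pos|apply (HA t Ht)]).
    apply Rle_trans with (B * (r - l) * A * Rabs (Derive v t)).
    - repeat apply Rabs_mult_le; [|now apply HA|apply Rle_refl].
      apply Rle_trans with (B * (t - l)); [|apply Rmult_le_compat_l; lra].
      apply (mean_value_bound b (Derive b)); [lra|now apply cdiff_is_derive|].
      intros y Hy; apply HBd; lra.
    - replace (B * (r - l) * A * Rabs (Derive v t))
        with (B * A * ((r - l) * Rabs (Derive v t))) by ring.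
      apply Rmult_le_compat_l; [nra|apply Hva; lra]. }
  eapply Rle_trans; [apply Rabs_minus_le; [apply Rabs_plus_le|]; eassumption|].
  lra.
Qed.

(** Here the convection term is bounded directly through the derivative of [v]; its cost is
    acceptable later because the widths of fine elements are of order [eps]. *)
Lemma fine_element_form k l r eps B A R0 a e b c U P v rho :
  (1 <= k)%nat -> l < r -> 0 <= eps ->
  cdiff b -> cont c -> cdiff U -> poly_le k v -> poly_le k P -> cont rho ->
  (forall t, l <= t <= r -> Rabs (P t - U t) <= A) ->
  (forall t, l <= t <= r -> Rabs (rho t) <= R0) ->
  (forall t, l <= t <= r -> Rabs (b t) <= B) ->
  (forall t, l <= t <= r -> Rabs (c t - Derive b t) <= B) ->
  (forall t, l <= t <= r -> Rabs (v t) <= a /\ Rabs (Derive v t) <= e) ->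
  (forall z, poly_le (k - 1) z ->
    RInt (fun t => (Derive P t - Derive U t) * z t) l r
    = RInt (fun t => rho t * z t) l r) ->
  let w := fun t => P t - U t in
  Rabs (eps * RInt (fun t => Derive w t * Derive v t) l r
        + RInt (fun t => (c t - Derive b t) * w t * v t) l r
        - RInt (fun t => b t * w t * Derive v t) l r)
  <= (r - l) * ((eps * R0 + B * A) * e) + (r - l) * (B * A * a).
Proof.
  intros Hk Hlr He Hb Hc HU Hv HP Hrho HA HR HBb HBc Hva Hint w.
  assert (HPc : cdiff P) by exact (poly_le_cdiff k P HP).
  assert (Hvc : cdiff v) by exact (poly_le_cdiff k v Hv).
  assert (Hw : cdiff w) by now apply cdiff_minus.
  assert (Hv1 : poly_le (k - 1) (Derive v)).
  { replace (k - 1)%nat with (pred k) by lia; now apply poly_le_Derive. }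
  pose proof (cdiff_cont b Hb); pose proof (cdiff_cont_Derive b Hb).
  pose proof (cdiff_cont w Hw); pose proof (cdiff_cont v Hvc).
  pose proof (cdiff_cont_Derive v Hvc).
  rewrite (RInt_ext (fun t => Derive w t * Derive v t)
    (fun t => (Derive P t - Derive U t) * Derive v t))
    by (intros; unfold w; rewrite Derive_minus_cdiff by easy; reflexivity).
  rewrite (Hint _ Hv1).
  assert (E1 : Rabs (eps * RInt (fun t => rho t * Derive v t) l r)
    <= eps * ((r - l) * (R0 * e))).
  { rewrite Rabs_mult, (Rabs_right eps) by lra.
    apply Rmult_le_compat_l; [easy|].
    apply RInt_abs_le; [lra|solve_cont|].
    intros t Ht; apply Rabs_mult_le; [now apply HR|now apply Hva]. }
  assert (E2 : Rabs (RInt (fun t => (c t - Derive b t) * w t * v t) l r)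
    <= (r - l) * (B * A * a)).
  { apply RInt_abs_le; [lra|solve_cont|].
    intros t Ht; repeat apply Rabs_mult_le; [apply HBc|apply HA|apply Hva]; lra. }
  assert (E3 : Rabs (RInt (fun t => b t * w t * Derive v t) l r)
    <= (r - l) * (B * A * e)).
  { apply RInt_abs_le; [lra|solve_cont|].
    intros t Ht; repeat apply Rabs_mult_le; [apply HBb|apply HA|apply Hva]; lra. }
  eapply Rle_trans; [apply Rabs_minus_le; [apply Rabs_plus_le|]; eassumption|].
  lra.
Qed.

Lemma young d x y : 0 < d -> x * y <= d * y ^ 2 + x ^ 2 / (4 * d).
Proof.
  intros Hd.
  assert (H : 0 <= (2 * d * y - x) ^ 2 / (4 * d)).
  { apply Rdiv_le_0_compat; [apply pow2_ge_0|lra]. }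
  replace ((2 * d * y - x) ^ 2 / (4 * d))
    with (d * y ^ 2 + x ^ 2 / (4 * d) - x * y) in H by (field; lra).
  lra.
Qed.

(** [y] is a sup bound of a test function, related to its squared norm [I] by an inverse estimate
    with factor [h]; [x] is an error bound. Young's inequality with weight [d * h / Ci] turns
    [y ^ 2] into [I], and the factor [h] in the hypothesis on [x] cancels the inverse weight. *)
Lemma young_local d c Ci K W h x y I :
  0 < d -> 0 < c -> 1 <= Ci -> 0 < W -> 0 < h ->
  h * y ^ 2 <= Ci * I -> c * W ^ 2 * x ^ 2 <= K * h ->
  c * x * y <= d * (c * I) + Ci / (4 * d) * K / W ^ 2.
Proof.
  intros Hd Hc HCi HW Hh Hy Hx.
  assert (Hd' : 0 < d * h / Ci) by (apply Rdiv_lt_0_compat; nra).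
  assert (HY := young (d * h / Ci) x y Hd').
  apply (Rmult_le_compat_l c) in HY; [|lra].
  assert (HW2 : 0 < W ^ 2) by (apply pow_lt; easy).
  assert (H1 : d * h / Ci * y ^ 2 <= d * I).
  { replace (d * h / Ci * y ^ 2) with (d * (h * y ^ 2 / Ci)) by (field; lra).
    apply Rmult_le_compat_l; [lra|].
    apply (proj2 (Rle_div_l _ _ Ci ltac:(lra))); lra. }
  assert (H2 : c * (x ^ 2 / (4 * (d * h / Ci))) <= Ci / (4 * d) * K / W ^ 2).
  { replace (c * (x ^ 2 / (4 * (d * h / Ci))))
      with (Ci / (4 * d) * (c * W ^ 2 * x ^ 2 / h) / W ^ 2) by (field; lra).
    apply Rmult_le_compat_r; [left; now apply Rinv_0_lt_compat|].
    apply Rmult_le_compat_l; [apply Rdiv_le_0_compat; lra|].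
    now apply (proj2 (Rle_div_l _ _ h Hh)). }
  apply (Rmult_le_compat_l c) in H1; [|lra].
  lra.
Qed.

Definition coefficients_ok (B : R) (b c : R -> R) : Prop :=
  cdiff b /\ cont c /\ forall t, 0 <= t <= 1 ->
  0 <= b t <= B /\ Rabs (Derive b t) <= B /\ Rabs (c t - Derive b t) <= B.

Lemma coarse_element_bound k s gamma B K :
  (1 <= k)%nat -> lobatto_nodes k s -> 0 < gamma -> 1 <= B -> 1 <= K ->
  exists K', 0 <= K' /\
  forall eps N l r b c U P v,
  0 < eps -> 1 <= N -> 0 <= l -> l < r -> r <= 1 ->
  coefficients_ok B b c -> cdiff U -> coarse_ok k K eps N l r U ->
  poly_le k v -> is_radau_interp k l r U P ->
  let w := fun t => P t - U t in
  Rabs (eps * RInt (fun t => Derive w t * Derive v t) l r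
        + RInt (fun t => (c t - Derive b t) * w t * v t) l r
        - RInt (fun t => b t * w t * Derive v t) l r)
  <= / 8 * (eps * RInt (fun t => Derive v t ^ 2) l r
            + gamma * RInt (fun t => v t ^ 2) l r)
     + K' / (N ^ (k + 1)) ^ 2.
Proof.
  intros Hk Hs Hg HB HK.
  destruct (coarse_interp k s Hk Hs) as (C & HC & HI).
  destruct (poly_inverse k) as (Ci & HCi & HIn).
  set (D := C * K); assert (HD : 1 <= D) by (apply one_le_mult; easy).
  exists (2 * Ci * (D * D) + 2 * Ci / gamma * (4 * B ^ 2 * (D * D))).
  assert (H8 : 0 <= 2 * Ci / gamma * (4 * B ^ 2 * (D * D))).
  { apply Rmult_le_pos; [apply Rdiv_le_0_compat; lra|].
    apply Rmult_le_pos; nra. }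
  split; [nra|].
  intros eps N l r b c U P v He HN Hl Hlr Hr (Hb & Hc & Hbc) HU Hok Hv HP w.
  destruct (HI K eps N l r U) as (T & A & HA & HWA & HeA & _ & HPb); auto.
  fold D in HWA, HeA, HPb.
  set (W := N ^ (k + 1)) in *.
  assert (HW : 1 <= W) by (apply pow_R1_Rle; lra).
  destruct (HIn l r v Hlr Hv) as (a & e & Ha & He0 & Hai & Hei & Hva).
  set (I0 := RInt (fun t => v t ^ 2) l r) in *.
  set (I1 := RInt (fun t => Derive v t ^ 2) l r) in *.
  eapply Rle_trans.
  { apply (coarse_element_form k l r eps B A a e b c U P v); auto.
    - lra.
    - intros t Ht; apply (HPb P); auto.
    - intros t Ht; apply Hbc; lra.
    - intros t Ht; apply Hbc; lra. }
  (* The product of the two bounds on [A]: one supplies a constant, the other the factor [r - l]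
     that [young_local] requires. *)
  assert (HeAA : eps * W ^ 2 * A ^ 2 <= D * D * (r - l)).
  { replace (eps * W ^ 2 * A ^ 2) with ((W * A) * (eps * W * A)) by ring.
    rewrite (Rmult_assoc D D); apply Rmult_le_compat; try easy.
    - nra.
    - apply Rmult_le_pos; nra. }
  assert (HAA : W ^ 2 * A ^ 2 <= D * D).
  { replace (W ^ 2 * A ^ 2) with ((W * A) * (W * A)) by ring.
    apply Rmult_le_compat; nra. }
  assert (H1 := young_local (/ 8) eps Ci (D * D) W (r - l) A e I1
    ltac:(lra) He HCi ltac:(lra) ltac:(lra) Hei HeAA).
  assert (Hh2 : (r - l) ^ 2 <= r - l) by nra.
  assert (HbA : 1 * W ^ 2 * (2 * B * (r - l) * A) ^ 2
    <= 4 * B ^ 2 * (D * D) * (r - l)).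
  { replace (1 * W ^ 2 * (2 * B * (r - l) * A) ^ 2)
      with (4 * B ^ 2 * (W ^ 2 * A ^ 2) * (r - l) ^ 2) by ring.
    assert (0 <= W ^ 2 * A ^ 2) by (apply Rmult_le_pos; apply pow2_ge_0).
    apply Rmult_le_compat; [nra|apply pow2_ge_0| |easy].
    apply Rmult_le_compat_l; [nra|easy]. }
  assert (H2 := young_local (gamma / 8) 1 Ci (4 * B ^ 2 * (D * D)) W (r - l)
    (2 * B * (r - l) * A) a I0 ltac:(lra) ltac:(lra) HCi ltac:(lra) ltac:(lra)
    Hai HbA).
  replace (Ci / (4 * / 8)) with (2 * Ci) in H1 by field.
  replace (Ci / (4 * (gamma / 8))) with (2 * Ci / gamma) in H2 by (field; lra).
  unfold Rdiv in *; lra.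
Qed.

Lemma fine_element_bound k s gamma B K :
  (1 <= k)%nat -> lobatto_nodes k s -> 0 < gamma -> 1 <= B -> 1 <= K ->
  exists K', 0 <= K' /\
  forall eps N l r b c U P v,
  0 < eps -> 1 <= N -> 0 <= l -> l < r -> r <= 1 -> r - l <= K * eps ->
  coefficients_ok B b c -> cdiff U -> fine_ok k K eps N l r U ->
  poly_le k v -> is_lobatto_interp k s l r U P ->
  let w := fun t => P t - U t in
  Rabs (eps * RInt (fun t => Derive w t * Derive v t) l r
        + RInt (fun t => (c t - Derive b t) * w t * v t) l r
        - RInt (fun t => b t * w t * Derive v t) l r)
  <= / 8 * (eps * RInt (fun t => Derive v t ^ 2) l r
            + gamma * RInt (fun t => v t ^ 2) l r)
     + K' / (N ^ (k + 1)) ^ 2.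
Proof.
  intros Hk Hs Hg HB HK.
  destruct (fine_interp k s Hk Hs) as (C & HC & HI).
  destruct (poly_inverse k) as (Ci & HCi & HIn).
  set (D := C * K); assert (HD : 1 <= D) by (apply one_le_mult; easy).
  set (Y := (1 + B) * D).
  exists (2 * Ci * (K * Y ^ 2) + 2 * Ci / gamma * Y ^ 2).
  assert (H8 : 0 <= 2 * Ci / gamma * Y ^ 2).
  { apply Rmult_le_pos; [apply Rdiv_le_0_compat; lra|apply pow2_ge_0]. }
  assert (H9 : 0 <= 2 * Ci * (K * Y ^ 2)).
  { apply Rmult_le_pos; [lra|apply Rmult_le_pos; [lra|apply pow2_ge_0]]. }
  split; [lra|].
  intros eps N l r b c U P v He HN Hl Hlr Hr HhK (Hb & Hc & Hbc) HU Hok Hv HP w.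
  destruct (HI K eps N l r U P) as (HPb & rho & Hrho & HR & Hint); auto.
  fold D in HPb, HR.
  set (W := N ^ (k + 1)) in *.
  assert (HW : 1 <= W) by (apply pow_R1_Rle; lra).
  destruct (HIn l r v Hlr Hv) as (a & e & Ha & He0 & Hai & Hei & Hva).
  set (I0 := RInt (fun t => v t ^ 2) l r) in *.
  set (I1 := RInt (fun t => Derive v t ^ 2) l r) in *.
  eapply Rle_trans.
  { apply (fine_element_form k l r eps B (D / W) (D / (eps * W)) a e b c U P v rho);
      auto.
    - lra.
    - apply HP.
    - intros t Ht; apply (proj1 (Rle_div_r _ _ W ltac:(lra))).
      rewrite Rmult_comm; now apply HPb.
    - intros t Ht; apply (proj1 (Rle_div_r _ _ (eps * W) ltac:(nra))).
      rewrite Rmult_comm; now apply HR.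
    - intros t Ht; rewrite Rabs_right; [apply Hbc; lra|].
      apply Rle_ge, Hbc; lra.
    - intros t Ht; apply Hbc; lra.
    - intros t Ht; split; apply Hva; lra. }
  assert (HW2 : 0 < W ^ 2) by (apply pow_lt; lra).
  (* The diffusion defect [eps * rho] and the convection error are both of order [1 / W] against the
     derivative of [v]. Writing their sum as [eps] times a quotient by [eps] leaves a surplus
     [(r - l) / eps], which is at most [K]. *)
  assert (Hx1 : eps * W ^ 2 * ((r - l) * (Y / W) / eps) ^ 2
    <= K * Y ^ 2 * (r - l)).
  { replace (eps * W ^ 2 * ((r - l) * (Y / W) / eps) ^ 2)
      with (Y ^ 2 * (r - l) * ((r - l) / eps)) by (field; lra).
    replace (K * Y ^ 2 * (r - l)) with (Y ^ 2 * (r - l) * K) by ring.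
    apply Rmult_le_compat_l.
    - apply Rmult_le_pos; [apply pow2_ge_0|lra].
    - apply (proj2 (Rle_div_l _ _ eps He)); lra. }
  assert (H1 := young_local (/ 8) eps Ci (K * Y ^ 2) W (r - l)
    ((r - l) * (Y / W) / eps) e I1
    ltac:(lra) He HCi ltac:(lra) ltac:(lra) Hei Hx1).
  assert (Hx2 : 1 * W ^ 2 * ((r - l) * (B * D / W)) ^ 2 <= Y ^ 2 * (r - l)).
  { replace (1 * W ^ 2 * ((r - l) * (B * D / W)) ^ 2)
      with ((B * D) ^ 2 * (r - l) ^ 2) by (field; lra).
    apply Rmult_le_compat; [apply pow2_ge_0|apply pow2_ge_0| |nra].
    apply pow_incr; unfold Y; nra. }
  assert (H2 := young_local (gamma / 8) 1 Ci (Y ^ 2) W (r - l)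
    ((r - l) * (B * D / W)) a I0 ltac:(lra) ltac:(lra) HCi ltac:(lra) ltac:(lra)
    Hai Hx2).
  replace (Ci / (4 * / 8)) with (2 * Ci) in H1 by field.
  replace (Ci / (4 * (gamma / 8))) with (2 * Ci / gamma) in H2 by (field; lra).
  replace (eps * ((r - l) * (Y / W) / eps) * e)
    with ((r - l) * ((eps * (D / (eps * W)) + B * (D / W)) * e)) in H1
    by (unfold Y; field; lra).
  replace (1 * ((r - l) * (B * D / W)) * a)
    with ((r - l) * (B * (D / W) * a)) in H2 by (field; lra).
  unfold Rdiv in *; lra.
Qed.

(** For nodes with penalty 1, kept as a literal factor. [g] and [j] are the jumps of the error and
    of the test function, [p] is [eps] times the average error derivative, and [q] is the average
    test derivative, whose two sides are charged to the adjacent elements through [X1] and [X2]. *)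
Lemma node_term_bound K W A p g q j eps e1 e2 X1 X2 :
  0 < W -> 0 <= eps -> 0 <= e1 -> 0 <= e2 ->
  W * Rabs p <= K -> Rabs g <= A -> W * A <= K -> Rabs q <= e1 + e2 ->
  eps * A * e1 <= X1 -> eps * A * e2 <= X2 ->
  Rabs (- (p * j) + g * (eps * q + 1 * j))
  <= / 8 * (1 * j ^ 2) + X1 + X2 + 8 * K ^ 2 / W ^ 2.
Proof.
  intros HW He He1 He2 Hp Hg HA Hq H1 H2.
  assert (Hp' : Rabs p <= K / W).
  { apply (proj1 (Rle_div_r _ _ W HW)); lra. }
  assert (HA' : A <= K / W).
  { apply (proj1 (Rle_div_r _ _ W HW)); lra. }
  assert (HY := young (/ 8) (2 * (K / W)) (Rabs j) ltac:(lra)).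
  rewrite pow2_abs in HY.
  replace ((2 * (K / W)) ^ 2 / (4 * / 8)) with (8 * K ^ 2 / W ^ 2) in HY
    by (field; lra).
  assert (E1 : Rabs (- (p * j)) <= K / W * Rabs j).
  { rewrite Rabs_Ropp; apply Rabs_mult_le; [easy|apply Rle_refl]. }
  assert (E2 : Rabs (g * (eps * q + 1 * j)) <= A * (eps * (e1 + e2) + Rabs j)).
  { apply Rabs_mult_le; [easy|]; apply Rabs_plus_le.
    - rewrite Rabs_mult, (Rabs_right eps) by lra.
      now apply Rmult_le_compat_l.
    - rewrite Rmult_1_l; apply Rle_refl. }
  eapply Rle_trans; [apply Rabs_plus_le; eassumption|].
  pose proof (Rmult_le_compat_r (Rabs j) _ _ (Rabs_pos j) HA').
  lra.
Qed.

(** * Errors on the whole mesh and contributions of the nodes *)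

Lemma penalty_coarse M j : (j <= M)%nat -> penalty (2 * M) j = 1.
Proof.
  intros H; unfold penalty.
  replace (2 * M / 2)%nat with M
    by (rewrite Nat.mul_comm; symmetry; apply Nat.div_mul; lia).
  now apply Nat.leb_le in H as ->.
Qed.

Lemma penalty_fine M j : (M < j)%nat -> penalty (2 * M) j = INR (2 * M) ^ 2.
Proof.
  intros H; unfold penalty.
  replace (2 * M / 2)%nat with M
    by (rewrite Nat.mul_comm; symmetry; apply Nat.div_mul; lia).
  now apply Nat.leb_gt in H as ->.
Qed.

Lemma lobatto_interp_ends k s l r U P :
  lobatto_nodes k s -> is_lobatto_interp k s l r U P -> P l = U l /\ P r = U r.
Proof.
  intros (H0 & H1 & _) [_ HP].
  assert (E0 := HP 0%nat (Nat.le_0_l k)); assert (E1 := HP k (le_n k)).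
  simpl in E0, E1; rewrite H0 in E0; rewrite H1 in E1.
  replace ((l + r) / 2 + (r - l) / 2 * -1) with l in E0 by field.
  replace ((l + r) / 2 + (r - l) / 2 * 1) with r in E1 by field.
  easy.
Qed.

(** All that the error analysis knows of the mesh. The bound of [eps] by the width stops at [j = M]:
    on the transition element it is not uniform as [eps] approaches 1. *)
Definition mesh_ok (K eps : R) (M : nat) (x : nat -> R) : Prop :=
  0 < eps < 1 /\ (2 <= M)%nat /\ x 0%nat = 0 /\ x (2 * M)%nat = 1 /\
  (forall j, (1 <= j <= 2 * M)%nat ->
     0 <= x (j - 1)%nat /\ x (j - 1)%nat < x j /\ x j <= 1) /\
  (forall j, (1 <= j <= M)%nat -> eps <= K * (x j - x (j - 1)%nat)) /\
  (forall j, (M + 2 <= j <= 2 * M)%nat -> x j - x (j - 1)%nat <= K * eps).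

Definition approx_ok (k : nat) (K eps : R) (M : nat) (x : nat -> R) (U : R -> R)
  : Prop :=
  (forall j, (1 <= j <= M + 1)%nat ->
     coarse_ok k K eps (INR (2 * M)) (x (j - 1)%nat) (x j) U) /\
  (forall j, (M + 2 <= j <= 2 * M)%nat ->
     fine_ok k K eps (INR (2 * M)) (x (j - 1)%nat) (x j) U).

Lemma half_double M : (2 * M / 2)%nat = M.
Proof. rewrite Nat.mul_comm; apply Nat.div_mul; lia. Qed.

Lemma composite_poly k s M x u P j :
  composite_interpolant k s (2 * M) x u P -> (1 <= j <= 2 * M)%nat ->
  poly_le k (P j).
Proof.
  intros [H1 H2] Hj; rewrite half_double in H1, H2.
  destruct (le_lt_dec j (M + 1)); [apply H1|apply H2]; lia.
Qed.

Lemma composite_error k s K :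
  (1 <= k)%nat -> lobatto_nodes k s -> 1 <= K ->
  exists D, 1 <= D /\
  forall eps M x U P,
  mesh_ok K eps M x -> approx_ok k K eps M x U -> cdiff U ->
  composite_interpolant k s (2 * M) x U P ->
  let N := INR (2 * M) in
  let W := N ^ (k + 1) in
  let w := broken_minus P (fun _ => U) in
  (forall j, (1 <= j <= 2 * M)%nat ->
     w j (x j) = 0 /\
     forall t, x (j - 1)%nat <= t <= x j ->
       eps * N ^ k * Rabs (broken_derive w j t) <= D) /\
  (forall j, (M + 2 <= j <= 2 * M)%nat -> w j (x (j - 1)%nat) = 0) /\
  (forall j, (1 <= j <= M + 1)%nat -> exists A, 0 <= A /\ W * A <= D /\
     eps * W * A <= D * (x j - x (j - 1)%nat) /\
     forall t, x (j - 1)%nat <= t <= x j ->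
       Rabs (w j t) <= A /\ eps * W * Rabs (broken_derive w j t) <= D).
Proof.
  intros Hk Hs HK.
  destruct (coarse_interp k s Hk Hs) as (C & HC & HI).
  destruct (fine_interp k s Hk Hs) as (C' & HC' & HI').
  exists ((C + C') * K); split; [nra|].
  intros eps M x U P (He & HM & Hx0 & HxN & Hx & _ & _) [Hco Hfi] HU HP N W w.
  assert (Hpoly := fun j => composite_poly k s M x U P j HP).
  destruct HP as [HP1 HP2]; rewrite half_double in HP1, HP2.
  assert (HN : 1 <= N).
  { unfold N; apply (le_INR 1); lia. }
  assert (HNk : 1 <= N ^ k) by (apply pow_R1_Rle; lra).
  assert (HW : W = N * N ^ k) by (unfold W; rewrite Nat.add_1_r; reflexivity).
  assert (Hdw : forall j t, (1 <= j <= 2 * M)%nat ->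
    broken_derive w j t = Derive (P j) t - Derive U t).
  { intros j t Hj; apply Derive_minus_cdiff; [|easy].
    apply (poly_le_cdiff k), Hpoly, Hj. }
  assert (Hcoarse : forall j, (1 <= j <= M + 1)%nat ->
    exists A, 0 <= A /\ W * A <= (C + C') * K /\
     eps * W * A <= (C + C') * K * (x j - x (j - 1)%nat) /\
     forall t, x (j - 1)%nat <= t <= x j ->
       Rabs (w j t) <= A /\ eps * W * Rabs (broken_derive w j t) <= (C + C') * K).
  { intros j Hj; destruct (Hx j ltac:(lia)) as (Hl & Hlr & Hr).
    destruct (HI K eps N (x (j - 1)%nat) (x j) U HK ltac:(lra) HN Hlr HU
      (Hco j Hj)) as (T & A & HA & HWA & HeA & _ & HPb).
    fold W in HWA, HeA, HPb.
    assert (HCK : C * K <= (C + C') * K) by nra.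
    exists A; split; [easy|]; split; [lra|]; split.
    - pose proof (Rmult_le_compat_r (x j - x (j - 1)%nat) _ _ ltac:(lra) HCK); lra.
    - intros t Ht; destruct (HPb (P j) (or_introl (HP1 j Hj)) t Ht) as (H1 & _ & H2).
      split; [easy|]; rewrite Hdw by lia; lra. }
  split; [|split; [|easy]].
  - intros j Hj; destruct (Hx j ltac:(lia)) as (Hl & Hlr & Hr).
    destruct (le_lt_dec j (M + 1)) as [HjM|HjM].
    + split.
      * destruct (HP1 j ltac:(lia)) as (_ & _ & H); unfold w, broken_minus; lra.
      * intros t Ht; destruct (Hcoarse j ltac:(lia)) as (A & _ & _ & _ & H).
        destruct (H t Ht) as [_ H']; rewrite HW in H'.
        eapply Rle_trans; [|exact H'].
        apply Rmult_le_compat_r; [apply Rabs_pos|].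
        apply Rmult_le_compat_l; nra.
    + assert (HL := HP2 j ltac:(lia)); split.
      * destruct (lobatto_interp_ends k s _ _ U (P j) Hs HL) as [_ H].
        unfold w, broken_minus; lra.
      * intros t Ht; rewrite Hdw by lia.
        destruct (HI' K eps N (x (j - 1)%nat) (x j) U (P j) HK ltac:(lra) HN Hlr
          HU (Hfi j ltac:(lia)) HL) as [H _].
        destruct (H t Ht) as [_ H'].
        assert (C' * K <= (C + C') * K) by nra; lra.
  - intros j Hj.
    destruct (lobatto_interp_ends k s _ _ U (P j) Hs (HP2 j ltac:(lia))) as [H _].
    unfold w, broken_minus; lra.
Qed.

Definition node_term (eps : R) (mu : nat -> R) (N : nat) (x : nat -> R)
    (w v : nat -> R -> R) (j : nat) : R :=
  - (eps * avg N x (broken_derive w) j * jump N x v j)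
  + jump N x w j * (eps * avg N x (broken_derive v) j + mu j * jump N x v j).

(** At [j = 0] truncated subtraction makes the interval degenerate and the energy zero, so sums over
    nodes can start at 0. *)
Definition energy (x : nat -> R) (v : nat -> R -> R) (j : nat) : R :=
  RInt (fun t => broken_derive v j t ^ 2) (x (j - 1)%nat) (x j).

Lemma Rabs_avg_le a b c A :
  0 <= c -> c * Rabs a <= A -> c * Rabs b <= A -> c * Rabs (/ 2 * (a + b)) <= A.
Proof.
  intros Hc Ha Hb; rewrite Rabs_mult, (Rabs_right (/ 2)) by lra.
  pose proof (Rmult_le_compat_l c _ _ Hc (Rabs_triang a b)); lra.
Qed.

(** Up to node [M] the jump of the error is, up to sign, its right trace, bounded by the [A] of
    element [j + 1], while [{v'}] also involves element [j]. The trace from element [j + 1] is paid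
    for by [eps * W * A <= D * h], the one from element [j] by [eps <= K * h]. Beyond [M] the error
    has no jumps. *)
Lemma node_bound k s K :
  (1 <= k)%nat -> lobatto_nodes k s -> 1 <= K ->
  exists K', 0 <= K' /\
  forall eps M x U P v,
  mesh_ok K eps M x -> approx_ok k K eps M x U -> cdiff U ->
  composite_interpolant k s (2 * M) x U P -> V_space k (2 * M) v ->
  let mu := penalty (2 * M) in
  forall j, (j <= 2 * M)%nat ->
  Rabs (node_term eps mu (2 * M) x (broken_minus P (fun _ => U)) v j)
  <= / 8 * (mu j * jump (2 * M) x v j ^ 2)
     + / 16 * (eps * energy x v j)
     + / 16 * (if (j <? 2 * M)%nat then eps * energy x v (S j) else 0)
     + K' / (INR (2 * M) ^ (k + 1)) ^ 2.
Proof.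
  intros Hk Hs HK.
  destruct (composite_error k s K Hk Hs HK) as (D & HD & Hcomp).
  destruct (poly_inverse k) as (Ci & HCi & HIn).
  assert (HDD : 1 <= D * D) by (now apply one_le_mult).
  set (Q := D * D * K).
  assert (HQ : 1 <= Q) by (now apply one_le_mult).
  assert (HQD : D * D <= Q) by (unfold Q; nra).
  exists (8 * Ci * Q + 8 * D ^ 2); split; [nra|].
  intros eps M x U P v Hmesh Happ HU HP Hv mu j Hj.
  destruct (Hcomp eps M x U P Hmesh Happ HU HP) as (Hall & Hfine & Hcoarse).
  destruct Hmesh as (He & HM & Hx0 & HxN & Hx & HhM & _).
  set (w := broken_minus P (fun _ => U)) in *.
  set (N := INR (2 * M)) in *; set (W := N ^ (k + 1)) in *.
  assert (HN : 1 <= N) by (unfold N; apply (le_INR 1); lia).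
  assert (HNk : 1 <= N ^ k) by (apply pow_R1_Rle; lra).
  assert (HW : 1 <= W) by (apply pow_R1_Rle; lra).
  assert (HWN : W = N * N ^ k) by (unfold W; rewrite Nat.add_1_r; reflexivity).
  assert (HW2 : 0 < W ^ 2) by (apply pow_lt; lra).
  assert (Hen : forall i, (1 <= i <= 2 * M)%nat -> 0 <= energy x v i).
  { intros i Hi; apply RInt_cont_ge_0.
    - destruct (Hx i Hi); lra.
    - apply cont_pow, cdiff_cont_Derive, (poly_le_cdiff k), Hv, Hi.
    - intros; apply pow2_ge_0. }
  assert (Hen0 : energy x v 0 = 0) by exact (RInt_point _ _).
  assert (Hen' : forall i, (i <= 2 * M)%nat -> 0 <= energy x v i).
  { intros [|i] Hi; [rewrite Hen0; lra|apply Hen; lia]. }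
  assert (Htrace : forall i, (1 <= i <= 2 * M)%nat -> exists e, 0 <= e /\
    (x i - x (i - 1)%nat) * e ^ 2 <= Ci * energy x v i /\
    forall t, x (i - 1)%nat <= t <= x i -> Rabs (broken_derive v i t) <= e).
  { intros i Hi; destruct (Hx i Hi) as (_ & Hlr & _).
    destruct (HIn _ _ (v i) Hlr (Hv i Hi)) as (a & e & _ & He0 & _ & Hei & Hve).
    exists e; split; [easy|]; split; [easy|]; intros t Ht; now apply Hve. }
  unfold node_term.
  destruct (le_lt_dec j M) as [HjM|HjM].
  - assert (HjN : (j <? 2 * M)%nat = true) by (apply Nat.ltb_lt; lia).
    rewrite HjN; unfold mu; rewrite (penalty_coarse M j HjM).
    destruct (Hcoarse (S j) ltac:(lia)) as (A & HA & HWA & HeA & HwA).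
    destruct (Htrace (S j) ltac:(lia)) as (e2 & He2 & Hei2 & Hv2).
    destruct (Hx (S j) ltac:(lia)) as (_ & Hlr & _).
    replace (S j - 1)%nat with j in HeA, HwA, Hei2, Hv2, Hlr by lia.
    assert (Hdata : forall h, 0 < h -> eps <= K * h \/ eps * W * A <= D * h ->
      eps * W ^ 2 * A ^ 2 <= Q * h).
    { intros h Hh0 [Hh|Hh].
      - replace (eps * W ^ 2 * A ^ 2) with ((W * A) * (W * A) * eps) by ring.
        unfold Q; rewrite (Rmult_assoc (D * D)).
        assert (0 <= W * A) by nra.
        apply Rmult_le_compat; [now apply Rmult_le_pos|lra| |easy].
        now apply Rmult_le_compat.
      - apply Rle_trans with (D * D * h); [|apply Rmult_le_compat_r; lra].
        replace (eps * W ^ 2 * A ^ 2) with ((W * A) * (eps * W * A)) by ring.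
        rewrite (Rmult_assoc D D); apply Rmult_le_compat; try easy; [nra|].
        apply Rmult_le_pos; nra. }
    assert (HX : forall h e I, 0 < h -> h * e ^ 2 <= Ci * I ->
      eps <= K * h \/ eps * W * A <= D * h ->
      eps * A * e <= / 16 * (eps * I) + 4 * Ci * Q / W ^ 2).
    { intros h e I Hh Hei Hor.
      assert (H := young_local (/ 16) eps Ci Q W h A e I ltac:(lra) ltac:(lra) HCi
        ltac:(lra) Hh Hei (Hdata h Hh Hor)).
      replace (Ci / (4 * / 16)) with (4 * Ci) in H by field; lra. }
    assert (Hleft : exists e1, 0 <= e1 /\
      eps * A * e1 <= / 16 * (eps * energy x v j) + 4 * Ci * Q / W ^ 2 /\
      ((1 <= j)%nat -> Rabs (broken_derive v j (x j)) <= e1)).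
    { destruct (Nat.eq_dec j 0) as [->|Hj0].
      - exists 0; split; [lra|]; split; [|intros; lia].
        rewrite Hen0, !Rmult_0_r, Rplus_0_l.
        apply Rdiv_le_0_compat; [repeat apply Rmult_le_pos|]; lra.
      - destruct (Htrace j ltac:(lia)) as (e1 & He1 & Hei1 & Hv1).
        destruct (Hx j ltac:(lia)) as (_ & Hlr1 & _).
        exists e1; split; [easy|]; split.
        + apply (HX _ e1 _) in Hei1; [easy|lra|left; apply HhM; lia].
        + intros _; apply Hv1; lra. }
    destruct Hleft as (e1 & He1 & HX1 & Hv1).
    assert (HX2 := HX (x (S j) - x j) e2 (energy x v (S j)) ltac:(lra) Hei2 (or_intror HeA)).
    assert (Hpj : eps * W * Rabs (avg (2 * M) x (broken_derive w) j) <= D /\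
      Rabs (jump (2 * M) x w j) <= A /\
      Rabs (avg (2 * M) x (broken_derive v) j) <= e1 + e2).
    { destruct (Nat.eq_dec j 0) as [->|Hj0].
      - rewrite !avg_0, jump_0, Rabs_Ropp.
        split; [apply HwA; lra|]; split; [apply HwA; lra|].
        assert (H := Hv2 (x 0%nat) ltac:(lra)); lra.
      - rewrite !avg_interior, jump_interior by lia.
        destruct (Hall j ltac:(lia)) as [Hw0 _].
        destruct (Hx j ltac:(lia)) as (_ & Hlr1 & _).
        split; [|split].
        + apply Rabs_avg_le; [nra|apply HwA; lra|].
          destruct (Hcoarse j ltac:(lia)) as (A' & _ & _ & _ & H); apply H; lra.
        + rewrite Hw0, Rminus_0_l, Rabs_Ropp; apply HwA; lra.
        + rewrite Rabs_mult, (Rabs_right (/ 2)) by lra.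
          assert (H1 := Hv2 (x j) ltac:(lra)); specialize (Hv1 ltac:(lia)).
          pose proof (Rabs_triang (broken_derive v (S j) (x j))
            (broken_derive v j (x j))); lra. }
    destruct Hpj as (Hp & Hg & Hq).
    eapply Rle_trans.
    { apply (node_term_bound D W A _ _ _ _ eps e1 e2); try eassumption; try lra.
      rewrite Rabs_mult, (Rabs_right eps) by lra; lra. }
    unfold Rdiv; lra.
  - assert (Hj0 : jump (2 * M) x w j = 0).
    { destruct (Nat.eq_dec j (2 * M)) as [->|HjN].
      - rewrite jump_N by lia; apply Hall; lia.
      - rewrite jump_interior by lia.
        destruct (Hall j ltac:(lia)) as [-> _].
        assert (H := Hfine (S j) ltac:(lia)).
        replace (S j - 1)%nat with j in H by lia; rewrite H; ring. }
    assert (Hp : eps * N ^ k * Rabs (avg (2 * M) x (broken_derive w) j) <= D).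
    { destruct (Hx j ltac:(lia)) as (_ & Hlr & _).
      destruct (Hall j ltac:(lia)) as [_ Hwj].
      destruct (Nat.eq_dec j (2 * M)) as [Heq|HjN].
      - rewrite Heq at 1; rewrite avg_N by lia; rewrite <- Heq; apply Hwj; lra.
      - rewrite avg_interior by lia; apply Rabs_avg_le; [nra| |apply Hwj; lra].
        destruct (Hall (S j) ltac:(lia)) as [_ Hwj1].
        destruct (Hx (S j) ltac:(lia)) as (_ & Hlr1 & _).
        replace (S j - 1)%nat with j in Hwj1, Hlr1 by lia.
        apply Hwj1; lra. }
    rewrite Hj0, Rmult_0_l, Rplus_0_r; unfold mu; rewrite penalty_fine by easy.
    fold N; rewrite Rabs_Ropp, Rabs_mult.
    set (p := avg (2 * M) x (broken_derive w) j) in *.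
    set (s' := jump (2 * M) x v j).
    (* Applied to [N * |[v]|], whose square is exactly the penalty term. *)
    assert (HY := young (/ 8) (D / W) (N * Rabs s') ltac:(lra)).
    rewrite Rpow_mult_distr, pow2_abs in HY.
    replace ((D / W) ^ 2 / (4 * / 8)) with (2 * D ^ 2 / W ^ 2) in HY
      by (field; lra).
    assert (Hle : Rabs (eps * p) * Rabs s' <= D / W * (N * Rabs s')).
    { rewrite <- Rmult_assoc; apply Rmult_le_compat_r; [apply Rabs_pos|].
      rewrite Rabs_mult, (Rabs_right eps) by lra.
      replace (D / W * N) with (D / N ^ k) by (rewrite HWN; field; lra).
      apply (proj1 (Rle_div_r _ _ (N ^ k) ltac:(lra))); lra. }
    assert (H1 : 0 <= eps * energy x v j) by (apply Rmult_le_pos; [lra|now apply Hen']).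
    assert (H2 : 0 <= if (j <? 2 * M)%nat then eps * energy x v (S j) else 0).
    { destruct (Nat.ltb_spec j (2 * M)); [|lra].
      apply Rmult_le_pos; [lra|apply Hen'; lia]. }
    assert (H3 : 2 * D ^ 2 / W ^ 2 <= (8 * Ci * Q + 8 * D ^ 2) / W ^ 2).
    { apply Rmult_le_compat_r; [left; now apply Rinv_0_lt_compat|nra]. }
    lra.
Qed.

(** * Error bounds *)

Lemma sum_const_R (a : R) n m :
  sum_n_m (fun _ => a) n m = INR (S m - n) * a.
Proof. apply sum_n_m_const. Qed.

Lemma sum_shift_R (a : nat -> R) n m :
  sum_n_m (fun j => a (S j)) n m = sum_n_m a (S n) (S m).
Proof. apply sum_n_m_S. Qed.

Definition mass (x : nat -> R) (v : nat -> R -> R) (j : nat) : R :=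
  RInt (fun t => v j t ^ 2) (x (j - 1)%nat) (x j).

Lemma broken_int_energy N x v :
  broken_int N x (fun j t => broken_derive v j t ^ 2) = sum_n_m (energy x v) 1 N.
Proof. reflexivity. Qed.

Lemma penalty_pos N j : (1 <= N)%nat -> 1 <= penalty N j.
Proof.
  intros HN; unfold penalty; destruct (j <=? N / 2)%nat; [lra|].
  apply pow_R1_Rle; now apply (le_INR 1).
Qed.

(** The fractions add up to 1/4 for the energy: 1/8 from the element itself and 1/16 from each of
    its two end nodes. The charges to right neighbours, collected in [tail], sum to the total energy
    again after a shift. *)
Lemma nipg_form_interp_bound k s gamma B K :
  (1 <= k)%nat -> lobatto_nodes k s -> 0 < gamma -> 1 <= B -> 1 <= K ->
  exists K', 0 <= K' /\
  forall eps M x b c U P v,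
  mesh_ok K eps M x -> approx_ok k K eps M x U -> coefficients_ok B b c ->
  cdiff U -> composite_interpolant k s (2 * M) x U P -> V_space k (2 * M) v ->
  let N := INR (2 * M) in
  let mu := penalty (2 * M) in
  nipg_form eps b c mu (2 * M) x (broken_minus P (fun _ => U)) v
  <= / 4 * nipg_norm_sq eps gamma b mu (2 * M) x v + K' * (N / (N ^ (k + 1)) ^ 2).
Proof.
  intros Hk Hs Hg HB HK.
  destruct (coarse_element_bound k s gamma B K Hk Hs Hg HB HK) as (K1 & HK1 & HE1).
  destruct (fine_element_bound k s gamma B K Hk Hs Hg HB HK) as (K2 & HK2 & HE2).
  destruct (node_bound k s K Hk Hs HK) as (K3 & HK3 & HN3).
  destruct (composite_error k s K Hk Hs HK) as (D & _ & Hcomp).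
  (* There are [N + 1] nodes, and [N + 1 <= 2 N]. *)
  exists (K1 + K2 + 2 * K3); split; [lra|].
  intros eps M x b c U P v Hmesh Happ Hcoef HU HP Hv N mu.
  destruct (Hcomp eps M x U P Hmesh Happ HU HP) as (Hall & _ & _).
  specialize (HN3 eps M x U P v Hmesh Happ HU HP Hv).
  assert (Hpoly := fun j => composite_poly k s M x U P j HP).
  destruct Hmesh as (He & HM & Hx0 & HxN & Hx & _ & Hhf).
  destruct Happ as [Hco Hfi].
  destruct HP as [HP1 HP2]; rewrite half_double in HP1, HP2.
  assert (HN1 : 1 <= N) by (unfold N; apply (le_INR 1); lia).
  set (w := broken_minus P (fun _ => U)) in *.
  set (W := N ^ (k + 1)) in *.
  assert (HW : 1 <= W) by (apply pow_R1_Rle; lra).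
  assert (HW2 : 0 < W ^ 2) by (apply pow_lt; lra).
  assert (Hwc : piecewise_cdiff (2 * M) w).
  { intros j Hj; apply cdiff_minus; [|easy].
    apply (poly_le_cdiff k), Hpoly, Hj. }
  assert (Hvc : piecewise_cdiff (2 * M) v).
  { intros j Hj; apply (poly_le_cdiff k), Hv, Hj. }
  rewrite nipg_form_right_zero; auto;
    [|lia|intros j Hj; destruct (Hx j Hj); lra|apply Hcoef|apply Hcoef
     |intros j Hj; now apply Hall].
  set (I0 := mass x v).
  assert (Hel : forall j, (1 <= j <= 2 * M)%nat ->
    eps * RInt (fun t => broken_derive w j t * broken_derive v j t)
            (x (j - 1)%nat) (x j)
    + RInt (fun t => (c t - Derive b t) * w j t * v j t) (x (j - 1)%nat) (x j)
    - RInt (fun t => b t * w j t * broken_derive v j t) (x (j - 1)%nat) (x j)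
    <= (/ 8 * eps) * energy x v j + (/ 8 * gamma) * I0 j + (K1 + K2) / W ^ 2).
  { intros j Hj; destruct (Hx j Hj) as (Hl & Hlr & Hr).
    assert (Hd : 0 <= / W ^ 2) by (left; now apply Rinv_0_lt_compat).
    destruct (le_lt_dec j (M + 1)) as [HjM|HjM].
    - assert (H := HE1 eps N (x (j - 1)%nat) (x j) b c U (P j) (v j) ltac:(lra)
        HN1 Hl Hlr Hr Hcoef HU (Hco j ltac:(lia)) (Hv j Hj) (HP1 j ltac:(lia))).
      cbv zeta in H; fold W in H.
      eapply Rle_trans; [apply Rle_abs|]; eapply Rle_trans; [exact H|].
      change (RInt (fun t => Derive (v j) t ^ 2) (x (j - 1)%nat) (x j))
        with (energy x v j).
      change (RInt (fun t => v j t ^ 2) (x (j - 1)%nat) (x j)) with (I0 j).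
      unfold Rdiv; pose proof (Rmult_le_pos K2 _ HK2 Hd); lra.
    - assert (H := HE2 eps N (x (j - 1)%nat) (x j) b c U (P j) (v j) ltac:(lra)
        HN1 Hl Hlr Hr (Hhf j ltac:(lia)) Hcoef HU (Hfi j ltac:(lia)) (Hv j Hj)
        (HP2 j ltac:(lia))).
      cbv zeta in H; fold W in H.
      eapply Rle_trans; [apply Rle_abs|]; eapply Rle_trans; [exact H|].
      change (RInt (fun t => Derive (v j) t ^ 2) (x (j - 1)%nat) (x j))
        with (energy x v j).
      change (RInt (fun t => v j t ^ 2) (x (j - 1)%nat) (x j)) with (I0 j).
      unfold Rdiv; pose proof (Rmult_le_pos K1 _ HK1 Hd); lra. }
  apply sum_le_R in Hel.
  rewrite (sum_plus_R (fun j => / 8 * eps * energy x v j + / 8 * gamma * I0 j)),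
    sum_plus_R, !sum_scal_R, sum_const_R in Hel.
  replace (S (2 * M) - 1)%nat with (2 * M)%nat in Hel by lia; fold N in Hel.
  set (tail := fun j => if (j <? 2 * M)%nat then energy x v (S j) else 0).
  assert (Hnd : forall j, (0 <= j <= 2 * M)%nat ->
    node_term eps mu (2 * M) x w v j <=
    / 8 * (mu j * jump (2 * M) x v j ^ 2) + (/ 16 * eps) * energy x v j
    + (/ 16 * eps) * tail j
    + K3 / W ^ 2).
  { intros j [_ Hj]; eapply Rle_trans; [apply Rle_abs|].
    eapply Rle_trans; [apply (HN3 j Hj)|].
    fold N W mu; unfold tail; destruct (j <? 2 * M)%nat; lra. }
  apply sum_le_R in Hnd.
  rewrite (sum_plus_R (fun j => / 8 * (mu j * jump (2 * M) x v j ^ 2)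
      + (/ 16 * eps) * energy x v j
      + (/ 16 * eps) * tail j)),
    (sum_plus_R (fun j => / 8 * (mu j * jump (2 * M) x v j ^ 2)
      + (/ 16 * eps) * energy x v j)),
    sum_plus_R, !sum_scal_R, sum_const_R in Hnd.
  assert (Hen0 : energy x v 0 = 0) by exact (RInt_point _ _).
  rewrite (sum_first_R (energy x v)), Hen0, Rplus_0_l in Hnd by lia.
  assert (Hshift : sum_n_m tail 0 (2 * M)
    = sum_n_m (energy x v) 1 (2 * M)).
  { unfold tail; replace (2 * M)%nat with (S (2 * M - 1)) by lia.
    rewrite sum_last_R by lia; rewrite Nat.ltb_irrefl, Rplus_0_r.
    rewrite <- sum_shift_R; apply sum_n_m_ext_loc; intros j Hj.
    now replace (j <? S (2 * M - 1))%nat with true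
      by (symmetry; apply Nat.ltb_lt; lia). }
  rewrite Hshift, Nat.sub_0_r, S_INR in Hnd; fold N in Hnd.
  assert (Hmu : sum_n_m (fun j => mu j * jump (2 * M) x v j ^ 2) 0 (2 * M)
    <= sum_n_m (fun j => (mu j + / 2 * b (x j)) * jump (2 * M) x v j ^ 2) 0 (2 * M)).
  { apply sum_le_R; intros j Hj; apply Rmult_le_compat_r; [apply pow2_ge_0|].
    destruct Hcoef as (_ & _ & Hbc).
    destruct (Nat.eq_dec j 0) as [->|Hj0].
    - rewrite Hx0; destruct (Hbc 0 ltac:(lra)); lra.
    - destruct (Hx j ltac:(lia)) as (Hl & Hlr & Hr).
      destruct (Hbc (x j) ltac:(lra)); lra. }
  assert (Hmu0 : 0 <= sum_n_m (fun j => mu j * jump (2 * M) x v j ^ 2) 0 (2 * M)).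
  { rewrite <- (Rmult_0_r (INR (S (2 * M) - 0))), <- sum_const_R.
    apply sum_le_R; intros j Hj; apply Rmult_le_pos; [|apply pow2_ge_0].
    pose proof (penalty_pos (2 * M) j ltac:(lia)); unfold mu; lra. }
  assert (HI1 : 0 <= sum_n_m (energy x v) 1 (2 * M)).
  { rewrite <- (Rmult_0_r (INR (S (2 * M) - 1))), <- sum_const_R.
    apply sum_le_R; intros j Hj; apply RInt_cont_ge_0.
    - destruct (Hx j Hj); lra.
    - apply cont_pow, cdiff_cont_Derive, Hvc, Hj.
    - intros; apply pow2_ge_0. }
  assert (HI0 : 0 <= sum_n_m I0 1 (2 * M)).
  { rewrite <- (Rmult_0_r (INR (S (2 * M) - 1))), <- sum_const_R.
    apply sum_le_R; intros j Hj; apply RInt_cont_ge_0.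
    - destruct (Hx j Hj); lra.
    - apply cont_pow, cdiff_cont, Hvc, Hj.
    - intros; apply pow2_ge_0. }
  eapply Rle_trans; [apply Rplus_le_compat; [exact Hel|exact Hnd]|].
  unfold nipg_norm_sq; rewrite broken_int_energy.
  change (broken_int (2 * M) x (fun j t => v j t ^ 2)) with (sum_n_m I0 1 (2 * M)).
  set (S1 := sum_n_m (energy x v) 1 (2 * M)) in *.
  set (S0 := sum_n_m I0 1 (2 * M)) in *.
  assert (0 <= eps * S1) by (apply Rmult_le_pos; lra).
  assert (0 <= gamma * S0) by (apply Rmult_le_pos; lra).
  assert (0 < / W ^ 2) by now apply Rinv_0_lt_compat.
  assert (K3 * / W ^ 2 <= N * (K3 * / W ^ 2)).
  { rewrite <- (Rmult_1_l (K3 * / W ^ 2)) at 1.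
    apply Rmult_le_compat_r; [apply Rmult_le_pos; lra|easy]. }
  unfold Rdiv; lra.
Qed.

Lemma galerkin_error k s gamma B K :
  (1 <= k)%nat -> lobatto_nodes k s -> 0 < gamma -> 1 <= B -> 1 <= K ->
  exists K', 0 <= K' /\
  forall eps M x b c f U P uN,
  mesh_ok K eps M x -> approx_ok k K eps M x U -> coefficients_ok B b c ->
  cdiff U -> cdiff (Derive U) -> U 0 = 0 -> U 1 = 0 ->
  (forall t, 0 < t < 1 ->
     - eps * Derive (Derive U) t + b t * Derive U t + c t * U t = f t) ->
  (forall t, 0 < t < 1 -> gamma <= c t - / 2 * Derive b t) ->
  composite_interpolant k s (2 * M) x U P ->
  nipg_solution k eps b c f (penalty (2 * M)) (2 * M) x uN ->
  let N := INR (2 * M) in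
  nipg_norm_sq eps gamma b (penalty (2 * M)) (2 * M) x (broken_minus P uN)
  <= K' * (N / (N ^ (k + 1)) ^ 2).
Proof.
  intros Hk Hs Hg HB HK.
  destruct (nipg_form_interp_bound k s gamma B K Hk Hs Hg HB HK) as (K' & HK' & HF).
  (* Absorbing a quarter of the norm gives the factor 4/3, rounded up to 2. *)
  exists (2 * K'); split; [lra|].
  intros eps M x b c f U P uN Hmesh Happ Hcoef HU HU' HU0 HU1 Heq Hgam HP
    [HuN Hsol] N.
  assert (Hpoly := fun j => composite_poly k s M x U P j HP).
  set (xi := broken_minus P uN).
  assert (Hxi : V_space k (2 * M) xi).
  { intros j Hj; apply poly_le_minus; [now apply Hpoly|now apply HuN]. }
  assert (Hb := HF eps M x b c U P xi Hmesh Happ Hcoef HU HP Hxi).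
  cbv zeta in Hb; fold N in Hb.
  destruct Hmesh as (He & HM & Hx0 & HxN & Hx & _ & _).
  destruct Hcoef as (Hbc & Hcc & Hcoef).
  assert (Hx' : forall j, (1 <= j <= 2 * M)%nat -> x (j - 1)%nat <= x j).
  { intros j Hj; destruct (Hx j Hj); lra. }
  assert (HPc : piecewise_cdiff (2 * M) P).
  { intros j Hj; apply (poly_le_cdiff k), Hpoly, Hj. }
  assert (HuNc : piecewise_cdiff (2 * M) uN).
  { intros j Hj; apply (poly_le_cdiff k), HuN, Hj. }
  assert (Hxic : piecewise_cdiff (2 * M) xi).
  { intros j Hj; apply (poly_le_cdiff k), Hxi, Hj. }
  assert (HUc : piecewise_cdiff (2 * M) (fun _ => U)) by now intros j Hj.
  assert (Hxin : forall j t, (1 <= j <= 2 * M)%nat -> x (j - 1)%nat < t < x j ->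
    0 < t < 1).
  { intros j t Hj Ht; destruct (Hx j Hj) as (H1 & H2 & H3); lra. }
  assert (Hcoer : nipg_norm_sq eps gamma b (penalty (2 * M)) (2 * M) x xi
    <= nipg_form eps b c (penalty (2 * M)) (2 * M) x xi xi).
  { apply nipg_form_coercive; auto; [lia|].
    intros j t Hj Ht; apply Hgam, (Hxin j t Hj Ht). }
  (* Galerkin orthogonality: the forms of [P - uN] and of [P - U] against [xi] both reduce to the
     form of [P] minus the integral of [f xi], by the discrete equation and by consistency. *)
  unfold xi at 2 in Hcoer.
  rewrite nipg_form_minus in Hcoer by (auto using cdiff_cont; lia).
  rewrite (Hsol xi Hxi) in Hcoer.
  rewrite nipg_form_minus in Hb by (auto using cdiff_cont; lia).
  rewrite (nipg_form_consistent eps b c f _ _ x U xi) in Hb;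
    auto using cdiff_cont; [|lia|now rewrite Hx0|now rewrite HxN|].
  - assert (H0 : 0 <= K' * (N / (N ^ (k + 1)) ^ 2)); [|lra].
    assert (HN : 0 < N) by (apply lt_0_INR; lia).
    apply Rmult_le_pos; [easy|]; apply Rdiv_le_0_compat; [lra|].
    now do 2 apply pow_lt.
  - intros j t Hj Ht; apply Heq, (Hxin j t Hj Ht).
Qed.

(** Termwise from [(a - c)^2 <= 2 (a - b)^2 + 2 (b - c)^2]; the factor 2 goes into the final
    constant. *)
Lemma nipg_norm_sq_triangle eps gamma b mu N x u v w :
  0 <= eps -> 0 <= gamma ->
  (forall j, (j <= N)%nat -> 0 <= mu j + / 2 * b (x j)) ->
  (forall j, (1 <= j <= N)%nat -> x (j - 1)%nat <= x j) ->
  piecewise_cdiff N u -> piecewise_cdiff N v -> piecewise_cdiff N w ->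
  nipg_norm_sq eps gamma b mu N x (broken_minus u w)
  <= 2 * nipg_norm_sq eps gamma b mu N x (broken_minus u v)
     + 2 * nipg_norm_sq eps gamma b mu N x (broken_minus v w).
Proof.
  intros He Hg Hmu Hx Hu Hv Hw; unfold nipg_norm_sq.
  assert (Huv := piecewise_cdiff_minus N u v Hu Hv).
  assert (Hvw := piecewise_cdiff_minus N v w Hv Hw).
  assert (Huw := piecewise_cdiff_minus N u w Hu Hw).
  assert (Hsq : forall a b c : R, (a - c) ^ 2 <= 2 * (a - b) ^ 2 + 2 * (b - c) ^ 2).
  { intros a b' c'; pose proof (pow2_ge_0 (a - 2 * b' + c')); nra. }
  assert (H1 : broken_int N x (fun j t => broken_derive (broken_minus u w) j t ^ 2)
    <= 2 * broken_int N x (fun j t => broken_derive (broken_minus u v) j t ^ 2)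
     + 2 * broken_int N x (fun j t => broken_derive (broken_minus v w) j t ^ 2)).
  { rewrite <- !broken_int_scal, <- broken_int_plus
      by (intros; solve_cont).
    apply broken_int_le; [easy|intros; solve_cont|intros; solve_cont|].
    intros j t Hj _; rewrite !(broken_derive_minus N) by auto; apply Hsq. }
  assert (H0 : broken_int N x (fun j t => broken_minus u w j t ^ 2)
    <= 2 * broken_int N x (fun j t => broken_minus u v j t ^ 2)
     + 2 * broken_int N x (fun j t => broken_minus v w j t ^ 2)).
  { rewrite <- !broken_int_scal, <- broken_int_plus
      by (intros; solve_cont).
    apply broken_int_le; [easy|intros; solve_cont|intros; solve_cont|].
    intros j t Hj _; apply Hsq. }
  assert (H2 : sum_n_m (fun j => (mu j + / 2 * b (x j))
      * jump N x (broken_minus u w) j ^ 2) 0 N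
    <= 2 * sum_n_m (fun j => (mu j + / 2 * b (x j))
           * jump N x (broken_minus u v) j ^ 2) 0 N
     + 2 * sum_n_m (fun j => (mu j + / 2 * b (x j))
           * jump N x (broken_minus v w) j ^ 2) 0 N).
  { rewrite <- !sum_scal_R, <- sum_plus_R; apply sum_le_R; intros j [_ Hj].
    rewrite !jump_minus.
    pose proof (Rmult_le_compat_l _ _ _ (Hmu j Hj)
      (Hsq (jump N x u j) (jump N x v j) (jump N x w j))); lra. }
  apply (Rmult_le_compat_l eps) in H1; [|easy].
  apply (Rmult_le_compat_l gamma) in H0; [|easy].
  lra.
Qed.

Lemma RInt_sq_le f l r A :
  l <= r -> cont f -> (forall t, l <= t <= r -> Rabs (f t) <= A) ->
  RInt (fun t => f t ^ 2) l r <= (r - l) * A ^ 2.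
Proof.
  intros Hlr Hf HA; eapply Rle_trans; [apply Rle_abs|].
  apply RInt_abs_le; [easy|solve_cont|].
  intros t Ht; rewrite <- RPow_abs; apply pow_incr; split; [apply Rabs_pos|auto].
Qed.

(** On Lobatto elements the two interpolants coincide, and both are exact at right ends. Hence the
    difference jumps only at nodes up to [M], where the penalty is 1, and each such jump is a single
    right trace. *)
Lemma interpolants_difference k s gamma B K :
  (1 <= k)%nat -> lobatto_nodes k s -> 0 < gamma -> 1 <= B -> 1 <= K ->
  exists K', 0 <= K' /\
  forall eps M x b c U L P,
  mesh_ok K eps M x -> approx_ok k K eps M x U -> coefficients_ok B b c ->
  cdiff U -> lobatto_interpolant k s (2 * M) x U L ->
  composite_interpolant k s (2 * M) x U P ->
  let N := INR (2 * M) in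
  nipg_norm_sq eps gamma b (penalty (2 * M)) (2 * M) x (broken_minus L P)
  <= K' * (N / (N ^ (k + 1)) ^ 2).
Proof.
  intros Hk Hs Hg HB HK.
  destruct (coarse_interp k s Hk Hs) as (C & HC & HI).
  destruct (interp_error k s Hk Hs) as (C' & HC' & HI').
  set (D := C * K); assert (HD : 1 <= D) by (apply one_le_mult; easy).
  set (Q := 4 * (D * D)).
  assert (HDD : 1 <= D * D) by (now apply one_le_mult).
  assert (HQ : 0 <= Q) by (unfold Q; lra).
  exists (Q * (1 + gamma) + 2 * ((1 + B) * Q)).
  assert (HBQ : 0 <= (1 + B) * Q) by (apply Rmult_le_pos; lra).
  split; [nra|].
  intros eps M x b c U L P Hmesh [Hco _] (Hbc & _ & Hcoef) HU HL HP N.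
  assert (Hpoly := fun j => composite_poly k s M x U P j HP).
  destruct Hmesh as (He & HM & Hx0 & HxN & Hx & _ & _).
  destruct HP as [HP1 HP2]; rewrite half_double in HP1, HP2.
  assert (HN : 1 <= N) by (unfold N; apply (le_INR 1); lia).
  set (W := N ^ (k + 1)).
  assert (HW : 1 <= W) by (apply pow_R1_Rle; lra).
  assert (HW2 : 0 < W ^ 2) by (apply pow_lt; lra).
  assert (HiW : 0 < / W ^ 2) by now apply Rinv_0_lt_compat.
  set (d := broken_minus L P).
  assert (HLc : piecewise_cdiff (2 * M) L).
  { intros j Hj; apply (poly_le_cdiff k), (HL j Hj). }
  assert (HPc : piecewise_cdiff (2 * M) P).
  { intros j Hj; apply (poly_le_cdiff k), Hpoly, Hj. }
  assert (Hdc : piecewise_cdiff (2 * M) d) by now apply piecewise_cdiff_minus.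
  assert (Hloc : forall j, (1 <= j <= 2 * M)%nat -> exists A,
    0 <= A /\ W ^ 2 * A ^ 2 <= Q /\
    eps * W ^ 2 * A ^ 2 <= Q * (x j - x (j - 1)%nat) /\
    forall t, x (j - 1)%nat <= t <= x j -> Rabs (d j t) <= A /\
      (x j - x (j - 1)%nat) * Rabs (broken_derive d j t) <= A).
  { intros j Hj; destruct (Hx j Hj) as (Hl & Hlr & Hr).
    assert (Hdd : forall t, broken_derive d j t = Derive (L j) t - Derive (P j) t).
    { intros t; apply Derive_minus_cdiff; auto. }
    destruct (le_lt_dec j (M + 1)) as [HjM|HjM].
    - destruct (HI K eps N _ _ U HK ltac:(lra) HN Hlr HU (Hco j ltac:(lia)))
        as (T & A & HA & HWA & HeA & _ & HPb).
      fold D W in HWA, HeA, HPb.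
      exists (2 * A); split; [lra|]; split; [|split].
      + replace (W ^ 2 * (2 * A) ^ 2) with (4 * ((W * A) * (W * A))) by ring.
        apply Rmult_le_compat_l; [lra|]; assert (0 <= W * A) by nra.
        now apply Rmult_le_compat.
      + replace (eps * W ^ 2 * (2 * A) ^ 2) with (4 * ((W * A) * (eps * W * A)))
          by ring.
        replace (Q * (x j - x (j - 1)%nat))
          with (4 * (D * (D * (x j - x (j - 1)%nat)))) by (unfold Q; ring).
        apply Rmult_le_compat_l; [lra|]; apply Rmult_le_compat; try easy; [nra|].
        apply Rmult_le_pos; [apply Rmult_le_pos|]; lra.
      + intros t Ht.
        destruct (HPb (P j) (or_introl (HP1 j ltac:(lia))) t Ht) as (P0 & P1 & _).
        destruct (HPb (L j) (or_intror (HL j Hj)) t Ht) as (L0 & L1 & _).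
        split.
        * unfold d, broken_minus.
          replace (L j t - P j t) with ((L j t - U t) - (P j t - U t)) by ring.
          replace (2 * A) with (A + A) by ring; now apply Rabs_minus_le.
        * rewrite Hdd.
          replace (Derive (L j) t - Derive (P j) t)
            with ((Derive (L j) t - Derive T t) + - (Derive (P j) t - Derive T t))
            by ring.
          pose proof (Rmult_le_compat_l (x j - x (j - 1)%nat) _ _ ltac:(lra)
            (Rabs_triang (Derive (L j) t - Derive T t)
               (- (Derive (P j) t - Derive T t)))) as H.
          rewrite Rabs_Ropp in H; lra.
    - exists 0; split; [lra|].
      replace (0 ^ 2) with 0 by ring; rewrite !Rmult_0_r.
      split; [easy|]; split; [apply Rmult_le_pos; lra|].
      intros t Ht.
      (* Uniqueness of the Lobatto interpolant: [L j] interpolates the polynomial [P j], so the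
         error estimate holds with [A = 0]. *)
      destruct (HI' (x (j - 1)%nat) (x j) (P j) (P j) (L j) 0) with (x := t)
        as [H0 H1]; auto; [lra| | |].
      + intros y _; rewrite Rminus_diag, Rabs_R0; lra.
      + right; split; [apply (HL j Hj)|]; intros i Hi.
        destruct (HL j Hj) as [_ HLn]; destruct (HP2 j ltac:(lia)) as [_ HPn].
        specialize (HLn i Hi); specialize (HPn i Hi); simpl in *; lra.
      + rewrite Rmult_0_r in H0, H1; rewrite Hdd; now split. }
  assert (Hright : forall j, (1 <= j <= 2 * M)%nat -> d j (x j) = 0).
  { intros j Hj; unfold d, broken_minus.
    destruct (lobatto_interp_ends k s _ _ U (L j) Hs (HL j Hj)) as [_ HLr].
    destruct (le_lt_dec j (M + 1)) as [HjM|HjM].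
    - destruct (HP1 j ltac:(lia)) as (_ & _ & H); lra.
    - destruct (lobatto_interp_ends k s _ _ U (P j) Hs (HP2 j ltac:(lia))) as [_ H].
      lra. }
  assert (Hleft : forall j, (M + 2 <= j <= 2 * M)%nat -> d j (x (j - 1)%nat) = 0).
  { intros j Hj; unfold d, broken_minus.
    destruct (lobatto_interp_ends k s _ _ U (L j) Hs (HL j ltac:(lia))) as [HLl _].
    destruct (lobatto_interp_ends k s _ _ U (P j) Hs (HP2 j Hj)) as [H _].
    lra. }
  assert (Hel : forall j, (1 <= j <= 2 * M)%nat ->
    eps * energy x d j + gamma * mass x d j <= Q * (1 + gamma) / W ^ 2).
  { intros j Hj; destruct (Hx j Hj) as (Hl & Hlr & Hr).
    destruct (Hloc j Hj) as (A & HA & HWA & HeA & Hdb).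
    set (h := x j - x (j - 1)%nat) in *.
    assert (Hh : 0 < h <= 1) by (unfold h; lra).
    assert (H1 : eps * energy x d j <= Q / W ^ 2).
    { apply Rle_trans with (eps * (h * (A / h) ^ 2)).
      - apply Rmult_le_compat_l; [lra|]; apply RInt_sq_le; [lra| |].
        + now apply cdiff_cont_Derive, Hdc.
        + intros t Ht; apply (proj1 (Rle_div_r _ _ h (proj1 Hh))).
          rewrite Rmult_comm; now apply Hdb.
      - apply (proj1 (Rle_div_r _ _ (W ^ 2) HW2)).
        apply Rmult_le_reg_r with h; [easy|].
        replace (eps * (h * (A / h) ^ 2) * W ^ 2 * h) with (eps * W ^ 2 * A ^ 2)
          by (field; lra).
        easy. }
    assert (H2 : mass x d j <= Q / W ^ 2).
    { apply Rle_trans with (h * A ^ 2).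
      - apply RInt_sq_le; [lra|now apply cdiff_cont, Hdc|].
        intros t Ht; now apply Hdb.
      - apply (proj1 (Rle_div_r _ _ (W ^ 2) HW2)).
        pose proof (pow2_ge_0 A); nra. }
    apply (Rmult_le_compat_l gamma) in H2; [|lra].
    unfold Rdiv in *; lra. }
  assert (Hnd : forall j, (0 <= j <= 2 * M)%nat ->
    (penalty (2 * M) j + / 2 * b (x j)) * jump (2 * M) x d j ^ 2
    <= (1 + B) * Q / W ^ 2).
  { intros j [_ Hj]; destruct (le_lt_dec j M) as [HjM|HjM].
    - rewrite penalty_coarse by easy.
      destruct (Hx (S j) ltac:(lia)) as (Hl & Hlr & Hr).
      destruct (Hloc (S j) ltac:(lia)) as (A & HA & HWA & _ & Hdb).
      replace (S j - 1)%nat with j in Hl, Hlr, Hdb by lia.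
      destruct (Hcoef (x j) ltac:(lra)) as (Hb & _ & _).
      assert (Hjmp : Rabs (jump (2 * M) x d j) <= A).
      { destruct (Nat.eq_dec j 0) as [->|Hj0].
        - rewrite jump_0, Rabs_Ropp; apply Hdb; lra.
        - rewrite jump_interior, Hright, Rminus_0_l, Rabs_Ropp by lia.
          apply Hdb; lra. }
      assert (Hj2 : jump (2 * M) x d j ^ 2 <= Q / W ^ 2).
      { apply Rle_trans with (A ^ 2).
        - rewrite <- pow2_abs; apply pow_incr; split; [apply Rabs_pos|easy].
        - apply (proj1 (Rle_div_r _ _ (W ^ 2) HW2)); lra. }
      unfold Rdiv; rewrite (Rmult_assoc (1 + B)); apply Rmult_le_compat;
        [lra|apply pow2_ge_0|lra|exact Hj2].
    - assert (Hj0 : jump (2 * M) x d j = 0).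
      { destruct (Nat.eq_dec j (2 * M)) as [->|HjN].
        - rewrite jump_N by lia; apply Hright; lia.
        - rewrite jump_interior, Hright by lia.
          assert (H := Hleft (S j) ltac:(lia)).
          replace (S j - 1)%nat with j in H by lia; rewrite H; ring. }
      rewrite Hj0; replace (0 ^ 2) with 0 by ring; rewrite Rmult_0_r.
      now apply Rdiv_le_0_compat. }
  apply sum_le_R in Hel; apply sum_le_R in Hnd.
  rewrite sum_plus_R, !sum_scal_R, sum_const_R in Hel.
  rewrite sum_const_R, Nat.sub_0_r, S_INR in Hnd.
  replace (S (2 * M) - 1)%nat with (2 * M)%nat in Hel by lia.
  fold N in Hel, Hnd; unfold nipg_norm_sq; rewrite broken_int_energy.
  change (broken_int (2 * M) x (fun j t => d j t ^ 2))
    with (sum_n_m (mass x d) 1 (2 * M)).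
  assert ((1 + B) * Q * / W ^ 2 <= N * ((1 + B) * Q * / W ^ 2)).
  { rewrite <- (Rmult_1_l ((1 + B) * Q * / W ^ 2)) at 1.
    apply Rmult_le_compat_r; [apply Rmult_le_pos; lra|easy]. }
  unfold Rdiv in *; lra.
Qed.

Lemma coarse_ok_mono k K K' eps N l r U :
  K <= K' -> l <= r -> coarse_ok k K eps N l r U -> coarse_ok k K' eps N l r U.
Proof.
  intros HK Hlr (T & A & HT & HA & H1 & H2 & H3).
  exists T, A; split; [easy|]; split; [easy|]; split; [lra|]; split.
  - pose proof (Rmult_le_compat_r (r - l) _ _ ltac:(lra) HK); lra.
  - intros x Hx; destruct (H3 x Hx); split; lra.
Qed.

Lemma fine_ok_mono k K K' eps N l r U :
  K <= K' -> l <= r -> fine_ok k K eps N l r U -> fine_ok k K' eps N l r U.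
Proof.
  intros HK Hlr [(T & A & HT & HA & H1 & H2 & H3) (T' & A' & HT' & HA' & H2' & H3')].
  pose proof (Rmult_le_compat_r (r - l) _ _ ltac:(lra) HK); split.
  - exists T, A; split; [easy|]; split; [easy|]; split; [lra|]; split; [lra|].
    intros x Hx; destruct (H3 x Hx); split; lra.
  - exists T', A'; split; [easy|]; split; [easy|]; split; [lra|].
    intros x Hx; destruct (H3' x Hx); split; lra.
Qed.

(** * Passing to extended coefficients and to the extended solution *)

Lemma cont_bounded f : cont f -> exists B, forall t, 0 <= t <= 1 -> Rabs (f t) <= B.
Proof.
  intros Hf; destruct (continuity_ab_maj (fun t => Rabs (f t)) 0 1) as (x & Hx & _).
  - lra.
  - intros c _; apply continuity_pt_filterlim, (cont_Rabs f Hf).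
  - now exists (Rabs (f x)).
Qed.

(** The form sees [b] and [c] only on [0,1], so the discrete equation survives the passage to their
    extensions. *)
Lemma nipg_form_coefficients_ext eps b b' c c' mu N x w v :
  (0 < N)%nat ->
  (forall j, (1 <= j <= N)%nat ->
     0 <= x (j - 1)%nat /\ x (j - 1)%nat <= x j /\ x j <= 1) ->
  (forall t, 0 <= t <= 1 -> b t = b' t) ->
  (forall t, 0 <= t <= 1 -> c t = c' t) ->
  nipg_form eps b c mu N x w v = nipg_form eps b' c' mu N x w v.
Proof.
  intros HN Hx Hb Hc; unfold nipg_form.
  assert (Hx' : forall j, (1 <= j <= N)%nat -> x (j - 1)%nat <= x j)
    by (intros j Hj; now apply Hx).
  rewrite (broken_int_ext N x (fun j t => b t * broken_derive w j t * v j t)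
    (fun j t => b' t * broken_derive w j t * v j t)).
  rewrite (broken_int_ext N x (fun j t => c t * w j t * v j t)
    (fun j t => c' t * w j t * v j t)).
  rewrite (sum_n_m_ext_loc (fun j => b (x j) * jump N x w j * lim_plus x v j)
    (fun j => b' (x j) * jump N x w j * lim_plus x v j)).
  - reflexivity.
  - intros j Hj; rewrite Hb; [easy|].
    destruct (Hx (S j) ltac:(lia)) as (H1 & H2 & H3).
    replace (S j - 1)%nat with j in H1, H2 by lia; lra.
  - easy.
  - intros j t Hj Ht; rewrite Hc; [easy|]; destruct (Hx j Hj) as (H1 & H2 & H3); lra.
  - easy.
  - intros j t Hj Ht; rewrite Hb; [easy|]; destruct (Hx j Hj) as (H1 & H2 & H3); lra.
Qed.

Lemma is_radau_interp_ext k l r u U P :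
  l <= r -> (forall t, l <= t <= r -> u t = U t) ->
  is_radau_interp k l r u P -> is_radau_interp k l r U P.
Proof.
  intros Hlr H (HP & Ho & Hr); split; [easy|]; split.
  - intros v Hv; rewrite (Ho v Hv); apply RInt_ext.
    rewrite Rmin_left, Rmax_right by easy; intros t Ht; rewrite H; [easy|lra].
  - rewrite Hr; apply H; lra.
Qed.

Lemma is_lobatto_interp_ext k s l r u U P :
  lobatto_nodes k s -> l <= r -> (forall t, l <= t <= r -> u t = U t) ->
  is_lobatto_interp k s l r u P -> is_lobatto_interp k s l r U P.
Proof.
  intros Hs Hlr H [HP Hn]; split; [easy|]; intros i Hi si.
  destruct (lobatto_nodes_gap k s Hs) as (_ & _ & _ & Hin).
  specialize (Hin i Hi); rewrite <- H; [now apply Hn|]; unfold si; nra.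
Qed.

Lemma rate_Rpower k N :
  0 < N -> sqrt (N / (N ^ (k + 1)) ^ 2) = Rpower N (- (INR k + 1 / 2)).
Proof.
  intros HN; assert (HW : 0 < N ^ (k + 1)) by now apply pow_lt.
  rewrite sqrt_div_alt by now apply pow_lt.
  rewrite sqrt_pow2 by lra.
  replace (- (INR k + 1 / 2)) with (/ 2 + - INR (k + 1))
    by (rewrite plus_INR; simpl; field).
  rewrite Rpower_plus, Rpower_sqrt, Rpower_Ropp, Rpower_pow by easy.
  reflexivity.
Qed.

Theorem theorem3 :
  forall k : nat, (1 <= k)%nat ->
  exists m q : nat,
  forall (alpha gamma sigma C0 : R) (b c f : R -> R) (s : nat -> R),
  0 < alpha -> 0 < gamma -> INR k + 1 <= sigma ->
  C_class m b -> C_class m c -> C_class m f ->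
  (forall x, 0 <= x <= 1 -> alpha <= b x) ->
  (forall x, 0 < x < 1 -> gamma <= c x - / 2 * Derive b x) ->
  solution_decomposition q alpha b c f ->
  lobatto_nodes k s ->
  exists C : R, 0 < C /\
  forall (eps : R) (N : nat) (u : R -> R) (uN Lu Pu : nat -> R -> R),
  0 < eps < 1 ->
  (4 <= N)%nat -> Nat.Even N ->
  1 / 2 <= tau sigma alpha eps ->
  eps <= C0 * / INR N ->
  bvp_solution eps b c f u ->
  let x := mesh sigma alpha eps N in
  let mu := penalty N in
  nipg_solution k eps b c f mu N x uN ->
  lobatto_interpolant k s N x u Lu ->
  composite_interpolant k s N x u Pu ->
  nipg_norm eps gamma b mu N x (broken_minus Lu uN)
  + nipg_norm eps gamma b mu N x (broken_minus Pu uN)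
  <= C * Rpower (INR N) (- (INR k + 1 / 2)).
Proof.
  (* One derivative of [b] enters through integration by parts; the Taylor polynomials of degree
     [k + 1] on fine elements call for [k + 2] derivatives of the solution. *)
  intros k Hk; exists 1%nat, (k + 2)%nat.
  intros alpha gamma sigma C0 b c f s Ha Hg Hsig Hb Hc _ Hba Hgam Hdec Hs.
  destruct (C_class_extend 1 b Hb) as (bD & Hb1 & Hb2 & Hb3 & Hb4).
  destruct (C_class_extend 1 c Hc) as (cD & _ & Hc2 & Hc3 & _).
  set (b' := bD 0%nat) in *; set (c' := cD 0%nat) in *.
  assert (Hb'd : cdiff b').
  { apply (cdiff_intro _ (bD 1%nat)); [intros; apply Hb1; lia|apply Hb2; lia]. }
  assert (Hc'c : cont c') by (apply Hc2; lia).
  assert (Hb'D : forall t, 0 < t < 1 -> Derive b' t = Derive b t).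
  { intros t Ht; unfold b'; rewrite (is_derive_unique _ _ _ (Hb1 0%nat t (Nat.lt_0_succ 0))).
    exact (Hb4 1%nat t (le_n 1) Ht). }
  destruct (cont_bounded b' (cdiff_cont b' Hb'd)) as (B1 & HB1).
  destruct (cont_bounded _ (cdiff_cont_Derive b' Hb'd)) as (B2 & HB2).
  destruct (cont_bounded (fun t => c' t - Derive b' t)) as (B3 & HB3).
  { apply cont_minus; [easy|now apply cdiff_cont_Derive]. }
  set (B := 1 + Rabs B1 + Rabs B2 + Rabs B3).
  pose proof (Rle_abs B1); pose proof (Rle_abs B2); pose proof (Rle_abs B3).
  pose proof (Rabs_pos B1); pose proof (Rabs_pos B2); pose proof (Rabs_pos B3).
  assert (HB : 1 <= B) by (unfold B; lra).
  assert (Hcoef : coefficients_ok B b' c').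
  { split; [easy|]; split; [easy|]; intros t Ht; split; [split|split].
    - rewrite Hb3 by easy; specialize (Hba t Ht); lra.
    - specialize (HB1 t Ht); pose proof (Rle_abs (b' t)); unfold B; lra.
    - specialize (HB2 t Ht); unfold B; lra.
    - specialize (HB3 t Ht); unfold B; lra. }
  destruct (solution_layer_bounds (k + 2) alpha b c f ltac:(lia) Hdec)
    as (Cd & HCd & Hsplit).
  destruct (mesh_facts k sigma alpha C0 Ha Hsig) as (Km & HKm & Hmesh).
  set (D := Rabs C0 + 1).
  assert (HD : 1 <= D) by (pose proof (Rabs_pos C0); unfold D; lra).
  assert (HCD : C0 <= D) by (pose proof (Rle_abs C0); unfold D; lra).
  set (K0 := Km + D).
  destruct (coarse_approx k alpha Cd K0 D Hk Ha HCd ltac:(unfold K0; lra) HD)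
    as (Kc & HKc & Hco).
  destruct (fine_approx k alpha Cd K0 Hk Ha HCd ltac:(unfold K0; lra))
    as (Kf & HKf & Hfi).
  set (K := K0 + Kc + Kf).
  assert (HK0 : 1 <= K0) by (unfold K0; lra).
  assert (HK : 1 <= K) by (unfold K; lra).
  destruct (galerkin_error k s gamma B K Hk Hs Hg HB HK) as (E1 & HE1 & Hgal).
  destruct (interpolants_difference k s gamma B K Hk Hs Hg HB HK)
    as (E2 & HE2 & Hdif).
  exists (sqrt (2 * E2 + 2 * E1) + sqrt E1 + 1).
  split; [pose proof (sqrt_pos (2 * E2 + 2 * E1)); pose proof (sqrt_pos E1); lra|].
  intros eps N u uN Lu Pu He HN4 [M ->] Htau HC0 Hu x mu HuN HLu HPu.
  assert (HM : (2 <= M)%nat) by lia.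
  destruct (Hsplit eps u He Hu) as (Sm & El & HLB & HuU & Heq).
  set (U := fun t => Sm 0%nat t + El 0%nat t).
  assert (HDer : derivatives (k + 2) (fun i t => Sm i t + El i t))
    by (destruct HLB as (? & ? & _); now apply derivatives_plus).
  assert (HU : cdiff U) by (apply (derivatives_cdiff _ _ 0 HDer); lia).
  assert (HU1 : forall t, Derive U t = Sm 1%nat t + El 1%nat t)
    by (intros t; apply (derivatives_Derive _ _ 0 t HDer); lia).
  assert (HU2 : forall t, Derive (Derive U) t = Sm 2%nat t + El 2%nat t).
  { intros t; rewrite (Derive_ext _ _ t HU1).
    apply (derivatives_Derive _ _ 1 t HDer); lia. }
  assert (HU' : cdiff (Derive U)).
  { apply (cdiff_intro _ (fun t => Sm 2%nat t + El 2%nat t)).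
    - intros t; apply (is_derive_ext (fun t => Sm 1%nat t + El 1%nat t));
        [intros; now rewrite HU1|].
      apply HDer; lia.
    - apply HDer; lia. }
  destruct (Hmesh eps M He HM Htau HC0)
    as (Hx0 & HxN & Hx & Hxc & Hxf & Hlay & Hxt).
  fold x in Hx0, HxN, Hx, Hxc, Hxf, Hlay, Hxt.
  set (N := INR (2 * M)) in *.
  assert (HN : 1 <= N) by (unfold N; apply (le_INR 1); lia).
  assert (HNe : N * eps <= D).
  { apply (Rmult_le_compat_l N) in HC0; [|lra].
    replace (N * (C0 * / N)) with C0 in HC0 by (field; lra); lra. }
  (* The equidistant widths are at least [1 / N], so [eps <= N * eps * h_j <= D * h_j]. *)
  assert (HeD : forall j, (1 <= j <= M)%nat -> eps <= D * (x j - x (j - 1)%nat)).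
  { intros j Hj; specialize (Hxc j Hj); destruct (Hx j ltac:(lia)) as (_ & Hlr & _).
    apply Rle_trans with (N * eps * (x j - x (j - 1)%nat));
      [|apply Rmult_le_compat_r; lra].
    rewrite <- (Rmult_1_r eps) at 1.
    replace (N * eps * (x j - x (j - 1)%nat))
      with (eps * (N * (x j - x (j - 1)%nat))) by ring.
    apply Rmult_le_compat_l; lra. }
  assert (HKmono : forall h : R, 0 <= h -> D * h <= K * h /\ Km * h <= K * h /\
    D * h <= K0 * h /\ Km * h <= K0 * h).
  { intros h Hh; repeat split; apply Rmult_le_compat_r; unfold K, K0; lra. }
  assert (Hmok : mesh_ok K eps M x).
  { split; [easy|]; split; [easy|]; split; [easy|]; split; [easy|].
    split; [intros j Hj; destruct (Hx j Hj) as (? & ? & ? & _); lra|]; split.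
    - intros j Hj; specialize (HeD j Hj); destruct (Hx j ltac:(lia)) as (_ & Hlr & _).
      destruct (HKmono (x j - x (j - 1)%nat)); lra.
    - intros j Hj; destruct (Hxf j Hj) as [H' _].
      destruct (HKmono eps) as (_ & H'' & _); lra. }
  assert (Haok : approx_ok k K eps M x U).
  { split; intros j Hj; destruct (Hx j ltac:(lia)) as (Hl & Hlr & Hr & HNh).
    - apply (coarse_ok_mono k Kc); [unfold K; lra|lra|].
      apply (Hco eps N (x (j - 1)%nat) (x j) Sm El); auto.
      + unfold K0; lra.
      + specialize (Hlay j ltac:(lia)); unfold K0; lra.
      + intros Hhalf; destruct (HKmono (x j - x (j - 1)%nat)) as (_ & _ & H1' & H2');
          [lra|].
        destruct (Nat.eq_dec j (M + 1)) as [->|Hne].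
        * specialize (Hxt Hhalf); lra.
        * specialize (HeD j ltac:(lia)); lra.
    - apply (fine_ok_mono k Kf); [unfold K; lra|lra|].
      apply (Hfi eps N (x (j - 1)%nat) (x j) Sm El); auto.
      + unfold K0; lra.
      + intros n Hn; destruct (Hxf j Hj) as [_ H'].
        eapply Rle_trans; [apply (H' n Hn)|].
        destruct (HKmono eps) as (_ & _ & _ & H''); [lra|].
        apply pow_incr; split; [apply Rmult_le_pos; lra|easy]. }
  assert (HuU' : forall j t, (1 <= j <= 2 * M)%nat -> x (j - 1)%nat <= t <= x j ->
    u t = U t).
  { intros j t Hj Ht; apply HuU; destruct (Hx j Hj) as (? & ? & ? & _); lra. }
  assert (HL : lobatto_interpolant k s (2 * M) x U Lu).
  { intros j Hj; destruct (Hx j Hj) as (_ & Hlr & _).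
    apply (is_lobatto_interp_ext k s _ _ u); auto; [lra|].
    intros t; now apply HuU'. }
  assert (HP : composite_interpolant k s (2 * M) x U Pu).
  { destruct HPu as [HP1 HP2]; pose proof (half_double M).
    split; intros j Hj; destruct (Hx j ltac:(lia)) as (_ & Hlr & _).
    - apply (is_radau_interp_ext k _ _ u); auto; [lra|].
      intros t; apply HuU'; lia.
    - apply (is_lobatto_interp_ext k s _ _ u); auto; [lra|].
      intros t; apply HuU'; lia. }
  assert (Hxle : forall j, (1 <= j <= 2 * M)%nat ->
    0 <= x (j - 1)%nat /\ x (j - 1)%nat <= x j /\ x j <= 1).
  { intros j Hj; destruct (Hx j Hj) as (? & ? & ? & _); lra. }
  assert (Hxin : forall j, (j <= 2 * M)%nat -> 0 <= x j <= 1).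
  { intros j Hj; destruct (Nat.eq_dec j 0) as [->|Hj0]; [rewrite Hx0; lra|].
    destruct (Hxle j ltac:(lia)); lra. }
  assert (HuN' : nipg_solution k eps b' c' f mu (2 * M) x uN).
  { destruct HuN as [HuN1 HuN2]; split; [easy|]; intros v Hv.
    rewrite <- (HuN2 v Hv); apply nipg_form_coefficients_ext; auto; lia. }
  assert (Hnorm : forall v, nipg_norm eps gamma b mu (2 * M) x v
    = sqrt (nipg_norm_sq eps gamma b' mu (2 * M) x v)).
  { intros v; unfold nipg_norm, nipg_norm_sq; f_equal; f_equal.
    apply sum_n_m_ext_loc; intros j [_ Hj]; rewrite Hb3 by now apply Hxin.
    reflexivity. }
  destruct Hu as (_ & _ & Hu0 & Hu1).
  assert (HG := Hgal eps M x b' c' f U Pu uN Hmok Haok Hcoef HU HU').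
  specialize (HG (eq_trans (eq_sym (HuU 0 ltac:(lra))) Hu0)).
  specialize (HG (eq_trans (eq_sym (HuU 1 ltac:(lra))) Hu1)).
  assert (HGe : forall t, 0 < t < 1 ->
    - eps * Derive (Derive U) t + b' t * Derive U t + c' t * U t = f t).
  { intros t Ht; rewrite <- (Heq t Ht), HU1, HU2, Hb3, Hc3 by lra; reflexivity. }
  assert (HGg : forall t, 0 < t < 1 -> gamma <= c' t - / 2 * Derive b' t).
  { intros t Ht; rewrite Hb'D, Hc3 by lra; auto. }
  specialize (HG HGe HGg HP HuN').
  assert (HDf := Hdif eps M x b' c' U Lu Pu Hmok Haok Hcoef HU HL HP).
  cbv zeta in HG, HDf; fold N mu in HG, HDf.
  set (rate := N / (N ^ (k + 1)) ^ 2) in *.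
  assert (HT : nipg_norm_sq eps gamma b' mu (2 * M) x (broken_minus Lu uN)
    <= (2 * E2 + 2 * E1) * rate).
  { eapply Rle_trans; [apply (nipg_norm_sq_triangle _ _ _ _ _ _ Lu Pu uN)|].
    - lra.
    - lra.
    - intros j Hj; destruct Hcoef as (_ & _ & Hcf).
      destruct (Hcf (x j) (Hxin j Hj)).
      pose proof (penalty_pos (2 * M) j ltac:(lia)); unfold mu; lra.
    - intros j Hj; now apply Hxle.
    - intros j Hj; apply (poly_le_cdiff k), (HL j Hj).
    - intros j Hj; apply (poly_le_cdiff k), (composite_poly k s M x U Pu j HP Hj).
    - intros j Hj; destruct HuN as [HuN1 _]; apply (poly_le_cdiff k), HuN1, Hj.
    - lra. }
  rewrite !Hnorm, <- rate_Rpower by lra; fold rate.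
  apply sqrt_le_1_alt in HT; apply sqrt_le_1_alt in HG.
  rewrite sqrt_mult_alt in HT, HG by lra.
  pose proof (sqrt_pos rate); lra.
Qed.
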